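(* Let $\sigma>1$, and for $\tau>0$ let $M_p^{\tau,\sigma}=p^{\tau p^\sigma}$ for $p\in\mathbb N$, $M_0^{\tau,\sigma}=1$, and let $\mathcal M_\sigma=\{(M_p^{\tau,\sigma})_{p\in\mathbb N_0}:\tau>0\}$. The following holds both in the Roumieu case ($[\mathcal M_\sigma]=\{\mathcal M_\sigma\}$) and in the Beurling case ($[\mathcal M_\sigma]=(\mathcal M_\sigma)$). For $f,g\in L^2(\mathbb R^n)$ let $TFR=\{R_gf,\,V_gf,\,W(f,g),\,A(f,g)\}$ be the set consisting of the Grossmann-Royer transform, the short-time Fourier transform, the cross-Wigner distribution and the cross-ambiguity function of $f$ and $g$. If $f,g\in\mathcal S_{[\mathcal M_\sigma]}^{[\mathcal M_\sigma]}(\mathbb R^n)$ and $T\in TFR$, then $T\in\mathcal S_{[\mathcal M_\sigma]}^{[\mathcal M_\sigma]}(\mathbb R^{2n})$. Conversely, if $f,g\in L^2(\mathbb R^n)$, $T\in TFR$ and $T\in\mathcal S_{[\mathcal M_\sigma]}^{[\mathcal M_\sigma]}(\mathbb R^{2n})$, then $f,g\in\mathcal S_{[\mathcal M_\sigma]}^{[\mathcal M_\sigma]}(\mathbb R^n)$.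
   Context: For $d\in\mathbb N$ (used with $d=n$ and $d=2n$) and $\varphi\in C^\infty(\mathbb R^d)$: - $\varphi\in\mathcal S_{\{\mathcal M_\sigma\}}^{\{\mathcal M_\sigma\}}(\mathbb R^d)$ iff $(\exists\tau>0)(\exists C>0)(\forall\alpha,\beta\in\mathbb N_0^d)\ \sup_{x\in\mathbb R^d}|x^\alpha\partial^\beta\varphi(x)|\le C M^{\tau,\sigma}_{|\alpha|}M^{\tau,\sigma}_{|\beta|}$. - $\varphi\in\mathcal S_{(\mathcal M_\sigma)}^{(\mathcal M_\sigma)}(\mathbb R^d)$ iff $(\forall\tau>0)(\exists C>0)(\forall\alpha,\beta\in\mathbb N_0^d)\ \sup_{x\in\mathbb R^d}|x^\alpha\partial^\beta\varphi(x)|\le C M^{\tau,\sigma}_{|\alpha|}M^{\tau,\sigma}_{|\beta|}$. For $f,g\in L^2(\mathbb R^n)$ and $x,\omega\in\mathbb R^n$ (integrals over $\mathbb R^n$, products such as $\omega t$ are Euclidean inner products): - Grossmann-Royer transform: $R_gf(x,\omega)=\int e^{4\pi i\omega(t-x)}f(2x-t)\overline{g(t)}\,dt$; - short-time Fourier transform: $V_gf(x,\omega)=\int e^{-2\pi i t\omega}f(t)\overline{g(t-x)}\,dt$; - cross-Wigner distribution: $W(f,g)(x,\omega)=\int e^{-2\pi i\omega t}f(x+\tfrac t2)\overline{g(x-\tfrac t2)}\,dt$; - cross-ambiguity function: $A(f,g)(x,\omega)=\int e^{-2\pi i\omega t}f(t+\tfrac x2)\overline{g(t-\tfrac x2)}\,dt$.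 An element of $L^2(\mathbb R^n)$ is said to belong to $\mathcal S_{[\mathcal M_\sigma]}^{[\mathcal M_\sigma]}(\mathbb R^n)$ if it coincides almost everywhere with a function in that space.
   Formalization: In the converse, f and g are additionally assumed not to vanish almost everywhere; without this the claim fails, since f = 0 makes every T in TFR equal to 0 while g in L^2 is arbitrary. *)

(* Defs.v *)
From HB Require Import structures.
From mathcomp Require Import all_boot all_order all_algebra.
From mathcomp Require Import complex.
From mathcomp Require Import all_classical all_reals all_analysis.

Set Implicit Arguments.
Unset Strict Implicit.
Unset Printing Implicit Defensive.

Import Order.TTheory GRing.Theory Num.Theory.
Import numFieldNormedType.Exports.
Import Normc.

Local Open Scope classical_set_scope.
Local Open Scope ring_scope.
Local Open Scope complex_scope.

(* The product sigma-algebra on 'rV[R]_n, generated by the coordinates; as in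
   the library's instance on n.-tuple T, but on the type that already carries
   the normed space structure. It is the Borel sigma-algebra of R^n. *)
Definition measure_rV_display : measure_display -> measure_display.
Proof. exact. Qed.

Section measurable_rV.
Context {R : realType} {n : nat}.

Let coord (i : 'I_n) (x : 'rV[R]_n) : R := x 0 i.

Let rV_set0 : g_sigma_preimage coord set0.
Proof. exact: sigma_algebra0. Qed.

Let rV_setC A : g_sigma_preimage coord A -> g_sigma_preimage coord (~` A).
Proof. exact: sigma_algebraC. Qed.

Let rV_bigcup (F : (set 'rV[R]_n)^nat) :
  (forall i, g_sigma_preimage coord (F i)) ->
  g_sigma_preimage coord (\bigcup_i (F i)).
Proof. exact: sigma_algebra_bigcup. Qed.

HB.instance Definition _ := @isMeasurable.Build
  (measure_rV_display default_measure_display)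
  'rV[R]_n (g_sigma_preimage coord) rV_set0 rV_setC rV_bigcup.

Lemma measurable_rV_coord (i : 'I_n) :
  measurable_fun [set: 'rV[R]_n] (fun x => x 0 i).
Proof.
move=> _ Y mY; rewrite setTI; apply: sub_sigma_algebra => /=.
rewrite -bigcup_seq/=; exists i => /=; first by rewrite mem_index_enum.
by exists Y => //; rewrite setTI.
Qed.

Lemma measurable_fun_rV d (T : measurableType d) (f : T -> 'rV[R]_n) :
  (forall i, measurable_fun [set: T] (fun t => f t 0 i)) ->
  measurable_fun [set: T] f.
Proof.
move=> mf.
suff H : g_sigma_preimage (fun i => coord i \o f) `<=` measurable.
  rewrite g_sigma_preimage_comp in H.
  by move=> _ A mA; apply: H; exists A.
apply: smallest_sub; first exact: sigma_algebra_measurable.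
move=> A; rewrite -bigcup_seq => -[i /= _ [B mB <-]].
exact: mf.
Qed.

End measurable_rV.

(* Lebesgue measure on R^n, by recursion on n through R^(1+n) = R x R^n. *)
Section lebesgue_rV.
Context {R : realType}.

Definition rV_cons n (p : measurableTypeR R * 'rV[R]_n) : 'rV[R]_n.+1 :=
  row_mx (p.1 : R)%:M p.2 : 'rV[R]_(1 + n).

Definition rV_uncons n (x : 'rV[R]_n.+1) : measurableTypeR R * 'rV[R]_n :=
  (x 0 0, \row_i x 0 (lift ord0 i)).

Lemma rV_consE n p i : @rV_cons n p 0 i =
  if unlift ord0 i is Some j then p.2 0 j else p.1.
Proof.
case: unliftP => [j ->|->].
  rewrite (_ : lift ord0 j = rshift 1 j); last exact/val_inj.
  exact: (@row_mxEr R 1 1 n (p.1)%:M p.2 0 j).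
rewrite (_ : ord0 = lshift n (ord0 : 'I_1)); last exact/val_inj.
apply: etrans (@row_mxEl R 1 1 n (p.1)%:M p.2 0 0) _.
by rewrite mxE eqxx mulr1n.
Qed.

Lemma rV_consK n : cancel (@rV_cons n) (@rV_uncons n).
Proof.
move=> [a v]; rewrite /rV_uncons; congr pair; first by rewrite rV_consE unlift_none.
by apply/rowP => i; rewrite mxE rV_consE liftK.
Qed.

Lemma measurable_rV_cons n : measurable_fun setT (@rV_cons n).
Proof.
apply: measurable_fun_rV => i.
under eq_fun do rewrite rV_consE.
case: unlift => [j|]; last exact: measurable_fst.
exact: (measurableT_comp (measurable_rV_coord j) measurable_snd).
Qed.

Lemma measurable_rV_uncons n : measurable_fun setT (@rV_uncons n).
Proof.
apply: measurable_fun_pair; first exact: measurable_rV_coord.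
apply: measurable_fun_rV => i; under eq_fun do rewrite mxE.
exact: measurable_rV_coord.
Qed.

Section step.
Context {n : nat}.
Variable m : {sigma_finite_measure set 'rV[R]_n -> \bar R}.

Definition lebesgue_rV_step : set 'rV[R]_n.+1 -> \bar R :=
  pushforward (lebesgue_measure \x m)%E (@rV_cons n).

Let measurable_preimage A :
  measurable A -> measurable (@rV_cons n @^-1` A).
Proof. by move=> mA; rewrite -[X in measurable X]setTI; exact: measurable_rV_cons. Qed.

Let step0 : lebesgue_rV_step set0 = 0%E.
Proof. by rewrite /lebesgue_rV_step /pushforward preimage_set0 measure0. Qed.

Let step_ge0 A : (0 <= lebesgue_rV_step A)%E.
Proof. by rewrite /lebesgue_rV_step /pushforward; exact: measure_ge0. Qed.

Let step_sigma_additive : semi_sigma_additive lebesgue_rV_step.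
Proof.
move=> F mF tF mUF; rewrite /lebesgue_rV_step /pushforward preimage_bigcup.
apply: measure_semi_sigma_additive.
- by move=> k; exact: measurable_preimage.
- apply/trivIsetP => /= i j _ _ ij; rewrite -preimage_setI.
  by move/trivIsetP : tF => /(_ _ _ _ _ ij) ->//; rewrite preimage_set0.
- by rewrite -preimage_bigcup; exact: measurable_preimage.
Qed.

HB.instance Definition _ := isMeasure.Build _ _ _
  lebesgue_rV_step step0 step_ge0 step_sigma_additive.

Let step_sigma_finite : sigma_finite setT lebesgue_rV_step.
Proof.
have /sigma_finiteP[F [FT ndF Foo]] := sigma_finiteT (@lebesgue_measure R).
have /sigma_finiteP[G [GT ndG Goo]] := sigma_finiteT m.
exists (fun k => @rV_uncons n @^-1` (F k `*` G k)).
  rewrite -preimage_bigcup -[LHS](preimage_setT (@rV_uncons n)).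
  congr (_ @^-1` _); rewrite -setXTT FT GT predeqE => -[x y]; split.
    move=> [/= [i _ Fx] [j _ Gy]]; exists (maxn i j) => //; split.
    - by move: x Fx; exact/subsetPset/ndF/leq_maxl.
    - by move: y Gy; exact/subsetPset/ndG/leq_maxr.
  by move=> [i _ []/= ? ?]; split; exists i.
move=> k; have [mF Fk] := Foo k; have [mG Gk] := Goo k; split.
  rewrite -[X in measurable X]setTI.
  by apply: measurable_rV_uncons => //; exact: measurableX.
rewrite /lebesgue_rV_step /pushforward -comp_preimage.
rewrite (_ : _ \o _ = id); last by apply/funext => p /=; rewrite rV_consK.
by rewrite preimage_id product_measure1E// lte_mul_pinfty// ge0_fin_numE.
Qed.

HB.instance Definition _ :=
  Measure_isSigmaFinite.Build _ _ _ lebesgue_rV_step step_sigma_finite.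

End step.

Fixpoint lebesgue_rV (n : nat) : {sigma_finite_measure set 'rV[R]_n -> \bar R} :=
  match n with
  | 0 => dirac (0 : 'rV[R]_0)
  | m.+1 => lebesgue_rV_step (lebesgue_rV m)
  end.

Lemma lebesgue_rV_box n (A : 'I_n -> set R) :
  (forall i, measurable (A i)) ->
  lebesgue_rV n [set x | forall i, A i (x 0 i)] =
  (\prod_(i < n) lebesgue_measure (A i))%E.
Proof.
elim: n A => [|n IH] A mA.
  by rewrite big_ord0 /= diracE mem_set// => -[].
rewrite big_ord_recl -(IH (fun i => A (lift ord0 i)))//.
pose B : set 'rV[R]_n := [set x | forall i, A (lift ord0 i) (x 0 i)].
have AB : @rV_cons n @^-1` [set x | forall i, A i (x 0 i)] = A ord0 `*` B.
  apply/seteqP; split=> [[a v] /= H|[a v] /= [H0 H1] i].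
    split; first by have := H ord0; rewrite rV_consE unlift_none.
    by move=> i; have := H (lift ord0 i); rewrite rV_consE liftK.
  by rewrite rV_consE; case: unliftP => [j ->|->]; [exact: H1|].
have mB : measurable B.
  rewrite (_ : B =
    \big[setI/setT]_(i < n) ((fun x : 'rV[R]_n => x 0 i) @^-1` A (lift ord0 i))).
    apply: bigsetI_measurable => i _; rewrite -[X in measurable X]setTI.
    exact: measurable_rV_coord.
  apply/seteqP; split=> x /=; rewrite -bigcap_seq/=.
    by move=> H i _; exact: H.
  by move=> H i; apply: H; exact: mem_index_enum.
transitivity ((lebesgue_measure \x lebesgue_rV n)%E
    (@rV_cons n @^-1` [set x | forall i, A i (x 0 i)])); first by [].
by rewrite AB product_measure1E//; exact: mA.
Qed.

End lebesgue_rV.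

Section function_spaces.
Context {R : realType}.
Local Notation Re := (@complex.Re R).
Local Notation Im := (@complex.Im R).

(* Square-integrability is required of the real and imaginary parts, which are
   Borel measurable: every class in L^2(R^n) has such representatives. *)
Definition L2 n (f : 'rV[R]_n -> R[i]) : Prop :=
  (Re \o f) \in Lfun (lebesgue_rV n) 2%:E /\
  (Im \o f) \in Lfun (lebesgue_rV n) 2%:E.

Definition pderiv d (i : 'I_d) (phi : 'rV[R]_d -> R[i]) (x : 'rV[R]_d) : R[i] :=
  ('D_(delta_mx 0 i) (Re \o phi) x) +i*
  ('D_(delta_mx 0 i) (Im \o phi) x).

Definition C1 d (phi : 'rV[R]_d -> R) : Prop :=
  [/\ forall i x, derivable phi x (delta_mx 0 i),
      continuous phi &
      forall i, continuous (fun x => 'D_(delta_mx 0 i) phi x)].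

(* C^oo: every iterated partial derivative, in any order, is of class C^1. *)
Definition smooth d (phi : 'rV[R]_d -> R[i]) : Prop :=
  forall s : seq 'I_d,
    let psi := foldr (@pderiv d) phi s in
    C1 (Re \o psi) /\ C1 (Im \o psi).

Definition mabs d (alpha : 'I_d -> nat) : nat := (\sum_i alpha i)%N.

Definition monomial d (alpha : 'I_d -> nat) (x : 'rV[R]_d) : R :=
  \prod_i x 0 i ^+ alpha i.

Definition mderiv d (beta : 'I_d -> nat) (phi : 'rV[R]_d -> R[i]) :
    'rV[R]_d -> R[i] :=
  foldr (fun i psi => iter (beta i) (pderiv i) psi) phi (enum 'I_d).

Definition Mseq (tau sigma : R) (p : nat) : R :=
  if p == 0%N then 1 else p%:R `^ (tau * p%:R `^ sigma).

Definition ultra_bound d (sigma tau C : R) (phi : 'rV[R]_d -> R[i]) : Prop :=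
  forall alpha beta : 'I_d -> nat,
    (ereal_sup [set (normc ((monomial alpha x)%:C * mderiv beta phi x))%:E
               | x in [set: 'rV[R]_d]]
     <= (C * Mseq tau sigma (mabs alpha) * Mseq tau sigma (mabs beta))%:E)%E.

Variant ultra_case := Roumieu | Beurling.

Definition in_S (c : ultra_case) (sigma : R) d (phi : 'rV[R]_d -> R[i]) : Prop :=
  smooth phi /\
  match c with
  | Roumieu => exists2 tau : R, 0 < tau &
               exists2 C : R, 0 < C & ultra_bound sigma tau C phi
  | Beurling => forall tau : R, 0 < tau ->
                exists2 C : R, 0 < C & ultra_bound sigma tau C phi
  end.

Definition in_S_ae (c : ultra_case) (sigma : R) n (f : 'rV[R]_n -> R[i]) : Prop :=
  exists2 phi : 'rV[R]_n -> R[i],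
    in_S c sigma phi & {ae lebesgue_rV n, forall x, f x = phi x}.

End function_spaces.

Section time_frequency_representations.
Context {R : realType} {n : nat}.
Local Notation Re := (@complex.Re R).
Local Notation Im := (@complex.Im R).
Implicit Types (f g : 'rV[R]_n -> R[i]) (z : 'rV[R]_(n + n)).

Definition dot (x y : 'rV[R]_n) : R := \sum_i x 0 i * y 0 i.

Definition expi (t : R) : R[i] := cos t +i* sin t.

Definition cintegral (h : 'rV[R]_n -> R[i]) : R[i] :=
  (\int[lebesgue_rV n]_t Re (h t)) +i*
  (\int[lebesgue_rV n]_t Im (h t)).

(* A point (x, omega) of R^(2n) is the row vector z = row_mx x omega. *)

Definition grossmann_royer g f z : R[i] :=
  let x := lsubmx z in let omega := rsubmx z in
  cintegral (fun t =>
    expi (4 * pi * dot omega (t - x)) * f (2 *: x - t) * (g t)^*).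

Definition stft g f z : R[i] :=
  let x := lsubmx z in let omega := rsubmx z in
  cintegral (fun t =>
    expi (- (2 * pi * dot t omega)) * f t * (g (t - x))^*).

Definition cross_wigner f g z : R[i] :=
  let x := lsubmx z in let omega := rsubmx z in
  cintegral (fun t =>
    expi (- (2 * pi * dot omega t)) *
    f (x + 2^-1 *: t) * (g (x - 2^-1 *: t))^*).

Definition cross_ambiguity f g z : R[i] :=
  let x := lsubmx z in let omega := rsubmx z in
  cintegral (fun t =>
    expi (- (2 * pi * dot omega t)) *
    f (t + 2^-1 *: x) * (g (t - 2^-1 *: x))^*).

Definition TFR f g : set ('rV[R]_(n + n) -> R[i]) :=
  [set grossmann_royer g f; stft g f; cross_wigner f g; cross_ambiguity f g].

End time_frequency_representations.

(* Main.v *)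
Require Import Defs.
From HB Require Import structures.
From mathcomp Require Import all_boot all_order all_algebra.
From mathcomp Require Import complex.
From mathcomp Require Import all_classical all_reals all_analysis.
From mathcomp Require Import measurable_realfun.
From mathcomp Require Import ring lra zify.

Set Implicit Arguments.
Unset Strict Implicit.
Unset Printing Implicit Defensive.

Import Order.TTheory GRing.Theory Num.Theory.
Import numFieldNormedType.Exports.
Import Normc.

Local Open Scope classical_set_scope.
Local Open Scope ring_scope.
Local Open Scope complex_scope.


(** The four representations are one transform. For scalars a, b, c, e put
    [tfr a b c e f g (x, w) = int exp(-2 pi i w.t) f(ax+bt) conj(g(cx+et)) dt];
    the short-time Fourier transform, the cross-Wigner distribution and the
    cross-ambiguity function are instances with [b, e, ae-bc] nonzero, and the
    Grossmann-Royer transform is [2^-n] times the cross-Wigner distribution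
    ([TFR_tfr]). So [tfr] is a tensor product f (x) conj g, followed by an
    invertible linear change of variables, followed by a Fourier transform in
    half of the variables.

    Regularity is preserved by each of these steps. A function belongs to the
    space exactly when it is smooth and the sup norms of all words of length at
    most N in the multiplications [x_i] and the derivatives [d_i], in any order,
    are dominated by a sequence [u N] that is at most [C * Mseq tau sigma N], for
    some or for all tau ([in_S_word_class], [word_class_in_S]). Two properties of
    the sequences matter: [Mseq_split], which trades [p + q] against p and q
    separately at the price of a constant factor on tau, and [Mseq_absorb], which
    absorbs geometric and factorial growth because sigma > 1. In this form the
    closure properties are short: a word applied to a tensor product is a tensor
    product of words; an affine pullback costs a factor [K^N] ([wbound_affine]);
    and the partial Fourier transform maps a letter to a multiple of a letter
    ([act_pft]), by differentiation under the integral and integration by parts,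
    so that it costs a factor [K^N] and the 2n extra letters that make the
    integral converge ([wbound_pft], [tame_shift]). This gives the direct part;
    modifying f and g on null sets does not change the transform ([ae_eq_tfr]).

    For the converse let T be one of the transforms of two square integrable
    functions. For each x the function [t |-> f(ax+bt) conj(g(cx+et))] is
    integrable and its Fourier transform [T(x, .)] is integrable too, so Fourier
    inversion ([fourier_inversion]) recovers it for almost every t from the
    inverse partial transform of T. Undoing the change of variables, with
    Tonelli's theorem to exchange the almost everywhere quantifiers ([ae_swap]),
    gives a function K in the space with [f(u) conj(g(v)) = K(u, v)] for almost
    all u and v ([ae_tensor_pft]). As g is not almost everywhere zero, some v with
    [g v != 0] is such that f agrees almost everywhere with the slice [K(., v)] up
    to a constant, and likewise for g.

    Inversion itself is proved by damping the inverse transform with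
    [exp(-2 pi eps |w_i|)] in each variable, whose Fourier transform is a product
    of Poisson kernels ([cint_poisson]): the damped inverse transforms tend
    pointwise to the inverse transform, and weakly, against bounded continuous
    integrable functions, to the original function ([cvg_poisson_smoothing]);
    such test functions separate integrable functions ([test_fun_separate]). *)
(** * Growth of the defining sequences *)

Section growth.
Context {R : realType}.
Variable sigma : R.
Hypothesis sigma_gt1 : 1 < sigma.
Implicit Types (tau A B : R) (p q N : nat) (u v : nat -> R).

Lemma MseqS tau p :
  Mseq tau sigma p.+1 = p.+1%:R `^ (tau * p.+1%:R `^ sigma).
Proof. by []. Qed.

Lemma MseqE tau p : (0 < p)%N -> Mseq tau sigma p = p%:R `^ (tau * p%:R `^ sigma).
Proof. by case: p. Qed.

Lemma Mseq_gt0 tau p : 0 < Mseq tau sigma p.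
Proof. by case: p => [|p]; rewrite ?ltr01// MseqS powR_gt0. Qed.

Lemma Mseq_ge1 tau p : 0 <= tau -> 1 <= Mseq tau sigma p.
Proof.
move=> t0; case: p => [|p]//.
rewrite MseqS -[leLHS](powRr0 p.+1%:R) ler_powR ?ler1n//.
by rewrite mulr_ge0 ?powR_ge0.
Qed.

Lemma MseqD tau1 tau2 p :
  Mseq (tau1 + tau2) sigma p = Mseq tau1 sigma p * Mseq tau2 sigma p.
Proof.
case: p => [|p]; first by rewrite /Mseq/= mulr1.
rewrite !MseqS mulrDl powRD//.
by apply/implyP => /eqP _; rewrite pnatr_eq0.
Qed.

Lemma ler_Mseq tau p q : 0 <= tau -> (p <= q)%N ->
  Mseq tau sigma p <= Mseq tau sigma q.
Proof.
move=> t0; case: p => [|p]; first by move=> _; exact: Mseq_ge1.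
case: q => // q pq; rewrite !MseqS.
have pq' : p.+1%:R <= q.+1%:R :> R by rewrite ler_nat.
apply: (@le_trans _ _ (q.+1%:R `^ (tau * p.+1%:R `^ sigma))).
  by apply: ge0_ler_powR; rewrite ?nnegrE// mulr_ge0 ?powR_ge0.
rewrite ler_powR ?ler1n// ler_wpM2l// ge0_ler_powR ?nnegrE//.
by rewrite (le_trans ler01)// ltW.
Qed.

Definition split_factor : R := 2 * 2 `^ sigma.

Lemma split_factor_gt0 : 0 < split_factor.
Proof. by rewrite mulr_gt0 ?powR_gt0. Qed.

(** Doubling the index multiplies the exponent p^sigma by 2^sigma and replaces
    the base p by 2p <= p^2, whence the factor 2 * 2^sigma on tau. *)
Lemma Mseq_double tau p : 0 <= tau -> (1 < p)%N ->
  Mseq tau sigma (2 * p) <= Mseq (split_factor * tau) sigma p.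
Proof.
move=> t0 p1; have p0 : (0 < p)%N by exact: ltnW.
rewrite !MseqE ?muln_gt0//.
have -> : split_factor * tau * p%:R `^ sigma = 2 * (tau * (2 * p)%:R `^ sigma).
  by rewrite /split_factor natrM powRM//; ring.
rewrite [leRHS]powRrM; apply: ge0_ler_powR; rewrite ?nnegrE//.
  by rewrite mulr_ge0 ?powR_ge0.
by rewrite powR_mulrn// -natrX ler_nat -mulnn leq_mul.
Qed.

(** The larger index absorbs p + q <= 2 max(p, q); the constant pays for indices
    at most 1, where doubling is not available. *)
Lemma Mseq_split tau : 0 < tau -> exists2 C : R, 0 < C & forall p q,
  Mseq tau sigma (p + q) <=
  C * Mseq (split_factor * tau) sigma p * Mseq (split_factor * tau) sigma q.
Proof.
move=> t0; have kt0 : 0 <= split_factor * tau by rewrite mulr_ge0 ?ltW// split_factor_gt0.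
exists (Mseq tau sigma 2); first exact: Mseq_gt0.
have M2 := Mseq_ge1 2 (ltW t0).
have M0 p := Mseq_ge1 p kt0.
suff wlg p q : (p <= q)%N -> Mseq tau sigma (p + q) <=
  Mseq tau sigma 2 * Mseq (split_factor * tau) sigma p *
  Mseq (split_factor * tau) sigma q.
  move=> p q; have [/wlg//|/ltnW/wlg] := leqP p q.
  by rewrite addnC mulrAC.
move=> pq; have [q1|q1] := leqP q 1.
  apply: (@le_trans _ _ (Mseq tau sigma 2)); first by apply: ler_Mseq; rewrite ?ltW//; lia.
  by rewrite -mulrA ler_peMr ?mulr_ege1// (le_trans ler01).
apply: (@le_trans _ _ (Mseq tau sigma (2 * q))).
  by apply: ler_Mseq; rewrite ?ltW//; lia.
apply: (le_trans (Mseq_double (ltW t0) q1)).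
by rewrite ler_peMl ?mulr_ege1// (le_trans ler01).
Qed.

(** Since sigma > 1, the exponent tau * N^sigma beats every multiple of N, so
    geometric and factorial factors cost only an arbitrarily small tau. *)
Lemma Mseq_absorb tau A : 0 < tau -> 1 <= A ->
  exists2 C : R, 0 < C & forall N, A ^+ N * N%:R ^+ N <= C * Mseq tau sigma N.
Proof.
move=> t0 A1.
have A0 : 0 <= A by rewrite (le_trans ler01).
pose e := sigma - 1; have e0 : 0 < e by rewrite subr_gt0.
pose B : R := (2 / tau) `^ e^-1.
pose K := (Num.trunc (Num.max A B)).+1.
have KA : A <= K%:R.
  by rewrite (le_trans _ (ltW (truncnS_gt _)))// le_max lexx.
have KB : B <= K%:R.
  by rewrite (le_trans _ (ltW (truncnS_gt _)))// le_max lexx orbT.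
exists (A ^+ K * K%:R ^+ K).
  by rewrite mulr_gt0 ?exprn_gt0// (lt_le_trans ltr01).
have AK1 : 1 <= A ^+ K * K%:R ^+ K by rewrite mulr_ege1 ?exprn_ege1// ler1n.
move=> N; have [NK|KN] := leqP N K.
  rewrite -[leLHS]mulr1 ler_pM ?mulr_ge0 ?exprn_ge0 ?Mseq_ge1 ?(ltW t0)//.
  rewrite ler_pM ?exprn_ge0 ?ler_weXn2l//.
  case: N NK => [|N] NK; first by rewrite expr0 exprn_ege1// ler1n.
  by rewrite (@le_trans _ _ (N.+1%:R ^+ K))// ?ler_weXn2l ?ler1n// lerXn2r ?nnegrE// ler_nat.
rewrite -[leLHS]mul1r ler_pM ?mulr_ge0 ?exprn_ge0//.
have N0 : (0 < N)%N by exact: leq_ltn_trans KN.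
have NR : K%:R <= N%:R :> R by rewrite ler_nat ltnW.
apply: (@le_trans _ _ (N%:R ^+ (2 * N))).
  rewrite -exprMn exprM lerXn2r ?nnegrE ?mulr_ge0 ?exprn_ge0//.
  by rewrite expr2 ler_wpM2r// (le_trans KA).
rewrite MseqE// -powR_mulrn// ler_powR ?ler1n//.
rewrite natrM.
have -> : sigma = e + 1 by rewrite /e subrK.
rewrite powRD; last by apply/implyP => _; rewrite pnatr_eq0 -lt0n.
rewrite powRr1// mulrA ler_wpM2r//.
rewrite -ler_pdivrMl// mulrC.
have -> : 2 / tau = B `^ e.
  by rewrite /B -powRrM mulVf ?gt_eqF// powRr1// divr_ge0 ?ltW.
apply: ge0_ler_powR; rewrite ?nnegrE ?powR_ge0 ?(ltW e0)//.
exact: le_trans KB NR.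
Qed.

(** The two quantifications over tau in the definition of the spaces, as one
    condition on a sequence that dominates all derivatives and moments. *)
Definition tame (c : ultra_case) u : Prop :=
  match c with
  | Roumieu => exists2 tau : R, 0 < tau &
               exists2 C : R, 0 < C & forall N, u N <= C * Mseq tau sigma N
  | Beurling => forall tau : R, 0 < tau ->
                exists2 C : R, 0 < C & forall N, u N <= C * Mseq tau sigma N
  end.

Lemma tame_le c u v : (forall N, u N <= v N) -> tame c v -> tame c u.
Proof.
move=> uv; case: c => [[tau t0 [C C0 vC]]|vC tau t0].
  by exists tau => //; exists C => // N; exact: le_trans (uv N) (vC N).
by have [C C0 {}vC] := vC _ t0; exists C => // N; exact: le_trans (uv N) (vC N).
Qed.

Lemma tameM c u v : (forall N, 0 <= u N) -> (forall N, 0 <= v N) ->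
  tame c u -> tame c v -> tame c (fun N => u N * v N).
Proof.
move=> u0 v0.
have H tau1 tau2 C D N : u N <= C * Mseq tau1 sigma N ->
    v N <= D * Mseq tau2 sigma N ->
    u N * v N <= C * D * Mseq (tau1 + tau2) sigma N.
  by move=> uC vD; rewrite MseqD mulrACA ler_pM.
case: c => [[t t0 [C C0 uC]] [s s0 [D D0 vD]]|uC vD t t0].
  exists (t + s); first exact: addr_gt0.
  by exists (C * D) => [|N]; [exact: mulr_gt0|exact: H].
have t20 : 0 < t / 2 by rewrite divr_gt0.
have [C C0 {}uC] := uC _ t20; have [D D0 {}vD] := vD _ t20.
exists (C * D) => [|N]; first exact: mulr_gt0.
by rewrite [t](splitr t); exact: H.
Qed.

Lemma tame_geometric c A : 1 <= A -> tame c (fun N => A ^+ N * N%:R ^+ N).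
Proof.
move=> A1; case: c => [|tau t0]; last exact: Mseq_absorb.
by exists 1 => //; exact: Mseq_absorb.
Qed.

(** Splitting off the fixed index k costs a factor on tau, which in the Beurling
    case is compensated beforehand. *)
Lemma tame_shift c u k : tame c u -> tame c (fun N => u (N + k)%N).
Proof.
have H tau C : 0 < tau -> 0 < C -> (forall N, u N <= C * Mseq tau sigma N) ->
    exists2 D : R, 0 < D & forall N,
      u (N + k)%N <= D * Mseq (split_factor * tau) sigma N.
  move=> t0 C0 uC; have [E E0 HE] := Mseq_split t0.
  exists (C * E * Mseq (split_factor * tau) sigma k).
    by rewrite !mulr_gt0 ?Mseq_gt0.
  move=> N; have := HE N k; rewrite -(ler_pM2l C0) => /(le_trans (uC _)).
  by move/le_trans; apply; rewrite le_eqVlt; apply/orP; left; apply/eqP; ring.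
case: c => [[t t0 [C C0 uC]]|uC t t0].
  exists (split_factor * t); first by rewrite mulr_gt0 ?split_factor_gt0.
  exact: H uC.
have t'0 : 0 < split_factor^-1 * t by rewrite mulr_gt0 ?invr_gt0 ?split_factor_gt0.
have [C C0 {}uC] := uC _ t'0; have [D D0 HD] := H _ _ t'0 C0 uC.
exists D => // N; rewrite -[t](mulVKf (_ : split_factor != 0)) ?gt_eqF ?split_factor_gt0//.
Qed.

End growth.


(** * Directional derivatives *)

Section directional.
Context {R : realType} {V : normedModType R}.
Implicit Types (f g : V -> R) (x y u v : V) (c r s h l : R).

Lemma is_derive_lineE f x v s l :
  is_derive s (1 : R) (fun r => f (r *: v + x)) l <->
  is_derive (s *: v + x) v f l.
Proof.
have E : (fun h : R => h^-1 *: (((fun r => f (r *: v + x)) \o shift s) (h *: 1) -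
    f (s *: v + x))) =
  (fun h : R => h^-1 *: ((f \o shift (s *: v + x)) (h *: v) - f (s *: v + x))).
  by apply/funext => h /=; rewrite addrA -scalerDl [h *: 1]mulr1.
have E1 : derivable (fun r : R => f (r *: v + x)) s (1 : R) =
    derivable f (s *: v + x) v by rewrite /derivable E.
have E2 : 'D_(1 : R) (fun r : R => f (r *: v + x)) s = 'D_v f (s *: v + x).
  by rewrite /derive E.
split=> -[H1 H2]; split.
- by rewrite -E1.
- by rewrite -E2.
- by rewrite E1.
- by rewrite E2.
Qed.

Lemma is_derive_scale f x v c l :
  is_derive x v f l -> is_derive x (c *: v) f (c * l).
Proof.
move=> fl; have /(is_derive_lineE f x (c *: v) 0) : is_derive (0 : R) 1 (fun r => f (r *: (c *: v) + x)) (c * l); last by rewrite scale0r add0r.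
have fl0 : is_derive (0 * c : R) 1 (fun r => f (r *: v + x)) l.
  by apply/is_derive_lineE; rewrite mul0r scale0r add0r.
have cl : is_derive (0 : R) 1 (fun r : R => r * c) c.
  have := @is_deriveM R R idfun (cst c) 0 1 1 0 (is_derive_id _ _) (is_derive_cst _ _ _).
  by rewrite scaler0 add0r [_ *: 1]mulr1.
have := @is_derive1_comp R (fun r : R => f (r *: v + x)) (fun r : R => r * c) 0 l c fl0 cl.
rewrite mulrC; congr (is_derive _ _ _ _).
by apply/funext => r /=; rewrite scalerA.
Qed.

(** The mean value theorem along a line, for increments of either sign. *)
Lemma mean_value_line f (f' : R -> R) x v :
  (forall r : R, is_derive (r *: v + x) v f (f' r)) ->
  forall h : R, exists2 r, `|r| <= `|h| & f (h *: v + x) - f x = h * f' r.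
Proof.
move=> df h; pose g r := f (r *: v + x).
have dg r : is_derive r (1 : R) g (f' r) by apply/is_derive_lineE.
have g0 : g 0 = f x by rewrite /g scale0r add0r.
have cg : continuous g.
  move=> r; apply/differentiable_continuous/derivable1_diffP.
  by have [] := dg r.
have cw (a b : R) : {within `[a, b], continuous g} by exact: continuous_subspaceT.
have [h0|h0|->] := ltgtP h 0.
- have [c ch E] := MVT h0 (fun r _ => dg r) (cw _ _).
  move: ch; rewrite in_itv/= => /andP[hc c0]; exists c.
    by rewrite !ler0_norm ?lerN2 ?ltW.
  by rewrite -g0 -[LHS]opprB E sub0r mulrN opprK mulrC.
- have [c ch E] := MVT h0 (fun r _ => dg r) (cw _ _).
  move: ch; rewrite in_itv/= => /andP[c0 ch]; exists c.
    by rewrite !ger0_norm ?ltW.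
  by rewrite -g0 E subr0 mulrC.
- by exists 0 => //; rewrite scale0r add0r subrr mul0r.
Qed.

Lemma continuous_plane f x u v : {for x, continuous f} ->
  forall e : R, 0 < e -> exists2 d : R, 0 < d & forall r s,
    `|r| <= d -> `|s| <= d -> `|f (s *: v + (r *: u + x)) - f x| < e.
Proof.
move=> cf e e0.
have /nbhs_ballP[d /= d0 Hd] : \forall y \near x, `|f x - f y| < e.
  by move/cvgrPdist_lt : cf; apply.
pose k := `|u| + `|v| + 1.
have k0 : 0 < k by rewrite ltr_wpDl ?addr_ge0.
exists (d / k); first exact: divr_gt0.
move=> r s rd sd; rewrite distrC; apply: Hd; rewrite -ball_normE /ball_/=.
rewrite addrA opprD addrCA subrr addr0 normrN.
apply: (le_lt_trans (ler_normD _ _)); rewrite !normrZ.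
apply: (@le_lt_trans _ _ (d / k * `|v| + d / k * `|u|)).
  by rewrite lerD// ler_wpM2r.
rewrite -mulrDr -ltr_pdivlMl ?divr_gt0// invf_div divfK ?gt_eqF//.
by rewrite /k addrC ltrDl.
Qed.

(** The increment along u is taken at the displaced point x + h v; the mean value
    theorem reduces it to the values of f' near x. *)
Lemma is_derive_dirD f f' x u v l :
  (forall y, is_derive y u f (f' y)) -> {for x, continuous f'} ->
  is_derive x v f l -> is_derive x (u + v) f (f' x + l).
Proof.
move=> fu cf' [fv <-].
suff H : (fun h : R => h^-1 *: ((f \o shift x) (h *: (u + v)) - f x)) @ 0^' -->
    (f' x + 'D_v f x).
  by split; [apply/cvg_ex; eexists; exact: H|exact: (cvg_lim _ H)].
have E : (fun h : R => h^-1 *: ((f \o shift x) (h *: (u + v)) - f x)) =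
  (fun h : R => h^-1 *: (f (h *: u + (h *: v + x)) - f (h *: v + x))) \+
  (fun h : R => h^-1 *: ((f \o shift x) (h *: v) - f x)).
  by apply/funext => h /=; rewrite -scalerDr [h *: (u + v)]scalerDr -addrA; congr (_ *: _);
  rewrite [RHS]addrA subrK.
rewrite E; apply: cvgD; last exact: fv.
apply/cvgrPdist_lt => e e0.
have [d d0 Hd] := @continuous_plane f' x v u cf' e e0.
rewrite near_withinE; near=> h => h0.
have hd : `|h| <= d.
  near: h; apply/nbhs_ballP; exists d => //= y.
  by rewrite -ball_normE /ball_/= sub0r normrN => /ltW.
have [r rh ->] := @mean_value_line f (fun r => f' (r *: u + (h *: v + x))) (h *: v + x) u (fun r => fu _) h.
rewrite scalerA mulVf// scale1r distrC; apply: Hd => //.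
exact: le_trans rh hd.
Unshelve. all: by end_near. Qed.

(** Schwarz: both iterated derivatives are limits of the second difference of
    f over the parallelogram with sides h u and h v, divided by h^2. *)
Lemma derive_comm f fu fv fuv fvu x u v :
  (forall y, is_derive y u f (fu y)) -> (forall y, is_derive y v f (fv y)) ->
  (forall y, is_derive y v fu (fuv y)) -> (forall y, is_derive y u fv (fvu y)) ->
  {for x, continuous fuv} -> {for x, continuous fvu} -> fuv x = fvu x.
Proof.
have key g gu guv a b h : (forall y, is_derive y a g (gu y)) ->
    (forall y, is_derive y b gu (guv y)) ->
  exists r s, [/\ `|r| <= `|h|, `|s| <= `|h| &
    g (h *: b + (h *: a + x)) - g (h *: a + x) - (g (h *: b + x) - g x) =
    h * (h * guv (s *: b + (r *: a + x)))].
  move=> ga gb.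
  pose k y := g (h *: b + y) - g y.
  have dk r : is_derive (r *: a + x) a k (gu (h *: b + (r *: a + x)) - gu (r *: a + x)).
    apply/is_derive_lineE; apply: is_deriveB; last exact/is_derive_lineE.
    rewrite (_ : (fun _ => _) = (fun t => g (t *: a + (h *: b + x)))); last first.
      by apply/funext => t; rewrite addrCA.
    by apply/is_derive_lineE; rewrite addrCA.
  have [r rh Er] := mean_value_line dk h.
  have [s sh Es] := mean_value_line (x := r *: a + x) (fun s => gb _) h.
  by exists r, s; split => //; rewrite -Es -Er.
move=> Hu Hv Huv Hvu cuv cvu; apply/eqP/negPn/negP => neq.
pose e := `|fuv x - fvu x| / 2.
have e0 : 0 < e by rewrite divr_gt0// normr_gt0 subr_eq0.
have [d d0 Hd] := @continuous_plane fuv x u v cuv e e0.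
have [d' d'0 Hd'] := @continuous_plane fvu x v u cvu e e0.
pose h := Num.min d d'.
have h0 : 0 < h by rewrite lt_min d0.
have hd : `|h| <= d by rewrite gtr0_norm// ge_min lexx.
have hd' : `|h| <= d' by rewrite gtr0_norm// ge_min lexx orbT.
have [r [s [rh sh E]]] := key f fu fuv u v h Hu Huv.
have [r' [s' [rh' sh' E']]] := key f fv fvu v u h Hv Hvu.
have EE : fuv (s *: v + (r *: u + x)) = fvu (s' *: u + (r' *: v + x)).
  have hn0 : h != 0 by rewrite gt_eqF.
  apply: (mulfI hn0); apply: (mulfI hn0).
  rewrite -E -E' (addrCA (h *: u)).
  by ring.
have := Hd r s (le_trans rh hd) (le_trans sh hd).
have := Hd' r' s' (le_trans rh' hd') (le_trans sh' hd').
rewrite -EE; set z := fuv (_ + _) => A B.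
have := ler_normB (z - fvu x) (z - fuv x).
rewrite opprB addrC addrA subrK.
move=> C; have := le_lt_trans C (ltrD A B).
by rewrite /e -splitr ltxx.
Qed.

End directional.

Section partials.
Context {R : realType} {d : nat}.
Implicit Types (f : 'rV[R]_d -> R) (x y : 'rV[R]_d).

Lemma norm_coord x i : `|x 0 i| <= `|x|.
Proof.
rewrite [leRHS]/Num.norm /= mx_normrE; apply/bigmax_geP; right => /=.
by exists (0, i).
Qed.

Lemma row_sum_coord x : x = \sum_i x 0 i *: delta_mx 0 i.
Proof. exact: row_sum_delta. Qed.

(** Partial derivatives that exist everywhere and are bounded make f Lipschitz:
    the increment is split along the coordinate axes. *)
Lemma bounded_partials_continuous f (f' : 'I_d -> 'rV[R]_d -> R) (A : R) :
  (forall i y, is_derive y (delta_mx 0 i) f (f' i y)) ->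
  (forall i y, `|f' i y| <= A) -> continuous f.
Proof.
move=> df f'A.
have lip (s : seq 'I_d) (h : 'I_d -> R) x :
    `|f (\sum_(i <- s) h i *: delta_mx 0 i + x) - f x| <= A * \sum_(i <- s) `|h i|.
  elim: s => [|i s IH]; first by rewrite !big_nil add0r subrr normr0 mulr0.
  rewrite !big_cons mulrDr -addrA.
  set y := \sum_(j <- s) h j *: delta_mx 0 j + x in IH *.
  rewrite -[X in X - _](subrK (f y)) -addrA.
  apply: (le_trans (ler_normD _ _)); apply: lerD => //.
  have [r _ ->] := @mean_value_line _ _ f _ y _ (fun r => df i _) (h i).
  by rewrite normrM mulrC ler_wpM2r.
move=> x; apply/(@cvgrPdist_lt _ _ _ (nbhs x) _ f (f x)) => e e0.
pose B := `|A| * d%:R + 1.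
have B0 : 0 < B by rewrite ltr_wpDl ?mulr_ge0.
near=> y; rewrite distrC -{1}(subrK x y) {1}(row_sum_coord (y - x)).
apply: (le_lt_trans (lip _ _ _)).
have yx : `|y - x| < e / B.
  by near: y; apply: cvgr_distC_lt; rewrite ?divr_gt0//; exact: cvg_id.
apply: (@le_lt_trans _ _ (`|A| * (d%:R * `|y - x|))).
  rewrite (le_trans (ler_norm _))// normrM ler_wpM2l// ger0_norm ?sumr_ge0//.
  rewrite (_ : d%:R * _ = \sum_(i < d) `|y - x|); last first.
    by rewrite sumr_const card_ord mulr_natl.
  apply: ler_sum => i _; exact: norm_coord.
rewrite mulrA (@le_lt_trans _ _ (B * `|y - x|))//.
  by rewrite ler_wpM2r// /B lerDl.
by rewrite -ltr_pdivlMl// mulrC.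
Unshelve. all: by end_near. Qed.

Lemma C1_derive f x v : C1 f ->
  is_derive x v f (\sum_i v 0 i * 'D_(delta_mx 0 i) f x).
Proof.
move=> [fd _ cf'].
rewrite [v in is_derive _ v]row_sum_coord.
elim: (index_enum _) => [|i s IH].
  rewrite !big_nil; apply: DeriveDef.
    exact: derivable0.
  by rewrite derive0.
rewrite !big_cons; apply: (@is_derive_dirD _ _ f (fun y => v 0 i * 'D_(delta_mx 0 i) f y)) => //.
  by move=> y; apply: is_derive_scale; apply: DeriveDef => //; exact: fd.
by apply: continuousM; [exact: cst_continuous|exact: cf'].
Qed.

End partials.

(** * Complex-valued smooth functions *)

Section complex_parts.
Context {R : realType}.
Local Notation Re := (@complex.Re R).
Local Notation Im := (@complex.Im R).
Implicit Types x y z : R[i].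

Lemma cReD x y : Re (x + y) = Re x + Re y. Proof. by case: x y => ? ? []. Qed.
Lemma cImD x y : Im (x + y) = Im x + Im y. Proof. by case: x y => ? ? []. Qed.
Lemma cReM x y : Re (x * y) = Re x * Re y - Im x * Im y.
Proof. by case: x y => ? ? []. Qed.
Lemma cImM x y : Im (x * y) = Re x * Im y + Im x * Re y.
Proof. by case: x y => ? ? []. Qed.
Lemma cReJ x : Re x^* = Re x. Proof. by case: x. Qed.
Lemma cImJ x : Im x^* = - Im x. Proof. by case: x. Qed.
Lemma eq_complex_parts x y : Re x = Re y -> Im x = Im y -> x = y.
Proof. by case: x y => ? ? [? ?] /= -> ->. Qed.

Lemma normc_ge0 z : 0 <= normc z.
Proof. by case: z => a b; rewrite /normc sqrtr_ge0. Qed.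

Lemma Re_le_normc z : `|Re z| <= normc z.
Proof.
case: z => a b /=; rewrite -sqrtr_sqr ler_wsqrtr// lerDl sqr_ge0//.
Qed.

Lemma Im_le_normc z : `|Im z| <= normc z.
Proof.
case: z => a b /=; rewrite -sqrtr_sqr ler_wsqrtr// lerDr sqr_ge0//.
Qed.

Lemma normc_le_parts z : normc z <= `|Re z| + `|Im z|.
Proof.
case: z => a b /=; rewrite -[leRHS]ger0_norm ?addr_ge0// -sqrtr_sqr.
rewrite ler_wsqrtr// sqrrD !real_normK ?num_real// [leRHS]addrAC lerDl.
by rewrite mulrn_wge0// mulr_ge0.
Qed.

Lemma normc_real (a : R) : normc a%:C = `|a|.
Proof. by rewrite /normc /= expr0n/= addr0 sqrtr_sqr. Qed.

Lemma normc_conj z : normc z^* = normc z.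
Proof. by case: z => a b /=; rewrite sqrrN. Qed.

Lemma cRe_sum (I : Type) (s : seq I) (F : I -> R[i]) :
  Re (\sum_(i <- s) F i) = \sum_(i <- s) Re (F i).
Proof. by elim: s => [|i s IH]; rewrite ?big_nil// !big_cons cReD IH. Qed.

Lemma cIm_sum (I : Type) (s : seq I) (F : I -> R[i]) :
  Im (\sum_(i <- s) F i) = \sum_(i <- s) Im (F i).
Proof. by elim: s => [|i s IH]; rewrite ?big_nil// !big_cons cImD IH. Qed.

End complex_parts.

Section complex_derivatives.
Context {R : realType} {d : nat}.
Local Notation Re := (@complex.Re R).
Local Notation Im := (@complex.Im R).
Local Notation fn := ('rV[R]_d -> R[i]).
Implicit Types (x v : 'rV[R]_d) (phi psi h : fn) (l m : R[i]) (i : 'I_d).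

Definition cder v h x l : Prop :=
  is_derive x v (Re \o h) (Re l) /\ is_derive x v (Im \o h) (Im l).

Definition ccont h : Prop := continuous (Re \o h) /\ continuous (Im \o h).

Lemma is_derive_ext (f g : 'rV[R]_d -> R) x v (l : R) :
  f =1 g -> is_derive x v f l -> is_derive x v g l.
Proof. by move=> /funext ->. Qed.

Lemma cder_eq v h x l m : l = m -> cder v h x l -> cder v h x m.
Proof. by move=> ->. Qed.

Lemma cder_cst v x (a : R[i]) : cder v (fun=> a) x 0.
Proof. by split; exact: is_derive_cst. Qed.

Lemma cderD v phi psi x l m : cder v phi x l -> cder v psi x m ->
  cder v (fun y => phi y + psi y) x (l + m).
Proof.
move=> [pr pi] [qr qi]; split.
- rewrite cReD; apply: is_derive_ext (is_deriveD pr qr) => y.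
  by rewrite /= cReD.
- rewrite cImD; apply: is_derive_ext (is_deriveD pi qi) => y.
  by rewrite /= cImD.
Qed.

Lemma cderM v phi psi x l m : cder v phi x l -> cder v psi x m ->
  cder v (fun y => phi y * psi y) x (l * psi x + phi x * m).
Proof.
move=> [pr pi] [qr qi]; split.
- have D := is_deriveB (is_deriveM pr qr) (is_deriveM pi qi).
  apply: is_derive_ext (is_derive_eq D _) => [y|]; first by rewrite /= cReM.
  rewrite cReD !cReM /= -![_ *: _]/(_ * _).
  by ring.
- have D := is_deriveD (is_deriveM pr qi) (is_deriveM pi qr).
  apply: is_derive_ext (is_derive_eq D _) => [y|]; first by rewrite /= cImM.
  rewrite cImD !cImM /= -![_ *: _]/(_ * _).
  by ring.
Qed.

Lemma cderZ v (a : R[i]) phi x l :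
  cder v phi x l -> cder v (fun y => a * phi y) x (a * l).
Proof.
move=> pl; apply: (cder_eq _ (cderM (cder_cst v x a) pl)).
by rewrite mul0r add0r.
Qed.

Lemma cder_conj v phi x l :
  cder v phi x l -> cder v (fun y => (phi y)^*) x l^*.
Proof.
move=> [pr pi]; split.
  by rewrite cReJ; apply: is_derive_ext pr => y; rewrite /= cReJ.
by rewrite cImJ; apply: is_derive_ext (is_deriveN pi) => y; rewrite /= cImJ.
Qed.

Lemma pderivE i h x l : cder (delta_mx 0 i) h x l -> pderiv i h x = l.
Proof.
move=> [hr hi]; apply: eq_complex_parts.
  by rewrite -[LHS]/('D_(delta_mx 0 i) (Re \o h) x); apply: derive_val.
by rewrite -[LHS]/('D_(delta_mx 0 i) (Im \o h) x); apply: derive_val.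
Qed.

Lemma smooth_C1 phi : smooth phi -> C1 (Re \o phi) /\ C1 (Im \o phi).
Proof. by move/(_ [::]). Qed.

Lemma smooth_pderiv i phi : smooth phi -> smooth (pderiv i phi).
Proof. by move=> sp s; have := sp (rcons s i); rewrite foldr_rcons. Qed.

Lemma smooth_cder i phi x :
  smooth phi -> cder (delta_mx 0 i) phi x (pderiv i phi x).
Proof.
move=> /smooth_C1[[dr _ _] [di _ _]].
split; first by apply: DeriveDef => //; exact: dr.
by apply: DeriveDef => //; exact: di.
Qed.

(** Along any direction, a smooth function is derived through its gradient. *)
Lemma smooth_cder_dir phi v x :
  smooth phi -> cder v phi x (\sum_i (v 0 i)%:C * pderiv i phi x).
Proof.
move=> /smooth_C1[Cr Ci]; split.
  apply: is_derive_eq; first exact: C1_derive.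
  rewrite cRe_sum; apply: eq_bigr => i _.
  by rewrite cReM /= mul0r subr0.
apply: is_derive_eq; first exact: C1_derive.
rewrite cIm_sum; apply: eq_bigr => i _.
by rewrite cImM /= mul0r addr0.
Qed.

Lemma smooth_ccont phi : smooth phi -> ccont phi.
Proof. by move=> /smooth_C1[[_ ? _] [_ ? _]]. Qed.

Lemma ccontD phi psi : ccont phi -> ccont psi -> ccont (fun x => phi x + psi x).
Proof.
move=> [pr pi] [qr qi]; split.
  rewrite (_ : Re \o _ = (Re \o phi) \+ (Re \o psi)); last first.
    by apply/funext => x /=; rewrite cReD.
  by move=> x; apply: continuousD; [exact: pr|exact: qr].
rewrite (_ : Im \o _ = (Im \o phi) \+ (Im \o psi)); last first.
  by apply/funext => x /=; rewrite cImD.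
by move=> x; apply: continuousD; [exact: pi|exact: qi].
Qed.

Lemma ccontM phi psi : ccont phi -> ccont psi -> ccont (fun x => phi x * psi x).
Proof.
move=> [pr pi] [qr qi]; split.
  rewrite (_ : Re \o _ =
      ((Re \o phi) \* (Re \o psi)) \- ((Im \o phi) \* (Im \o psi))); last first.
    by apply/funext => x /=; rewrite cReM.
  move=> x; apply: continuousB; apply: continuousM;
    by [exact: pr|exact: qr|exact: pi|exact: qi].
rewrite (_ : Im \o _ =
    ((Re \o phi) \* (Im \o psi)) \+ ((Im \o phi) \* (Re \o psi))); last first.
  by apply/funext => x /=; rewrite cImM.
move=> x; apply: continuousD; apply: continuousM;
  by [exact: pr|exact: qr|exact: pi|exact: qi].
Qed.

Lemma ccont_cst (a : R[i]) : ccont (fun=> a).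
Proof. by split; exact: cst_continuous. Qed.

Lemma ccont_conj phi : ccont phi -> ccont (fun x => (phi x)^*).
Proof.
move=> [pr pi]; split.
  rewrite (_ : Re \o _ = Re \o phi)//.
  by apply/funext => x /=; rewrite cReJ.
rewrite (_ : Im \o _ = \- (Im \o phi)); last first.
  by apply/funext => x /=; rewrite cImJ.
by move=> x; apply: continuousN; exact: pi.
Qed.

(** Linear combinations as an inductive predicate, which closes a class of
    functions under the sums produced by the product and chain rules. *)
Inductive lspan (P : fn -> Prop) : fn -> Prop :=
| lspan0 : lspan P (fun=> 0)
| lspan_cons a h1 h2 : P h1 -> lspan P h2 -> lspan P (fun x => a * h1 x + h2 x).

Lemma lspan1 (P : fn -> Prop) h : P h -> lspan P h.
Proof.
move=> Ph; rewrite (_ : h = (fun x => 1 * h x + 0)).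
  by apply: lspan_cons => //; exact: lspan0.
by apply/funext => x; rewrite mul1r addr0.
Qed.

Lemma lspanD (P : fn -> Prop) h1 h2 :
  lspan P h1 -> lspan P h2 -> lspan P (fun x => h1 x + h2 x).
Proof.
elim=> {h1} [|a h h1 Ph _ IH] h2P.
  by rewrite (_ : (fun _ => _) = h2)//; apply/funext => x; rewrite add0r.
rewrite (_ : (fun _ => _) = (fun x => a * h x + (h1 x + h2 x))).
  by apply: lspan_cons => //; exact: IH.
by apply/funext => x; rewrite addrA.
Qed.

Lemma lspanZ (P : fn -> Prop) a h : lspan P h -> lspan P (fun x => a * h x).
Proof.
elim=> {h} [|b h h1 Ph _ IH].
  rewrite (_ : (fun _ => _) = (fun=> 0)); first exact: lspan0.
  by apply/funext => x; rewrite mulr0.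
rewrite (_ : (fun _ => _) = (fun x => (a * b) * h x + a * h1 x)).
  exact: lspan_cons.
by apply/funext => x; rewrite mulrDr mulrA.
Qed.

Lemma lspan_sum (P : fn -> Prop) (I : Type) (s : seq I) (a : I -> R[i])
    (F : I -> fn) : (forall j, P (F j)) ->
  lspan P (fun x => \sum_(j <- s) a j * F j x).
Proof.
move=> PF; elim: s => [|j s IH].
  by under eq_fun do rewrite big_nil; exact: lspan0.
by under eq_fun do rewrite big_cons; exact: lspan_cons.
Qed.

(** Smoothness is coinductive: it suffices that a class of continuous functions
    contains the partial derivatives of its members up to linear combinations. *)
Lemma smooth_coind (P : fn -> Prop) :
  (forall h, P h -> ccont h) ->
  (forall h i, P h -> exists2 psi, lspan P psi &
     forall x, cder (delta_mx 0 i) h x (psi x)) ->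
  forall h, P h -> smooth h.
Proof.
move=> Pc Pd.
have Sc h : lspan P h -> ccont h.
  elim=> {h} [|a h1 h2 Ph _ IH]; first exact: ccont_cst.
  by apply: ccontD => //; apply: ccontM; [exact: ccont_cst|exact: Pc].
have Sd h i : lspan P h -> exists2 psi, lspan P psi &
    forall x, cder (delta_mx 0 i) h x (psi x).
  elim=> {h} [|a h1 h2 Ph _ [psi Spsi dpsi]].
    by exists (fun=> 0); [exact: lspan0|move=> x; exact: cder_cst].
  have [chi Schi dchi] := Pd _ i Ph.
  exists (fun x => a * chi x + psi x).
    by apply: lspanD => //; exact: lspanZ.
  by move=> x; apply: cderD => //; exact: cderZ.
move=> h Ph s.
have {Ph} : lspan P (foldr (@pderiv R d) h s).
  elim: s => [|i s IH] /=; first exact: lspan1.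
  have [psi Spsi dpsi] := Sd _ i IH.
  suff -> : pderiv i (foldr (@pderiv R d) h s) = psi by [].
  by apply/funext => x; exact: pderivE (dpsi x).
move: (foldr _ _ _) => k Sk /=; have [cr ci] := Sc _ Sk.
have H i : (forall x, cder (delta_mx 0 i) k x (pderiv i k x)) /\ ccont (pderiv i k).
  have [psi Spsi dpsi] := Sd _ i Sk.
  have -> : pderiv i k = psi by apply/funext => x; exact: pderivE (dpsi x).
  by split => //; exact: Sc.
split; split => //.
- by move=> i x; have [/(_ x)[[]]] := H i.
- by move=> i; have [_ []] := H i.
- by move=> i x; have [/(_ x)[_ []]] := H i.
- by move=> i; have [_ []] := H i.
Qed.

Lemma smooth_cst (a : R[i]) : smooth (fun _ : 'rV[R]_d => a).
Proof.
apply: (@smooth_coind (fun h => exists b, h = fun=> b)); last by exists a.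
  by move=> _ [b ->]; exact: ccont_cst.
move=> _ i [b ->]; exists (fun=> 0); first exact: lspan0.
by move=> x; exact: cder_cst.
Qed.

Lemma smoothM phi psi :
  smooth phi -> smooth psi -> smooth (fun x => phi x * psi x).
Proof.
pose P h := exists p q, [/\ smooth p, smooth q & h = fun x => p x * q x].
move=> sp sq; apply: (@smooth_coind P); last by exists phi, psi.
  by move=> _ [p [q [? ? ->]]]; apply: ccontM; exact: smooth_ccont.
move=> _ i [p [q [p_ q_ ->]]].
exists (fun x => pderiv i p x * q x + p x * pderiv i q x).
  apply: lspanD; apply: lspan1.
    by exists (pderiv i p), q; split => //; exact: smooth_pderiv.
  by exists p, (pderiv i q); split => //; exact: smooth_pderiv.
by move=> x; apply: cderM; exact: smooth_cder.
Qed.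

Lemma smoothD phi psi :
  smooth phi -> smooth psi -> smooth (fun x => phi x + psi x).
Proof.
pose P h := exists p q, [/\ smooth p, smooth q & h = fun x => p x + q x].
move=> sp sq; apply: (@smooth_coind P); last by exists phi, psi.
  by move=> _ [p [q [? ? ->]]]; apply: ccontD; exact: smooth_ccont.
move=> _ i [p [q [p_ q_ ->]]].
exists (fun x => pderiv i p x + pderiv i q x).
  apply: lspan1; exists (pderiv i p), (pderiv i q).
  by split; [exact: smooth_pderiv|exact: smooth_pderiv|].
by move=> x; apply: cderD; exact: smooth_cder.
Qed.

Lemma smoothZ (a : R[i]) phi : smooth phi -> smooth (fun x => a * phi x).
Proof. by move=> ?; apply: smoothM => //; exact: smooth_cst. Qed.

Lemma smooth_sum (I : Type) (s : seq I) (F : I -> fn) :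
  (forall j, smooth (F j)) -> smooth (fun x => \sum_(j <- s) F j x).
Proof.
move=> sF; elim: s => [|j s IH].
  rewrite (_ : (fun _ => _) = fun=> 0); first exact: smooth_cst.
  by apply/funext => x; rewrite big_nil.
rewrite (_ : (fun _ => _) = fun x => F j x + \sum_(k <- s) F k x).
  exact: smoothD.
by apply/funext => x; rewrite big_cons.
Qed.

Lemma smooth_conj phi : smooth phi -> smooth (fun x => (phi x)^*).
Proof.
pose P h := exists2 p, smooth p & h = fun x => (p x)^*.
move=> sp; apply: (@smooth_coind P); last by exists phi.
  by move=> _ [p ? ->]; apply: ccont_conj; exact: smooth_ccont.
move=> _ i [p p_ ->]; exists (fun x => (pderiv i p x)^*).
  by apply: lspan1; exists (pderiv i p) => //; exact: smooth_pderiv.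
by move=> x; apply: cder_conj; exact: smooth_cder.
Qed.

Lemma cder_coord i v x : cder v (fun y => (y 0 i)%:C) x (v 0 i)%:C.
Proof.
split; last exact: is_derive_cst.
suff H : (fun h : R => h^-1 *: (((fun y : 'rV[R]_d => y 0 i) \o shift x) (h *: v) -
    x 0 i)) @ 0^' --> v 0 i.
  by split; [apply/cvg_ex; eexists; exact: H|exact: (cvg_lim _ H)].
apply: cvg_near_cst; rewrite near_withinE; near=> h => h0 /=.
by rewrite !mxE addrK [_ *: _]mulrA mulVf// mul1r.
Unshelve. all: by end_near. Qed.

Lemma ccont_coord i : ccont (fun y => (y 0 i)%:C).
Proof. by split; [exact: coord_continuous|exact: cst_continuous]. Qed.

Lemma smooth_coord i : smooth (fun x : 'rV[R]_d => (x 0 i)%:C).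
Proof.
pose P h := h = (fun x : 'rV[R]_d => (x 0 i)%:C) \/ exists a, h = fun=> a.
apply: (@smooth_coind P); last by left.
  by move=> _ [->|[a ->]]; [exact: ccont_coord|exact: ccont_cst].
move=> _ j [->|[a ->]].
  exists (fun=> ((delta_mx 0 j : 'rV[R]_d) 0 i)%:C).
    by apply: lspan1; right; exists ((delta_mx 0 j : 'rV[R]_d) 0 i)%:C.
  by move=> x; exact: cder_coord.
exists (fun=> 0); first exact: lspan0.
by move=> x; exact: cder_cst.
Qed.

Lemma pderivD i phi psi : smooth phi -> smooth psi ->
  pderiv i (fun x => phi x + psi x) = fun x => pderiv i phi x + pderiv i psi x.
Proof.
by move=> sp sq; apply/funext => x; apply/pderivE/cderD; exact: smooth_cder.
Qed.

Lemma pderivM i phi psi : smooth phi -> smooth psi ->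
  pderiv i (fun x => phi x * psi x) =
  fun x => pderiv i phi x * psi x + phi x * pderiv i psi x.
Proof.
by move=> sp sq; apply/funext => x; apply/pderivE/cderM; exact: smooth_cder.
Qed.

Lemma pderivZ i (a : R[i]) phi : smooth phi ->
  pderiv i (fun x => a * phi x) = fun x => a * pderiv i phi x.
Proof.
by move=> sp; apply/funext => x; apply/pderivE/cderZ; exact: smooth_cder.
Qed.

Lemma pderiv_conj i phi : smooth phi ->
  pderiv i (fun x => (phi x)^*) = fun x => (pderiv i phi x)^*.
Proof.
by move=> sp; apply/funext => x; apply/pderivE/cder_conj; exact: smooth_cder.
Qed.

Lemma pderiv_coord i j :
  pderiv j (fun x : 'rV[R]_d => (x 0 i)%:C) = fun=> (i == j)%:R.
Proof.
apply/funext => x; rewrite (pderivE (cder_coord i _ x)) mxE eqxx/=.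
by case: eqP.
Qed.

Lemma pderiv_comm i j phi : smooth phi ->
  pderiv i (pderiv j phi) = pderiv j (pderiv i phi).
Proof.
move=> sp; apply/funext => x.
have si := smooth_pderiv i sp; have sj := smooth_pderiv j sp.
have [ir ii] := smooth_ccont (smooth_pderiv j si).
have [jr ji] := smooth_ccont (smooth_pderiv i sj).
have Dj y := smooth_cder j y sp; have Di y := smooth_cder i y sp.
have Dij y := smooth_cder i y sj; have Dji y := smooth_cder j y si.
apply: eq_complex_parts.
  exact: (derive_comm (fun y => (Dj y).1) (fun y => (Di y).1)
    (fun y => (Dij y).1) (fun y => (Dji y).1) (jr x) (ir x)).
exact: (derive_comm (fun y => (Dj y).2) (fun y => (Di y).2)
  (fun y => (Dij y).2) (fun y => (Dji y).2) (ji x) (ii x)).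
Qed.

End complex_derivatives.

(** * Words in the coordinates and the partial derivatives *)

Section words.
Context {R : realType} {d : nat}.
Local Notation Re := (@complex.Re R).
Local Notation Im := (@complex.Im R).
Local Notation fn := ('rV[R]_d -> R[i]).
Implicit Types (phi psi : fn) (A B : R) (N : nat) (i : 'I_d).

(** A letter [inl i] multiplies by the i-th coordinate, [inr i] differentiates
    along it. Bounding all words, in any order of the letters, treats the two
    kinds of operators alike, as the Fourier transform requires. *)
Definition letter : Type := 'I_d + 'I_d.

Definition act (l : letter) phi : fn :=
  match l with
  | inl i => fun x => (x 0 i)%:C * phi x
  | inr i => pderiv i phi
  end.

Definition word (w : seq letter) phi : fn := foldr act phi w.

Definition wbound phi N A : Prop :=
  forall w, (size w <= N)%N -> forall x, normc (word w phi x) <= A.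

Lemma smooth_act l phi : smooth phi -> smooth (act l phi).
Proof.
case: l => i sp /=; last exact: smooth_pderiv.
by apply: smoothM => //; exact: smooth_coord.
Qed.

Lemma smooth_word w phi : smooth phi -> smooth (word w phi).
Proof. by move=> sp; elim: w => //= l w; exact: smooth_act. Qed.

Lemma act_lin l (a : R[i]) phi psi : smooth phi -> smooth psi ->
  act l (fun x => a * phi x + psi x) = fun x => a * act l phi x + act l psi x.
Proof.
move=> sp sq; case: l => i /=.
  by apply/funext => x; rewrite mulrDr mulrCA.
by rewrite pderivD ?pderivZ//; exact: smoothZ.
Qed.

Lemma word_lin w (a : R[i]) phi psi : smooth phi -> smooth psi ->
  word w (fun x => a * phi x + psi x) = fun x => a * word w phi x + word w psi x.
Proof.
move=> sp sq; elim: w => //= l w ->.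
by apply: act_lin; exact: smooth_word.
Qed.

Lemma word0 w : word w (fun=> 0) = fun=> 0.
Proof.
elim: w => //= l w ->; case: l => i /=; apply/funext => x; first by rewrite mulr0.
by apply/pderivE; exact: cder_cst.
Qed.

Lemma wbound_normc phi N A : wbound phi N A -> forall x, normc (phi x) <= A.
Proof. by move=> /(_ [::] isT). Qed.

Lemma wbound_ge0 phi N A : wbound phi N A -> 0 <= A.
Proof. by move=> /wbound_normc/(_ 0)/(le_trans (normc_ge0 _)). Qed.

Lemma wbound_le phi N M A B : (N <= M)%N -> A <= B ->
  wbound phi M A -> wbound phi N B.
Proof.
by move=> NM AB H w wN x; rewrite (le_trans _ AB)// H// (leq_trans wN).
Qed.

Lemma wbound_act l phi N A : wbound phi N.+1 A -> wbound (act l phi) N A.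
Proof.
by move=> H w wN x; have := H (rcons w l); rewrite size_rcons /word foldr_rcons; exact.
Qed.

Lemma wbound_rec phi N A : (forall x, normc (phi x) <= A) ->
  (forall l, wbound (act l phi) N A) -> wbound phi N.+1 A.
Proof.
move=> H0 H w; case: (lastP w) => [|{}w l] //.
by rewrite size_rcons /word foldr_rcons => /H; exact.
Qed.

Lemma wboundD phi psi N A B : smooth phi -> smooth psi ->
  wbound phi N A -> wbound psi N B -> wbound (fun x => phi x + psi x) N (A + B).
Proof.
move=> sp sq pA qB w wN x.
have -> : (fun x => phi x + psi x) = (fun x => 1 * phi x + psi x).
  by apply/funext => y; rewrite mul1r.
rewrite word_lin// mul1r (le_trans (le_normcD _ _))// lerD//; [exact: pA|exact: qB].
Qed.

Lemma wboundZ (a : R[i]) phi N A : smooth phi ->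
  wbound phi N A -> wbound (fun x => a * phi x) N (normc a * A).
Proof.
move=> sp pA w wN x.
have -> : (fun x => a * phi x) = (fun x => a * phi x + 0).
  by apply/funext => y; rewrite addr0.
rewrite (word_lin w a sp (smooth_cst 0)) word0 addr0 normcM.
by rewrite ler_wpM2l ?normc_ge0// pA.
Qed.

Lemma wbound_sum (I : Type) (s : seq I) (a : I -> R[i]) (F : I -> fn) N A :
  (forall j, smooth (F j)) -> (forall j, wbound (F j) N A) ->
  wbound (fun x => \sum_(j <- s) a j * F j x) N ((\sum_(j <- s) normc (a j)) * A).
Proof.
move=> sF FA; elim: s => [|j s IH].
  move=> w wN x; rewrite big_nil mul0r.
  rewrite (_ : (fun _ => _) = fun=> 0); first by rewrite word0 normc0.
  by apply/funext => y; rewrite big_nil.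
rewrite (_ : (fun _ => _) = fun x => a j * F j x + \sum_(k <- s) a k * F k x); last first.
  by apply/funext => x; rewrite big_cons.
rewrite big_cons mulrDl; apply: wboundD => //.
- exact: smoothZ.
- by apply: (@smooth_sum _ _ _ s (fun j x => a j * F j x)) => k; exact: smoothZ.
- exact: wboundZ.
Qed.

Lemma act_conj l phi : smooth phi ->
  act l (fun x => (phi x)^*) = fun x => (act l phi x)^*.
Proof.
move=> sp; case: l => i /=; last exact: pderiv_conj.
by apply/funext => x; rewrite rmorphM /= oppr0.
Qed.

Lemma wbound_conj phi N A : smooth phi -> wbound phi N A ->
  wbound (fun x => (phi x)^*) N A.
Proof.
move=> sp pA w wN x; suff -> : word w (fun x => (phi x)^*) = fun x => (word w phi x)^*.
  by rewrite normc_conj; exact: pA.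
elim: w {wN} => //= l w ->.
by rewrite act_conj//; exact: smooth_word.
Qed.

End words.

Arguments letter : clear implicits.

(** * Affine changes of variables and tensor products *)

Section pullback.
Context {R : realType} {d d' : nat}.
Local Notation Re := (@complex.Re R).
Local Notation Im := (@complex.Im R).
Variables (B : 'M[R]_(d, d')) (v0 : 'rV[R]_d').

Definition affine (x : 'rV[R]_d) : 'rV[R]_d' := x *m B + v0.

Lemma is_derive_affine (f : 'rV[R]_d' -> R) x v (l : R) :
  is_derive (affine x) (v *m B) f l -> is_derive x v (f \o affine) l.
Proof.
have E : (fun h : R => h^-1 *: (((f \o affine) \o shift x) (h *: v) - (f \o affine) x)) =
    (fun h : R => h^-1 *: ((f \o shift (affine x)) (h *: (v *m B)) - f (affine x))).
  by apply/funext => h /=; rewrite /affine mulmxDl -scalemxAl addrA.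
move=> [H1 H2]; split; first by rewrite /derivable E.
by rewrite /derive E.
Qed.

Lemma continuous_affine : continuous affine.
Proof.
have cD (T : topologicalType) (V : normedModType R) (f g : T -> V) :
    continuous f -> continuous g -> continuous (fun x => f x + g x).
  by move=> cf cg x; apply: cvgD; [exact: cf|exact: cg].
have cZ (T : topologicalType) (V : normedModType R) (f : T -> R) (v : V) :
    continuous f -> continuous (fun x => f x *: v).
  by move=> cf x; apply: cvgZr_tmp; exact: cf.
rewrite (_ : affine = (fun x => \sum_i x 0 i *: row i B + v0)); last first.
  by apply/funext => y; rewrite /affine mulmx_sum_row.
apply: (cD); last exact: cst_continuous.
elim: (index_enum _) => [|i s IH].
  rewrite (_ : (fun _ => _) = fun=> 0); first exact: cst_continuous.
  by apply/funext => y; rewrite big_nil.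
rewrite (_ : (fun _ => _) = fun y : 'rV_d => y 0 i *: row i B + \sum_(k <- s) y 0 k *: row k B).
  by apply: cD => //; apply: cZ; exact: coord_continuous.
by apply/funext => y; rewrite big_cons.
Qed.

Lemma cder_affine (phi : 'rV[R]_d' -> R[i]) i x : smooth phi ->
  cder (delta_mx 0 i) (phi \o affine) x (\sum_j (B i j)%:C * pderiv j phi (affine x)).
Proof.
move=> sp; have [dr di] := smooth_cder_dir (delta_mx 0 i *m B) (affine x) sp.
have E : \sum_j (((delta_mx 0 i : 'rV[R]_d) *m B) 0 j)%:C * pderiv j phi (affine x) =
    \sum_j (B i j)%:C * pderiv j phi (affine x).
  by apply: eq_bigr => j _; rewrite -rowE mxE.
by rewrite -E; split; exact: is_derive_affine.
Qed.

Lemma ccont_affine (phi : 'rV[R]_d' -> R[i]) : ccont phi -> ccont (phi \o affine).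
Proof.
move=> [pr pi]; split => x.
  exact: (continuous_comp (@continuous_affine x) (pr _)).
exact: (continuous_comp (@continuous_affine x) (pi _)).
Qed.

Lemma smooth_affine (phi : 'rV[R]_d' -> R[i]) : smooth phi -> smooth (phi \o affine).
Proof.
pose P h := exists2 p : 'rV[R]_d' -> R[i], smooth p & h = p \o affine.
move=> sp; apply: (@smooth_coind _ _ P); last by exists phi.
  by move=> _ [p ? ->]; exact/ccont_affine/smooth_ccont.
move=> _ i [p p_ ->]; exists (fun x => \sum_j (B i j)%:C * pderiv j p (affine x)).
  apply: (@lspan_sum _ _ _ _ _ (fun j => (B i j)%:C) (fun j => pderiv j p \o affine)).
  by move=> j; exists (pderiv j p) => //; exact: smooth_pderiv.
by move=> x; exact: cder_affine.
Qed.

Variable C : 'M[R]_(d', d).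
Hypothesis affineK : forall x, affine x *m C = x.

(** With a linear left inverse C, each letter pulls back to a combination of
    letters whose coefficients are entries of B (derivatives) or C
    (coordinates). *)
Lemma wbound_affine : exists2 K, 1 <= K &
  forall (phi : 'rV[R]_d' -> R[i]) N A, smooth phi -> wbound phi N A ->
  wbound (phi \o affine) N (K ^+ N * A).
Proof.
pose K := 1 + \sum_i (\sum_j `|B i j| + \sum_j `|C j i|).
have K1 : 1 <= K.
  by rewrite lerDl sumr_ge0// => i _; rewrite addr_ge0 ?sumr_ge0.
have KE i : \sum_j `|B i j| + \sum_j `|C j i| <= K.
  rewrite /K (bigD1 i)//= addrCA lerDl addr_ge0// sumr_ge0// => k _.
  by rewrite addr_ge0 ?sumr_ge0.
have KB i : \sum_j `|B i j| <= K by rewrite (le_trans _ (KE i))// lerDl sumr_ge0.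
have KC i : \sum_j `|C j i| <= K by rewrite (le_trans _ (KE i))// lerDr sumr_ge0.
exists K => // phi N; elim: N phi => [|N IH] phi A sp pA.
  by move=> [|//] _ x; rewrite expr0 mul1r; exact: wbound_normc pA _.
have A0 := wbound_ge0 pA.
apply: wbound_rec => [x|l].
  apply: (le_trans (wbound_normc pA _)).
  by rewrite ler_peMl// exprn_ege1.
have key (a : 'I_d' -> R) (L : 'I_d' -> letter d') : \sum_j `|a j| <= K ->
    wbound (fun x => \sum_j (a j)%:C * act (L j) phi (affine x)) N (K ^+ N.+1 * A).
  move=> aK; apply: (@wbound_le _ _ _ N N ((\sum_j normc (a j)%:C) * (K ^+ N * A))) => //.
    rewrite exprS -mulrA ler_wpM2r ?mulr_ge0 ?exprn_ge0 ?(le_trans ler01 K1)//.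
    by under eq_bigr do rewrite normc_real.
  apply: (@wbound_sum _ _ _ _ (fun j => (a j)%:C) (fun j => act (L j) phi \o affine)).
    by move=> j; apply: smooth_affine; exact: smooth_act.
  by move=> j; apply: IH; [exact: smooth_act|exact: wbound_act].
case: l => i.
  have := key (fun j => C j i) (fun j => inl j) (KC i).
  congr (wbound _ _ _); apply/funext => x /=.
  have -> : x 0 i = \sum_j affine x 0 j * C j i by rewrite -{1}[x]affineK mxE.
  rewrite rmorph_sum mulr_suml; apply: eq_bigr => j _.
  by rewrite rmorphM mulrCA mulrA.
have := key (B i) (fun j => inr j) (KB i).
congr (wbound _ _ _); apply/funext => x /=.
by apply/esym/pderivE; exact: cder_affine.
Qed.

End pullback.

Section tensor.
Context {R : realType} {n m : nat}.
Implicit Types (phi : 'rV[R]_n -> R[i]) (psi : 'rV[R]_m -> R[i]).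

Definition tensor phi psi (z : 'rV[R]_(n + m)) : R[i] :=
  phi (lsubmx z) * psi (rsubmx z).

Lemma lsubmx_affine : (@lsubmx R 1 n m) = affine (col_mx 1%:M 0) 0.
Proof.
apply/funext => z; rewrite /affine -[z in RHS]hsubmxK mul_row_col.
by rewrite mulmx1 mulmx0 !addr0.
Qed.

Lemma rsubmx_affine : (@rsubmx R 1 n m) = affine (col_mx 0 1%:M) 0.
Proof.
apply/funext => z; rewrite /affine -[z in RHS]hsubmxK mul_row_col.
by rewrite mulmx1 mulmx0 add0r addr0.
Qed.

Lemma smooth_tensor phi psi : smooth phi -> smooth psi -> smooth (tensor phi psi).
Proof.
move=> sp sq; apply: smoothM.
  by rewrite -[fun z => _]/(phi \o lsubmx) lsubmx_affine; exact: smooth_affine.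
by rewrite -[fun z => _]/(psi \o rsubmx) rsubmx_affine; exact: smooth_affine.
Qed.

Let cder_l phi i z : smooth phi -> cder (delta_mx 0 i) (phi \o lsubmx) z
  (\sum_k ((col_mx 1%:M 0 : 'M[R]_(n + m, n)) i k)%:C * pderiv k phi (lsubmx z)).
Proof. by move=> sp; rewrite lsubmx_affine; exact: cder_affine. Qed.

Let cder_r psi i z : smooth psi -> cder (delta_mx 0 i) (psi \o rsubmx) z
  (\sum_k ((col_mx 0 1%:M : 'M[R]_(n + m, m)) i k)%:C * pderiv k psi (rsubmx z)).
Proof. by move=> sp; rewrite rsubmx_affine; exact: cder_affine. Qed.

Let sum_delta p (j : 'I_p) (F : 'I_p -> R[i]) :
  \sum_k ((1%:M : 'M[R]_p) j k)%:C * F k = F j.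
Proof.
rewrite (bigD1 j)//= big1 => [|k kj]; rewrite mxE.
  by rewrite eqxx mul1r addr0.
by rewrite eq_sym (negbTE kj) mul0r.
Qed.

Let sum_0 p (F : 'I_p -> R[i]) : \sum_k (0 : R)%:C * F k = 0.
Proof. by rewrite big1// => k _; rewrite mul0r. Qed.

Lemma pderiv_tensorl j phi psi : smooth phi -> smooth psi ->
  pderiv (lshift m j) (tensor phi psi) = tensor (pderiv j phi) psi.
Proof.
move=> sp sq; apply/funext => z.
rewrite (pderivE (cderM (cder_l (lshift m j) z sp) (cder_r (lshift m j) z sq))).
under eq_bigr do rewrite col_mxEu.
rewrite sum_delta; under eq_bigr do rewrite col_mxEu mxE.
by rewrite sum_0 mulr0 addr0.
Qed.

Lemma pderiv_tensorr j phi psi : smooth phi -> smooth psi ->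
  pderiv (rshift n j) (tensor phi psi) = tensor phi (pderiv j psi).
Proof.
move=> sp sq; apply/funext => z.
rewrite (pderivE (cderM (cder_l (rshift n j) z sp) (cder_r (rshift n j) z sq))).
under eq_bigr do rewrite col_mxEd mxE.
rewrite sum_0; under eq_bigr do rewrite col_mxEd.
by rewrite sum_delta mul0r add0r.
Qed.

Lemma coord_tensorl j phi psi :
  act (inl (lshift m j)) (tensor phi psi) = tensor (act (inl j) phi) psi.
Proof. by apply/funext => z; rewrite /tensor /= mxE mulrA. Qed.

Lemma coord_tensorr j phi psi :
  act (inl (rshift n j)) (tensor phi psi) = tensor phi (act (inl j) psi).
Proof. by apply/funext => z; rewrite /tensor /= mxE mulrCA. Qed.

Lemma wbound_tensor phi psi N A B : smooth phi -> smooth psi ->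
  wbound phi N A -> wbound psi N B -> wbound (tensor phi psi) N (A * B).
Proof.
have base p q M C D z : wbound p M C -> wbound q M D ->
    normc (tensor p q z) <= C * D.
  move=> pC qD; rewrite normcM ler_pM ?normc_ge0//.
    exact: wbound_normc pC _.
  exact: wbound_normc qD _.
elim: N phi psi => [|N IH] phi psi sp sq pA qB.
  by move=> [|//] _ z; exact: base pA qB.
have pA' := wbound_le (leqnSn N) (lexx A) pA.
have qB' := wbound_le (leqnSn N) (lexx B) qB.
apply: wbound_rec => [z|]; first exact: base pA qB.
case=> i; case: (split_ordP i) => j ->.
- rewrite coord_tensorl; apply: IH => //; [exact: smooth_act|exact: wbound_act].
- rewrite coord_tensorr; apply: IH => //; [exact: smooth_act|exact: wbound_act].
- rewrite /= pderiv_tensorl//; apply: IH => //; first exact: smooth_pderiv.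
  exact: (wbound_act (inr j) pA).
- rewrite /= pderiv_tensorr//; apply: IH => //; first exact: smooth_pderiv.
  exact: (wbound_act (inr j) qB).
Qed.

End tensor.

(** * The spaces in terms of words *)

Section word_class.
Context {R : realType}.
Local Notation Re := (@complex.Re R).
Local Notation Im := (@complex.Im R).
Variable sigma : R.
Hypothesis sigma_gt1 : 1 < sigma.

(** One sequence u controls all words, so that the two indices of the seminorms
    become the single length N. *)
Definition word_class (c : ultra_case) d (phi : 'rV[R]_d -> R[i]) : Prop :=
  smooth phi /\ exists2 u : nat -> R, tame sigma c u & forall N, wbound phi N (u N).

Section normal_order.
Context {d : nat}.
Local Notation fn := ('rV[R]_d -> R[i]).
Implicit Types (phi psi : fn) (A B : R) (N : nat) (i : 'I_d) (s : seq 'I_d).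

Definition deriv_word s phi : fn := foldr (@pderiv R d) phi s.

Lemma smooth_deriv_word s phi : smooth phi -> smooth (deriv_word s phi).
Proof. by move=> sp; elim: s => //= i s; exact: smooth_pderiv. Qed.

Lemma deriv_word_rem i s phi : smooth phi -> i \in s ->
  deriv_word s phi = deriv_word (i :: rem i s) phi.
Proof.
move=> sp; elim: s => //= j s IH; rewrite inE; case: eqVneq => [->//|ij] /= si.
rewrite (IH si) /=; exact: (pderiv_comm _ _ (smooth_deriv_word _ sp)).
Qed.

(** By Schwarz's theorem any derivative can be moved to the front. *)
Lemma perm_deriv_word s1 s2 phi : smooth phi -> perm_eq s1 s2 ->
  deriv_word s1 phi = deriv_word s2 phi.
Proof.
move=> sp; elim: s1 s2 => [|i s1 IH] s2 s12.
  by have /perm_nilP -> : perm_eq s2 [::] by rewrite perm_sym.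
have is2 : i \in s2 by rewrite -(perm_mem s12) mem_head.
rewrite (deriv_word_rem sp is2) /=; congr (pderiv _ _); apply: IH.
by rewrite -(perm_cons i) (perm_trans s12)// perm_to_rem.
Qed.

Definition expand_index (beta : 'I_d -> nat) : seq 'I_d :=
  flatten [seq nseq (beta i) i | i <- enum 'I_d].

Lemma mderivE beta phi : mderiv beta phi = deriv_word (expand_index beta) phi.
Proof.
rewrite /mderiv /expand_index; elim: (enum _) => //= i s ->.
rewrite /deriv_word foldr_cat; elim: (beta i) => //= k.
by rewrite /deriv_word => ->.
Qed.

Lemma count_expand_index beta i : count_mem i (expand_index beta) = beta i.
Proof.
rewrite /expand_index count_flatten -map_comp.
have -> : sumn [seq (count_mem i \o (fun j => nseq (beta j) j)) j | j <- enum 'I_d] =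
    (\sum_(j <- enum 'I_d) (j == i) * beta j)%N.
  rewrite sumnE big_map; apply: eq_bigr => j _ /=.
  by rewrite count_nseq.
rewrite big_enum/= (bigD1 i)//= eqxx mul1n big1 ?addn0// => j /negbTE ->.
by rewrite mul0n.
Qed.

Lemma size_expand_index beta : size (expand_index beta) = mabs beta.
Proof.
rewrite /expand_index size_flatten /shape -map_comp sumnE big_map /mabs big_enum/=.
by apply: eq_bigr => i _ /=; rewrite size_nseq.
Qed.

Lemma perm_expand_index s : perm_eq s (expand_index (fun i => count_mem i s)).
Proof.
apply/allP => /= i _; apply/eqP.
by rewrite count_expand_index.
Qed.

Lemma mabs_count s : mabs (fun i => count_mem i s) = size s.
Proof. by rewrite -size_expand_index; apply/esym/perm_size/perm_expand_index. Qed.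

(** Commuting a coordinate out of a word of derivatives removes each of its
    occurrences once. *)
Lemma deriv_word_coord i s phi : smooth phi ->
  deriv_word s (fun x => (x 0 i)%:C * phi x) =
  fun x => (x 0 i)%:C * deriv_word s phi x +
           (count_mem i s)%:R * deriv_word (rem i s) phi x.
Proof.
move=> sp; elim: s => [|j s IH] /=.
  by apply/funext => x; rewrite mul0r addr0.
have sd t : smooth (deriv_word t phi) by exact: smooth_deriv_word.
rewrite IH pderivD; last 2 first.
  by apply: smoothM => //; exact: smooth_coord.
  exact: smoothZ.
rewrite pderivM ?pderivZ//; last exact: smooth_coord.
apply/funext => x; rewrite pderiv_coord eq_sym.
have [->|ji] := eqVneq j i; last first.
  by rewrite mul0r add0r add0n.
rewrite mul1r add1n.
case: (boolP (i \in s)) => [si|/count_memPn ->]; last by rewrite mul0r addr0 mul1r addrC.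
rewrite -[pderiv i (deriv_word (rem i s) phi)]/(deriv_word (i :: rem i s) phi).
by rewrite -deriv_word_rem// mulrS mulrDl mul1r addrAC addrC addrA.
Qed.

(** Bounds on normally ordered words: all coordinates act after all derivatives. *)
Definition mbound phi N A : Prop := forall (alpha : 'I_d -> nat) s,
  (mabs alpha <= N)%N -> (size s <= N)%N ->
  forall x, normc ((monomial alpha x)%:C * deriv_word s phi x) <= A.

Definition incr_index i (alpha : 'I_d -> nat) : 'I_d -> nat :=
  fun j => ((j == i) + alpha j)%N.

Lemma mabs_incr i alpha : mabs (incr_index i alpha) = (mabs alpha).+1.
Proof.
rewrite /mabs big_split/= (bigD1 i)//= eqxx big1; first by rewrite addn0 add1n.
by move=> j /negbTE ->.
Qed.

Lemma monomial_incr i alpha (x : 'rV[R]_d) :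
  monomial (incr_index i alpha) x = x 0 i * monomial alpha x.
Proof.
rewrite /monomial /incr_index; under eq_bigr do rewrite exprD.
rewrite big_split/= (bigD1 i)//= eqxx expr1 big1 ?mulr1//.
by move=> j /negbTE ->.
Qed.

Lemma mbound_ge0 phi N A : mbound phi N A -> 0 <= A.
Proof.
move=> H; have := H (fun=> 0%N) [::].
by rewrite /mabs big1// => /(_ isT isT 0); apply: le_trans; exact: normc_ge0.
Qed.

(** A new coordinate has to be moved to the left of at most N derivatives; each
    commutator is again normally ordered. *)
Lemma mbound_act l phi N A : smooth phi -> mbound phi N.+1 A ->
  mbound (act l phi) N (N.+1%:R * A).
Proof.
move=> sp H alpha s aN sN x; have A0 := mbound_ge0 H.
case: l => i /=; last first.
  rewrite -[deriv_word s (pderiv i phi)]/(deriv_word s (deriv_word [:: i] phi)).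
  rewrite /deriv_word -foldr_cat; apply: (@le_trans _ _ A); last first.
    by rewrite ler_peMl// ler1n.
  by apply: H; [exact: leqW|rewrite size_cat addn1].
rewrite deriv_word_coord// mulrDr (le_trans (le_normcD _ _))//.
rewrite -natr1 mulrDl mul1r [leRHS]addrC lerD//.
  have := H (incr_index i alpha) s; rewrite mabs_incr ltnS => /(_ aN (leqW sN) x).
  by rewrite monomial_incr rmorphM -mulrA mulrCA.
rewrite mulrCA normcM.
have -> : normc (count_mem i s)%:R = (count_mem i s)%:R :> R.
  rewrite -[X in normc X](rmorph_nat (real_complex R)) normc_real ger0_norm//.
rewrite ler_pM ?normc_ge0 ?ler_nat ?(leq_trans (count_size _ _))//.
apply: H; first exact: leqW.
by rewrite (leq_trans _ (leqW sN))// size_subseq// rem_subseq.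
Qed.

(** Normal ordering letter by letter multiplies the bound by 1, 2, ..., N. *)
Lemma mbound_wbound phi N A : smooth phi -> mbound phi N A ->
  wbound phi N (N`!%:R * A).
Proof.
have base p M C x : mbound p M C -> normc (p x) <= C.
  move=> /(_ (fun=> 0%N) [::]); rewrite /mabs big1// => /(_ isT isT x).
  by rewrite /monomial big1 ?mul1r// => i _; rewrite expr0.
elim: N phi A => [|N IH] phi A sp pA.
  by move=> [|//] _ x; rewrite fact0 mul1r; exact: base pA.
apply: wbound_rec => [x|l].
  rewrite (le_trans (base _ _ _ x pA))// ler_peMl ?(mbound_ge0 pA)//.
  by rewrite ler1n fact_gt0.
have := IH _ _ (smooth_act l sp) (mbound_act l sp pA).
by rewrite factS mulnC natrM mulrA.
Qed.

Lemma ultra_boundP tau C phi : ultra_bound sigma tau C phi <->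
  forall alpha beta x, normc ((monomial alpha x)%:C * mderiv beta phi x) <=
    C * Mseq tau sigma (mabs alpha) * Mseq tau sigma (mabs beta).
Proof.
split=> H alpha beta.
  move=> x; rewrite -lee_fin; apply: le_trans (H alpha beta).
  by apply: ereal_sup_ubound; exists x.
by apply: ge_ereal_sup => _ [x _ <-]; rewrite lee_fin.
Qed.

Lemma ultra_bound_mbound tau C phi N : 0 < tau -> 0 < C -> smooth phi ->
  ultra_bound sigma tau C phi -> mbound phi N (C * Mseq (tau + tau) sigma N).
Proof.
move=> t0 C0 sp /ultra_boundP H alpha s aN sN x.
rewrite (perm_deriv_word sp (perm_expand_index s)) -mderivE.
rewrite (le_trans (H _ _ _))// MseqD mulrA -!mulrA ler_pM2l//.
have M0 p := ltW (Mseq_gt0 sigma tau p).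
by rewrite ler_pM// ler_Mseq// ?(ltW t0)// mabs_count.
Qed.

Lemma monomial_word alpha phi : exists2 w : seq (letter d), size w = mabs alpha &
  word w phi = fun x => (monomial alpha x)%:C * phi x.
Proof.
exists (map inl (expand_index alpha)); first by rewrite size_map size_expand_index.
apply/funext => x; rewrite /monomial.
rewrite (_ : \prod_i _ = \prod_(i <- expand_index alpha) x 0 i).
  elim: (expand_index alpha) => [|i s IH] /=; first by rewrite big_nil mul1r.
  by rewrite big_cons IH rmorphM mulrA.
rewrite /expand_index big_flatten big_map big_enum/=; apply: eq_bigr => i _.
by rewrite big_nseq; elim: (alpha i) => //= k <-; rewrite exprS.
Qed.

Lemma deriv_wordE s phi : deriv_word s phi = word (map inr s) phi.
Proof. by elim: s => //= i s ->. Qed.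

Lemma wbound_moment phi N A alpha beta x : (mabs alpha + mabs beta <= N)%N ->
  wbound phi N A -> normc ((monomial alpha x)%:C * mderiv beta phi x) <= A.
Proof.
move=> abN H; rewrite mderivE deriv_wordE.
have [w sw E] := monomial_word alpha (word (map inr (expand_index beta)) phi).
have := H (w ++ map inr (expand_index beta)) _ x.
rewrite /word foldr_cat -/(word w _) -/(word _ phi) E; apply.
by rewrite size_cat size_map size_expand_index sw.
Qed.

End normal_order.

Lemma leq_fact_exp N : (N`! <= N ^ N)%N.
Proof.
elim: N => // N IH; rewrite factS expnS leq_mul2l /=.
by apply: (leq_trans IH); case: N {IH} => // N; rewrite leq_exp2r.
Qed.

(** The least admissible u is the supremum over all words of length at most N; the
    factorial from normal ordering is absorbed in an arbitrarily small part of
    tau, here tau / 3 in the Beurling case. *)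
Lemma in_S_word_class c d (phi : 'rV[R]_d -> R[i]) :
  in_S c sigma phi -> word_class c phi.
Proof.
move=> [sp H]; split => //.
pose E N := [set r | exists w, (size w <= N)%N /\ exists x, r = normc (word w phi x)].
have E0 N : E N !=set0 by exists (normc (phi 0)), [::]; split => //; exists 0.
pose b tau C N := N`!%:R * (C * Mseq (tau + tau) sigma N).
have EC tau C N : 0 < tau -> 0 < C -> ultra_bound sigma tau C phi ->
    ubound (E N) (b tau C N).
  move=> t0 C0 HC r [w [wN [x ->]]].
  by apply: mbound_wbound => //; exact: ultra_bound_mbound.
have bM tau tau' C : 0 < tau' -> 0 < C -> exists2 D : R, 0 < D & forall N,
    b tau C N <= D * Mseq (tau' + (tau + tau)) sigma N.
  move=> t'0 C0; have [D D0 HD] := Mseq_absorb sigma_gt1 t'0 (lexx 1).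
  exists (D * C) => [|N]; first exact: mulr_gt0.
  rewrite /b (MseqD _ tau') mulrACA; apply: ler_wpM2r.
    by rewrite mulr_ge0 ?(ltW C0) ?(ltW (Mseq_gt0 _ _ _)).
  by rewrite (le_trans _ (HD N))// expr1n mul1r -natrX ler_nat leq_fact_exp.
have supE N r : ubound (E N) r -> sup (E N) <= r by exact: ge_sup.
exists (fun N => sup (E N)); last first.
  move=> N w wN x; apply: ub_le_sup; last by exists w; split => //; exists x.
  case: c H => [[tau t0 [C C0 HC]]|/(_ 1 ltr01)[C C0 HC]].
    by exists (b tau C N); exact: EC.
  by exists (b 1 C N); exact: EC.
case: c H => [[tau t0 [C C0 HC]]|H tau t0].
  exists (1 + (tau + tau)); first by rewrite !addr_gt0.
  have [D D0 HD] := bM tau 1 C ltr01 C0; exists D => // N.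
  by rewrite (le_trans _ (HD N))// supE//; exact: EC.
have t30 : 0 < tau / 3 by rewrite divr_gt0.
have [C C0 HC] := H _ t30.
have [D D0 HD] := bM (tau / 3) (tau / 3) C t30 C0.
exists D => // N; have -> : tau = tau / 3 + (tau / 3 + tau / 3) by field.
by rewrite (le_trans _ (HD N))// supE//; exact: EC.
Qed.

(** The seminorm of order (alpha, beta) is a word of length |alpha| + |beta|, and
    the sequence splits over this sum. *)
Lemma word_class_in_S c d (phi : 'rV[R]_d -> R[i]) :
  word_class c phi -> in_S c sigma phi.
Proof.
move=> [sp [u tu ub]]; split => //.
have key tau C : 0 < tau -> 0 < C -> (forall N, u N <= C * Mseq tau sigma N) ->
    exists2 D : R, 0 < D & ultra_bound sigma (split_factor sigma * tau) D phi.
  move=> t0 C0 uC; have [E E0 HE] := Mseq_split sigma_gt1 t0.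
  exists (C * E); first exact: mulr_gt0.
  apply/ultra_boundP => alpha beta x.
  apply: (le_trans (wbound_moment x (leqnn _) (ub _))).
  apply: (le_trans (uC _)); rewrite -2!mulrA ler_pM2l// mulrA; exact: HE.
case: c tu => [[tau t0 [C C0 uC]]|tu tau t0].
  exists (split_factor sigma * tau); last exact: key uC.
  by rewrite mulr_gt0 ?split_factor_gt0.
have k0 := split_factor_gt0 sigma.
have t'0 : 0 < (split_factor sigma)^-1 * tau by rewrite mulr_gt0 ?invr_gt0.
have [C C0 uC] := tu _ t'0; have [D D0 HD] := key _ _ t'0 C0 uC.
by exists D => //; rewrite mulVKf ?gt_eqF// in HD.
Qed.

End word_class.

(** * Lebesgue measure on row vectors *)

Section boxes.
Context {R : realType} {n : nat}.
Local Notation RM := (measurableTypeR R).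
Implicit Types (G : set (set RM)) (B : 'I_n -> set RM).

Definition box B : set 'rV[R]_n := [set x | forall i, B i (x 0 i)].

Definition boxes G : set (set 'rV[R]_n) :=
  [set A | exists2 B, (forall i, G (B i)) & A = box B].

Lemma boxesI G : setI_closed G -> setI_closed (boxes G).
Proof.
move=> GI _ _ [B GB ->] [C GC ->]; exists (fun i => B i `&` C i).
  by move=> i; exact: GI.
apply/seteqP; split=> x; first by move=> [Bx Cx] i; split; [exact: Bx|exact: Cx].
by move=> H; split=> i; have [] := H i.
Qed.

Lemma measurable_box B : (forall i, measurable (B i)) -> measurable (box B).
Proof.
move=> mB; rewrite (_ : box B = \big[setI/setT]_(i < n) ((fun x : 'rV[R]_n => x 0 i) @^-1` B i)).
  apply: bigsetI_measurable => i _; rewrite -[X in measurable X]setTI.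
  exact: (@measurable_rV_coord R n i measurableT _ (mB i)).
apply/seteqP; split=> x /=; rewrite -bigcap_seq/=; first by move=> H i _; exact: H.
by move=> H i; apply: H; exact: mem_index_enum.
Qed.

(** Coordinates are measurable for the sigma-algebra of boxes, since a condition
    on one coordinate is a box with full sides elsewhere. *)
Lemma measurable_boxes G : @measurable _ RM = <<s G >> -> G setT ->
  @measurable _ 'rV[R]_n = <<s boxes G >>.
Proof.
move=> mG GT; apply/seteqP; split; last first.
  apply: smallest_sub; first exact: sigma_algebra_measurable.
  move=> _ [B GB ->]; apply: measurable_box => i.
  by rewrite mG; apply: sub_sigma_algebra.
have mid : measurable_fun setT (id : g_sigma_algebraType (boxes G) -> 'rV[R]_n).
  apply: measurable_fun_rV => i; apply: (measurability _ mG) => _ [Y GY <-].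
  rewrite setTI; apply: sub_sigma_algebra.
  exists (fun j => if j == i then Y else setT); first by move=> j; case: ifP.
  apply/seteqP; split=> x /=; first by move=> Yx j; case: eqP => [->|].
  by move=> /(_ i); rewrite eqxx.
by move=> A mA; have := mid measurableT A mA; rewrite setTI.
Qed.

End boxes.

Section continuous_measurable.
Context {R : realType} {n : nat}.

(** An open set is the union of the countably many rational cubes inside it. *)
Lemma open_measurable_rV (U : set 'rV[R]_n) : open U -> measurable U.
Proof.
move=> oU.
pose Q (p : 'rV[rat]_n * nat) : set 'rV[R]_n :=
  box (fun i => `]ratr (p.1 0 i) - p.2.+1%:R^-1, ratr (p.1 0 i) + p.2.+1%:R^-1[%classic).
have mQ p : measurable (Q p) by apply: measurable_box => i; exact: measurable_itv.
rewrite (_ : U = \bigcup_(p in [set p | Q p `<=` U]) Q p); last first.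
  apply/seteqP; split=> [x Ux|x [p /= QU] /QU//].
  have /nbhs_ballP[e /= e0 xeU] : nbhs x U by exact: open_nbhs_nbhs.
  pose k := Num.trunc (2 / e).
  have k0 : 0 < k.+1%:R^-1 :> R by rewrite invr_gt0.
  have ke : k.+1%:R^-1 < e / 2.
    rewrite -[e / 2]invrK ltf_pV2 ?posrE ?invr_gt0 ?divr_gt0// invf_div.
    exact: truncnS_gt.
  have ex i : exists q : rat, ratr q \in `]x 0 i - k.+1%:R^-1, x 0 i + k.+1%:R^-1[.
    have /rat_in_itvoo[q xq] : x 0 i - k.+1%:R^-1 < x 0 i + k.+1%:R^-1.
      by rewrite ltrD2l gtrN.
    by exists q.
  have [q Hq] := choice ex.
  exists (\row_i q i, k) => /=.
    move=> y Qy; apply: xeU; rewrite -ball_normE /ball_/=.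
    rewrite [X in X < _]/Num.norm /= mx_normrE; apply/bigmax_ltP; split=> //= -[a i] _ /=.
    rewrite !mxE ord1; have := Hq i; have := Qy i; rewrite /= mxE !in_itv/= => /andP[y1 y2] /andP[x1 x2].
    move: ke y1 y2 x1 x2; move: (ratr (q i)) (k.+1%:R^-1) => w r ke y1 y2 x1 x2.
    by rewrite ltr_norml; apply/andP; split; lra.
  move=> i /=; rewrite mxE; have := Hq i; rewrite !in_itv/=.
  move: (ratr (q i)) (k.+1%:R^-1) => w r /andP[x1 x2].
  by apply/andP; split; lra.
rewrite bigcup_mkcond; apply: countable_bigcupT_measurable; first exact: countableP.
by move=> p; case: ifP.
Qed.

Lemma continuous_measurable_rV (f : 'rV[R]_n -> R) :
  continuous f -> measurable_fun setT f.
Proof.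
move=> cf; apply: (measurability _ (RGenOInfty.measurableE R)) => _ [_ [a ->] <-].
rewrite setTI; apply: open_measurable_rV.
apply: open_comp; last exact: rray_open.
by move=> x _; exact: cf.
Qed.

End continuous_measurable.

Lemma measurable_row_mx d (T : measurableType d) (R : realType) (n m : nat)
    (s : T -> 'rV[R]_n) (t : T -> 'rV[R]_m) :
  measurable_fun setT s -> measurable_fun setT t ->
  measurable_fun setT (fun p => row_mx (s p) (t p)).
Proof.
move=> ms mt; apply: measurable_fun_rV => i; case: (split_ordP i) => j ->.
  under eq_fun do rewrite row_mxEl.
  exact: (measurableT_comp (measurable_rV_coord j) ms).
under eq_fun do rewrite row_mxEr.
exact: (measurableT_comp (measurable_rV_coord j) mt).
Qed.

Section scaled_pushforward.
Context d {T : measurableType d} {R : realType} (mu : {measure set T -> \bar R}).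
Variables (f : T -> T) (k : {nonneg R}).
Hypothesis mf : measurable_fun setT f.
Hypothesis muf : forall A, measurable A -> (k%:num%:E * mu (f @^-1` A) = mu A)%E.
Local Open Scope ereal_scope.

(** Change of variables for nonnegative functions follows from the behaviour of
    the measure on sets. *)
Lemma ge0_integral_scaled (g : T -> \bar R) :
  measurable_fun setT g -> (forall t, 0 <= g t) ->
  \int[mu]_t g t = k%:num%:E * \int[mu]_t g (f t).
Proof.
move=> mg g0; pose p : {measure set T -> \bar R} := pushforward mu f.
rewrite (_ : \int[mu]_t g (f t) = \int[p mf]_t g t); last first.
  by rewrite /p [RHS]ge0_integral_pushforward//.
rewrite -(ge0_integral_mscale (p mf) measurableT k)//.
apply: eq_measure_integral => A mA _ /=.
exact/esym/muf.
Qed.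

End scaled_pushforward.

Section affine_invariance.
Context {R : realType}.
Local Notation RM := (measurableTypeR R).
Variables (c : R) (c0 : c != 0).

Lemma lebesgue_measure_affine (v : R) (A : set RM) : measurable A ->
  (`|c|%:E * lebesgue_measure ((fun t : RM => (c * t + v)%R : RM) @^-1` A) = lebesgue_measure A)%E.
Proof.
pose f (t : RM) : RM := c * t + v.
have mf : measurable_fun setT f.
  by apply: measurable_funD => //; exact: measurable_funM.
pose k : {nonneg R} := NngNum (normr_ge0 c).
pose p : {measure set RM -> \bar R} := pushforward lebesgue_measure f.
pose m : {measure set RM -> \bar R} := mscale k (p mf).
move=> mA; transitivity (m A); first by [].
apply/esym/lebesgue_measure_unique => // _ [[a b]] _ <- /=.
rewrite /mscale /=; rewrite /pushforward.
have [cp|cn|] := ltgtP c 0; last by move/eqP; rewrite (negbTE c0).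
- rewrite (_ : f @^-1` _ = `[(b - v) / c, (a - v) / c[%classic); last first.
    apply/seteqP; split=> t /=; rewrite !in_itv/= /f => /andP[t1 t2]; apply/andP.
      by rewrite ler_ndivrMr// ltr_ndivlMr//; split; lra.
    by rewrite ler_ndivrMr// in t1; rewrite ltr_ndivlMr// in t2; split; lra.
  rewrite !lebesgue_measure_itv/= !lte_fin ltr_nM2r ?invr_lt0// ltrD2r.
  case: ifP => _; last by rewrite mule0.
  by rewrite -!EFinD -EFinM; congr EFin; rewrite ltr0_norm//; field.
- rewrite (_ : f @^-1` _ = `](a - v) / c, (b - v) / c]%classic); last first.
    apply/seteqP; split=> t /=; rewrite !in_itv/= /f => /andP[t1 t2]; apply/andP.
      by rewrite ltr_pdivrMr// ler_pdivlMr//; split; lra.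
    by rewrite ltr_pdivrMr// in t1; rewrite ler_pdivlMr// in t2; split; lra.
  rewrite !lebesgue_measure_itv/= !lte_fin ltr_pM2r ?invr_gt0// ltrD2r.
  case: ifP => _; last by rewrite mule0.
  by rewrite -!EFinD -EFinM; congr EFin; rewrite gtr0_norm//; field.
Qed.

Context {n : nat}.
Implicit Types (v : 'rV[R]_n) (A : set 'rV[R]_n).
Local Notation mu := (@lebesgue_rV R n).

Lemma measurable_affine v :
  measurable_fun setT (fun t : 'rV[R]_n => c *: t + v).
Proof.
apply: measurable_fun_rV => i; under eq_fun do rewrite !mxE.
apply: measurable_funD => //; apply: measurable_funM => //.
exact: measurable_rV_coord.
Qed.

(** Both sides are measures in A that agree on boxes, by the one-dimensional case
    in each coordinate. *)
Lemma lebesgue_rV_affine v A : measurable A ->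
  ((`|c| ^+ n)%:E * mu ((fun t : 'rV[R]_n => (c *: t + v)%R) @^-1` A) = mu A)%E.
Proof.
pose f (t : 'rV[R]_n) : 'rV[R]_n := c *: t + v.
have mf : measurable_fun setT f := measurable_affine v.
pose k : {nonneg R} := NngNum (exprn_ge0 n (normr_ge0 c)).
pose p : {measure set 'rV[R]_n -> \bar R} := pushforward mu f.
pose m : {measure set 'rV[R]_n -> \bar R} := mscale k (p mf).
move=> mA; transitivity (m A); first by [].
pose g (j : nat) : set 'rV[R]_n := box (fun=> `]- j%:R, j%:R[%classic).
apply/esym; apply: (@measure_unique _ R _ (boxes (@measurable _ RM)) g _ _ _ _ mu m _ _ A mA).
- apply: measurable_boxes => //.
  apply/seteqP; split; first exact: sub_sigma_algebra.
  by apply: smallest_sub => //; exact: sigma_algebra_measurable.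
- by apply: boxesI => X Y; exact: measurableI.
- by move=> j; eexists; [|reflexivity] => i /=; exact: measurable_itv.
- rewrite -subTset => x _; exists (Num.trunc `|x|).+1 => // i /=.
  by rewrite in_itv/= -ltr_norml (le_lt_trans (norm_coord x i))// truncnS_gt.
- move=> _ [B mB ->]; transitivity ((`|c| ^+ n)%:E * mu (f @^-1` box B))%E; last by [].
  rewrite [LHS]lebesgue_rV_box//.
  rewrite (_ : f @^-1` _ = box (fun i => (fun t : RM => (c * t + v 0 i)%R : RM) @^-1` B i)); last first.
    by apply/seteqP; split=> x /= H i; have := H i; rewrite /= /f !mxE.
  rewrite [X in (_ * X)%E](lebesgue_rV_box); last first.
    move=> i; rewrite -[X in measurable X]setTI.
    have mi : measurable_fun setT (fun t : RM => (c * t + v 0 i)%R : RM).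
      by apply: measurable_funD => //; exact: measurable_funM.
    exact: mi.
  have prodZ q (a b : 'I_q -> \bar R) : (forall i, `|c|%:E * a i = b i)%E ->
      ((`|c| ^+ q)%:E * \prod_(i < q) a i = \prod_(i < q) b i)%E.
    elim: q a b => [|q IH] a b ab; first by rewrite !big_ord0 expr0 mul1e.
    by rewrite !big_ord_recl exprS EFinM muleACA ab (IH _ (fun i => b (lift ord0 i))).
  by apply/esym/prodZ => i; exact: lebesgue_measure_affine.
- move=> j; rewrite [X in (X < _)%E]lebesgue_rV_box//.
  rewrite -ge0_fin_numE; last by apply: prode_ge0 => i _; exact: measure_ge0.
  apply: prode_fin_num => i _; rewrite lebesgue_measure_itv/=.
  by case: ifP.
Qed.

Local Open Scope ereal_scope.

Lemma ge0_integral_affine v (g : 'rV[R]_n -> \bar R) :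
  measurable_fun setT g -> (forall t, 0 <= g t) ->
  \int[mu]_t g t = (`|c| ^+ n)%:E * \int[mu]_t g (c *: t + v)%R.
Proof.
exact: (@ge0_integral_scaled _ _ _ _ _ (NngNum (exprn_ge0 n (normr_ge0 c)))
  (measurable_affine v) (lebesgue_rV_affine v)).
Qed.

Lemma measurable_comp_affine v (g : 'rV[R]_n -> \bar R) :
  measurable_fun setT g -> measurable_fun setT (fun t : 'rV[R]_n => g (c *: t + v)%R).
Proof. by move=> mg; exact: (measurableT_comp mg (measurable_affine v)). Qed.

Lemma integrable_affine v (g : 'rV[R]_n -> \bar R) :
  mu.-integrable setT g -> mu.-integrable setT (fun t => g (c *: t + v)%R).
Proof.
move=> /integrableP[mg goo]; apply/integrableP; split.
  exact: measurable_comp_affine.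
have cn : 0 < (`|c| ^+ n)%:E by rewrite lte_fin exprn_gt0// normr_gt0.
rewrite -(@lte_pmul2l _ (`|c| ^+ n)%:E)// -(ge0_integral_affine v (g := abse \o g))//.
  by rewrite (lt_le_trans goo)// gt0_muley.
  exact: measurableT_comp.
by move=> t; exact: abse_ge0.
Qed.

Lemma integral_affine v (g : 'rV[R]_n -> \bar R) : mu.-integrable setT g ->
  \int[mu]_t g t = (`|c| ^+ n)%:E * \int[mu]_t g (c *: t + v)%R.
Proof.
move=> ig; have mg := measurable_int _ ig.
pose h (t : 'rV[R]_n) : 'rV[R]_n := (c *: t + v)%R.
rewrite -[\int[mu]_t g (c *: t + v)%R]/(\int[mu]_t (g \o h) t).
have fin := integrable_pos_fin_num measurableT (integrable_affine v ig).
rewrite integralE [in RHS]integralE muleBr//; last exact: fin_num_adde_defr.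
rewrite (ge0_integral_affine v (measurable_funepos mg))//.
rewrite (ge0_integral_affine v (measurable_funeneg mg))//.
by rewrite (funepos_comp g h) (funeneg_comp g h).
Qed.

End affine_invariance.

Section rV_step.
Context {R : realType}.
Local Notation leb := (@lebesgue_measure R).
Local Open Scope ereal_scope.

Lemma ge0_integral_rV_cons n (g : 'rV[R]_n.+1 -> \bar R) :
  measurable_fun setT g -> (forall x, 0 <= g x) ->
  \int[lebesgue_rV n.+1]_x g x = \int[leb \x lebesgue_rV n]_p g (rV_cons p).
Proof.
move=> mg g0.
by apply: (etrans (ge0_integral_pushforward (@measurable_rV_cons R n)
  (leb \x lebesgue_rV n) measurableT mg (fun y _ => g0 y))).
Qed.

Lemma integrable_rV_cons n (g : 'rV[R]_n.+1 -> \bar R) : measurable_fun setT g ->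
  (lebesgue_rV n.+1).-integrable setT g <->
  (leb \x lebesgue_rV n).-integrable setT (g \o @rV_cons R n).
Proof.
move=> mg; have mg' : measurable_fun setT (g \o @rV_cons R n).
  exact: (measurableT_comp mg (@measurable_rV_cons R n)).
have E := @ge0_integral_rV_cons n (abse \o g) (measurableT_comp (@abse_measurable R setT) mg).
split=> /integrableP[_ goo]; apply/integrableP; split => //.
  by rewrite -E// => x; exact: abse_ge0.
by rewrite E// => x; exact: abse_ge0.
Qed.

Lemma integral_rV_cons n (g : 'rV[R]_n.+1 -> \bar R) :
  (lebesgue_rV n.+1).-integrable setT g ->
  \int[lebesgue_rV n.+1]_x g x = \int[leb \x lebesgue_rV n]_p g (rV_cons p).
Proof.
move=> ig; have mg := measurable_int _ ig.
rewrite -(@integral_pushforward _ _ _ _ _ _ (@measurable_rV_cons R n) _ setT g mg)//.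
exact/integrable_rV_cons.
Qed.

End rV_step.

(** * Complex-valued integrals *)

Section complex_integral.
Context d {T : measurableType d} {R : realType} (mu : {measure set T -> \bar R}).
Local Notation Re := (@complex.Re R).
Local Notation Im := (@complex.Im R).
Implicit Types (h k : T -> R[i]) (g : T -> R).

Definition cint h : R[i] := (\int[mu]_t Re (h t)) +i* (\int[mu]_t Im (h t)).

Definition cmeasurable h : Prop :=
  measurable_fun setT (Re \o h) /\ measurable_fun setT (Im \o h).

Definition cintegrable h : Prop :=
  mu.-integrable setT (EFin \o (Re \o h)) /\
  mu.-integrable setT (EFin \o (Im \o h)).

Lemma cintegrable_measurable h : cintegrable h -> cmeasurable h.
Proof. by move=> [/measurable_int/measurable_EFinP ? /measurable_int/measurable_EFinP]. Qed.

Lemma cmeasurable_cst (a : R[i]) : cmeasurable (fun=> a).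
Proof. by split; exact: measurable_cst. Qed.

Lemma cmeasurable_real g : measurable_fun setT g -> cmeasurable (fun t => (g t)%:C).
Proof. by move=> mg; split => //; exact: measurable_cst. Qed.

Lemma cmeasurableM h k : cmeasurable h -> cmeasurable k ->
  cmeasurable (fun t => h t * k t).
Proof.
move=> [hr hi] [kr ki]; split.
  rewrite (_ : Re \o _ = (fun t => Re (h t) * Re (k t) - Im (h t) * Im (k t))).
    by apply: measurable_funB; apply: measurable_funM.
  by apply/funext => t /=; rewrite cReM.
rewrite (_ : Im \o _ = (fun t => Re (h t) * Im (k t) + Im (h t) * Re (k t))).
  by apply: measurable_funD; apply: measurable_funM.
by apply/funext => t /=; rewrite cImM.
Qed.

Lemma cmeasurableB h k : cmeasurable h -> cmeasurable k ->
  cmeasurable (fun t => h t - k t).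
Proof.
move=> [hr hi] [kr ki]; split.
  rewrite (_ : Re \o _ = (fun t => Re (h t) - Re (k t))).
    exact: measurable_funB.
  by apply/funext => t /=; rewrite cReD; case: (k t).
rewrite (_ : Im \o _ = (fun t => Im (h t) - Im (k t))).
  exact: measurable_funB.
by apply/funext => t /=; rewrite cImD; case: (k t).
Qed.

Lemma cmeasurable_conj h : cmeasurable h -> cmeasurable (fun t => (h t)^*).
Proof.
move=> [hr hi]; split.
  by rewrite (_ : Re \o _ = Re \o h)//; apply/funext => t /=; rewrite cReJ.
rewrite (_ : Im \o _ = (fun t => - Im (h t))); first exact: measurable_funN.
by apply/funext => t /=; rewrite cImJ.
Qed.

Lemma cmeasurable_prod (I : Type) (s : seq I) (F : I -> T -> R[i]) :
  (forall i, cmeasurable (F i)) -> cmeasurable (fun t => \prod_(i <- s) F i t).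
Proof.
move=> mF; elim: s => [|i s IH].
  rewrite (_ : (fun _ => _) = fun=> 1); first exact: cmeasurable_cst.
  by apply/funext => t; rewrite big_nil.
rewrite (_ : (fun _ => _) = fun t => F i t * \prod_(j <- s) F j t).
  exact: cmeasurableM.
by apply/funext => t; rewrite big_cons.
Qed.

Lemma cintegrable_dom h g : cmeasurable h -> (forall t, normc (h t) <= g t) ->
  mu.-integrable setT (EFin \o g) -> cintegrable h.
Proof.
move=> [mr mi] hg ig; split; apply: le_integrable ig => //; first exact/measurable_EFinP.
- by move=> t _ /=; rewrite lee_fin (le_trans (Re_le_normc _))// (le_trans (hg t))// ler_norm.
- exact/measurable_EFinP.
- by move=> t _ /=; rewrite lee_fin (le_trans (Im_le_normc _))// (le_trans (hg t))// ler_norm.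
Qed.

Lemma cintegrable_normc h : cintegrable h ->
  exists2 g, mu.-integrable setT (EFin \o g) & forall t, normc (h t) <= g t.
Proof.
move=> [/integrable_norm ir /integrable_norm ii].
exists (fun t => `|Re (h t)| + `|Im (h t)|); last by move=> t; exact: normc_le_parts.
have := integrableD measurableT ir ii.
by apply: eq_integrable.
Qed.

Lemma cintegrableM h (b : T -> R[i]) (A : R) : cintegrable h -> cmeasurable b ->
  (forall t, normc (b t) <= A) -> cintegrable (fun t => b t * h t).
Proof.
move=> ih mb bA; have [g ig hg] := cintegrable_normc ih.
apply: (@cintegrable_dom _ (fun t => A * g t)).
- by apply: cmeasurableM => //; exact: cintegrable_measurable.
- by move=> t; rewrite normcM ler_pM ?normc_ge0.
- by apply: eq_integrable (integrableZl measurableT A ig).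
Qed.

Lemma cintegrableZ h (a : R[i]) : cintegrable h -> cintegrable (fun t => a * h t).
Proof.
move=> ih; apply: (@cintegrableM h (fun=> a) (normc a)) => //.
exact: cmeasurable_cst.
Qed.

Lemma cintZ h (a : R[i]) : cintegrable h -> cint (fun t => a * h t) = a * cint h.
Proof.
move=> [ir ii]; have iZ g r : mu.-integrable setT (EFin \o g) ->
    mu.-integrable setT (EFin \o (fun t => r * g t)).
  by move=> ig; apply: eq_integrable (integrableZl measurableT r ig).
apply: eq_complex_parts; rewrite /cint /=.
  under eq_Rintegral do rewrite cReM.
  rewrite RintegralB ?RintegralZl//; [|exact: iZ|exact: iZ].
  by rewrite cReM.
under eq_Rintegral do rewrite cImM.
rewrite RintegralD ?RintegralZl//; [|exact: iZ|exact: iZ].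
by rewrite cImM.
Qed.

Lemma cintD h k : cintegrable h -> cintegrable k ->
  cint (fun t => h t + k t) = cint h + cint k.
Proof.
move=> [hr hi] [kr ki]; apply: eq_complex_parts; rewrite /cint /=.
  by under eq_Rintegral do rewrite cReD; rewrite RintegralD ?cReD.
by under eq_Rintegral do rewrite cImD; rewrite RintegralD ?cImD.
Qed.

(** The factor 2 comes from bounding the real and imaginary parts separately; only
    the order of magnitude matters below. *)
Lemma normc_cint h g : cmeasurable h -> (forall t, normc (h t) <= g t) ->
  mu.-integrable setT (EFin \o g) -> normc (cint h) <= 2 * \int[mu]_t g t.
Proof.
move=> mh hg ig; have [ir ii] := cintegrable_dom mh hg ig.
rewrite mulr_natl mulr2n (le_trans (normc_le_parts _))//.
have key f : (forall t, `|f t| <= g t) -> mu.-integrable setT (EFin \o f) ->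
    `|\int[mu]_t f t| <= \int[mu]_t g t.
  move=> fg i_f; rewrite (le_trans (le_normr_Rintegral measurableT i_f))//.
  by apply: le_Rintegral => //; exact: integrable_norm.
apply: lerD; apply: key => // t.
  exact: le_trans (Re_le_normc _) (hg t).
exact: le_trans (Im_le_normc _) (hg t).
Qed.

Lemma ae_eq_cint h k : cmeasurable h -> cmeasurable k ->
  {ae mu, forall t, h t = k t} -> cint h = cint k.
Proof.
move=> [hr hi] [kr ki] hk; apply: eq_complex_parts; rewrite /cint /=.
  congr fine; apply: ae_eq_integral => //; try exact/measurable_EFinP.
  by apply: filterS hk => t hkt _ /=; rewrite hkt.
congr fine; apply: ae_eq_integral => //; try exact/measurable_EFinP.
by apply: filterS hk => t hkt _ /=; rewrite hkt.
Qed.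

Lemma Rintegral_dominated_cvg (f_ : nat -> T -> R) (f g : T -> R) :
  (forall j : nat, measurable_fun setT (f_ j)) -> measurable_fun setT f ->
  {ae mu, forall t, f_ ^~ t @ \oo --> f t} ->
  (forall (j : nat) t, `|f_ j t| <= g t) -> mu.-integrable setT (EFin \o g) ->
  (fun j : nat => \int[mu]_t f_ j t) @ \oo --> \int[mu]_t f t.
Proof.
move=> mf_ mf f_f f_g ig.
have f_fE : {ae mu, forall t, setT t -> (fun j : nat => (f_ j t)%:E) @ \oo --> (f t)%:E}.
  by apply: filterS f_f => t H _; apply: cvg_EFin => //; exact: nearW.
have [i_f _ /=] := @dominated_convergence _ _ _ mu setT measurableT
  (fun j t => (f_ j t)%:E) (fun t => (f t)%:E) (EFin \o g)
  (fun j => (measurable_EFinP _ _).2 (mf_ j)) ((measurable_EFinP _ _).2 mf)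
  f_fE ig (aeW _ (fun t j _ => f_g j t)).
by rewrite -(fineK (integrable_fin_num measurableT i_f)) => H; exact: fine_cvg H.
Qed.

End complex_integral.

Lemma cmeasurable_comp d d' (T : measurableType d) (T' : measurableType d')
    (R : realType) (h : T -> R[i]) (s : T' -> T) :
  cmeasurable h -> measurable_fun setT s -> cmeasurable (fun p => h (s p)).
Proof.
by move=> [hr hi] ms; split;
  [exact: (measurableT_comp hr ms)|exact: (measurableT_comp hi ms)].
Qed.

Section fubini.
Context d1 d2 {T1 : measurableType d1} {T2 : measurableType d2} {R : realType}.
Variables (m1 : {sigma_finite_measure set T1 -> \bar R}).
Variables (m2 : {sigma_finite_measure set T2 -> \bar R}).
Local Notation Re := (@complex.Re R).
Local Notation Im := (@complex.Im R).
Local Open Scope ereal_scope.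

Lemma Rintegral12_prod (f : T1 * T2 -> R) :
  (m1 \x m2).-integrable setT (EFin \o f) ->
  (forall x, m2.-integrable setT (fun y => (f (x, y))%:E)) ->
  (\int[m1]_x \int[m2]_y f (x, y) = \int[m1 \x m2]_p f p)%R /\
  m1.-integrable setT (fun x => (\int[m2]_y f (x, y))%R%:E).
Proof.
move=> jf f2.
have E x : (\int[m2]_y f (x, y))%R%:E = fubini_F m2 (EFin \o f) x.
  by rewrite /Rintegral fineK//; exact: integrable_fin_num.
split; last first.
  apply: eq_integrable (integrable_fubini_F jf) => // x _; exact/esym/E.
rewrite /Rintegral -(integral12_prod_meas1 jf); congr fine.
by apply: eq_integral => x _; exact: E.
Qed.

Lemma Rintegral21_prod (f : T1 * T2 -> R) :
  (m1 \x m2).-integrable setT (EFin \o f) ->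
  (forall y, m1.-integrable setT (fun x => (f (x, y))%:E)) ->
  (\int[m2]_y \int[m1]_x f (x, y) = \int[m1 \x m2]_p f p)%R.
Proof.
move=> jf f1.
rewrite /Rintegral -(integral21_prod_meas1 jf); congr fine.
apply: eq_integral => y _; rewrite fineK//; exact: integrable_fin_num.
Qed.

(** Domination by a product of functions of one variable each, so that Tonelli's
    criterion is immediate. *)
Lemma integrable_prod (f : T1 * T2 -> R) (g1 : T1 -> R) (g2 : T2 -> R) :
  measurable_fun setT f -> (forall x y, `|f (x, y)| <= g1 x * g2 y)%R ->
  m1.-integrable setT (EFin \o g1) -> m2.-integrable setT (EFin \o g2) ->
  (m1 \x m2).-integrable setT (EFin \o f).
Proof.
move=> mf fg i1 i2.
have j1 := integrable_norm i1; have j2 := integrable_norm i2.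
have m1' : measurable_fun setT g1 by apply/measurable_EFinP/measurable_int/i1.
have m2' : measurable_fun setT g2 by apply/measurable_EFinP/measurable_int/i2.
pose G (p : T1 * T2) : R := (g1 p.1 * g2 p.2)%R.
have mG : measurable_fun setT G.
  apply: measurable_funM.
    exact: (measurableT_comp m1' measurable_fst).
  exact: (measurableT_comp m2' measurable_snd).
apply: (@le_integrable _ _ _ _ _ _ _ (EFin \o G)) => //.
- exact/measurable_EFinP.
- by move=> [x y] _ /=; rewrite lee_fin (le_trans (fg x y))// ler_norm.
apply/integrable12ltyP; first exact/measurable_EFinP.
have E x : \int[m2]_y `|(EFin \o G) (x, y)| = (`|g1 x|)%:E * \int[m2]_y (`|g2 y|)%:E.
  rewrite -ge0_integralZl//; last first.
    exact: measurable_int j2.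
  by apply: eq_integral => y _; rewrite /= normrM.
under eq_integral do rewrite E.
have /integrableP[_ foo] := j2.
have fin : \int[m2]_y (`|g2 y|)%:E \is a fin_num.
  by have := integrable_fin_num measurableT j2.
rewrite -(fineK fin) ge0_integralZr//; last 2 first.
- exact: measurable_int j1.
- by rewrite lee_fin fine_ge0// integral_ge0.
rewrite lte_mul_pinfty//; first by rewrite integral_ge0.
- by have := integrable_fin_num measurableT j1.
- by rewrite ltry.
Qed.

Lemma cintegrable_prod (h : T1 * T2 -> R[i]) (g1 : T1 -> R) (g2 : T2 -> R) :
  cmeasurable h -> (forall x y, normc (h (x, y)) <= g1 x * g2 y)%R ->
  m1.-integrable setT (EFin \o g1) -> m2.-integrable setT (EFin \o g2) ->
  cintegrable (m1 \x m2) h.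
Proof.
move=> [mr mi] hg i1 i2; split; apply: integrable_prod i1 i2 => //.
  by move=> x y; exact: le_trans (Re_le_normc _) (hg x y).
by move=> x y; exact: le_trans (Im_le_normc _) (hg x y).
Qed.

Lemma cint12_prod (h : T1 * T2 -> R[i]) : cintegrable (m1 \x m2) h ->
  (forall x, cintegrable m2 (fun y => h (x, y))) ->
  cint m1 (fun x => cint m2 (fun y => h (x, y))) = cint (m1 \x m2) h.
Proof.
move=> [ir ii] s; apply: eq_complex_parts; rewrite /cint /=.
  by have [] := @Rintegral12_prod (Re \o h) ir (fun x => (s x).1).
by have [] := @Rintegral12_prod (Im \o h) ii (fun x => (s x).2).
Qed.

Lemma cint21_prod (h : T1 * T2 -> R[i]) : cintegrable (m1 \x m2) h ->
  (forall y, cintegrable m1 (fun x => h (x, y))) ->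
  cint m2 (fun y => cint m1 (fun x => h (x, y))) = cint (m1 \x m2) h.
Proof.
move=> [ir ii] s; apply: eq_complex_parts; rewrite /cint /=.
  exact: (@Rintegral21_prod (Re \o h) ir (fun x => (s x).1)).
exact: (@Rintegral21_prod (Im \o h) ii (fun x => (s x).2)).
Qed.

Lemma cint_tensor (f : T1 -> R[i]) (g : T2 -> R[i]) :
  cintegrable m1 f -> cintegrable m2 g ->
  cintegrable (m1 \x m2) (fun p => f p.1 * g p.2)%R /\
  cint (m1 \x m2) (fun p => f p.1 * g p.2)%R = (cint m1 f * cint m2 g)%R.
Proof.
move=> i_f i_g.
have [f' if' ff'] := cintegrable_normc i_f; have [g' ig' gg'] := cintegrable_normc i_g.
have mfst : cmeasurable (fun p : T1 * T2 => f p.1).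
  have [mr mi] := cintegrable_measurable i_f; split.
    exact: (measurableT_comp mr measurable_fst).
  exact: (measurableT_comp mi measurable_fst).
have msnd : cmeasurable (fun p : T1 * T2 => g p.2).
  have [mr mi] := cintegrable_measurable i_g; split.
    exact: (measurableT_comp mr measurable_snd).
  exact: (measurableT_comp mi measurable_snd).
have I : cintegrable (m1 \x m2) (fun p => f p.1 * g p.2)%R.
  apply: cintegrable_prod if' ig'; first exact: (cmeasurableM mfst msnd).
  by move=> x y /=; rewrite normcM ler_pM ?normc_ge0.
split => //; rewrite -cint12_prod//=; last by move=> x; exact: cintegrableZ.
transitivity (cint m1 (fun x => cint m2 g * f x)%R).
  by congr cint; apply/funext => x; rewrite cintZ// mulrC.
by rewrite cintZ// mulrC.
Qed.

End fubini.

Section product_functions.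
Context {R : realType}.
Local Notation leb := (@lebesgue_measure R).
Local Notation RM := (measurableTypeR R).

Lemma cmeasurable_coord n (h : RM -> R[i]) (i : 'I_n) : cmeasurable h ->
  cmeasurable (fun x : 'rV[R]_n => h (x 0 i)).
Proof.
by move=> mh; exact: (cmeasurable_comp mh (measurable_rV_coord i)).
Qed.

Lemma cint_rV_cons n (h : 'rV[R]_n.+1 -> R[i]) : cmeasurable h ->
  cintegrable (leb \x lebesgue_rV n)%E (fun p => h (rV_cons p)) ->
  cintegrable (lebesgue_rV n.+1) h /\
  cint (lebesgue_rV n.+1) h = cint (leb \x lebesgue_rV n)%E (fun p => h (rV_cons p)).
Proof.
move=> [mr mi] [ir ii].
have I : cintegrable (lebesgue_rV n.+1) h.
  by split; apply/integrable_rV_cons => //; exact/measurable_EFinP.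
split => //; case: I => jr ji; apply: eq_complex_parts; rewrite /cint /=.
  by congr fine; rewrite (integral_rV_cons jr).
by congr fine; rewrite (integral_rV_cons ji).
Qed.

(** Induction on the dimension, peeling off one coordinate by Fubini. *)
Lemma cint_coord_prod n (h : 'I_n -> RM -> R[i]) :
  (forall i, cintegrable leb (h i)) ->
  cintegrable (lebesgue_rV n) (fun x => \prod_i h i (x 0 i)) /\
  cint (lebesgue_rV n) (fun x => \prod_i h i (x 0 i)) = \prod_i cint leb (h i).
Proof.
elim: n h => [|n IH] h ih.
  have E : (fun x : 'rV[R]_0 => \prod_i h i (x 0 i)) = fun=> 1.
    by apply/funext => x; rewrite big_ord0.
  rewrite E big_ord0; split.
    apply: (@cintegrable_dom _ _ _ _ _ (fun=> 1)).
    - exact: cmeasurable_cst.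
    - by move=> _; rewrite normc1.
    - apply/integrableP; split; first exact: measurable_cst.
      rewrite integral_cst//= normr1 mul1e diracE.
      by case: (_ \in _); rewrite ?ltry.
  have l0 : lebesgue_rV 0 [set: 'rV[R]_0] = 1%E by rewrite /= diracE in_setT.
  apply: eq_complex_parts; rewrite /cint.
    by rewrite -[LHS]/(\int[lebesgue_rV 0]_t 1) Rintegral_cst// [X in fine X]l0 mulr1.
  by rewrite -[LHS]/(\int[lebesgue_rV 0]_t 0) Rintegral_cst// mul0r.
have [J EJ] := IH (fun i => h (lift ord0 i)) (fun i => ih _).
have [K EK] := cint_tensor (ih ord0) J.
have E : (fun p : RM * 'rV[R]_n => h ord0 p.1 * \prod_i h (lift ord0 i) (p.2 0 i)) =
    (fun p => \prod_i h i (rV_cons p 0 i)).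
  apply/funext => p; rewrite big_ord_recl rV_consE unlift_none; congr (_ * _).
  by apply: eq_bigr => i _; rewrite rV_consE liftK.
rewrite E in K EK.
have M : cmeasurable (fun x : 'rV[R]_n.+1 => \prod_i h i (x 0 i)).
  apply: (@cmeasurable_prod _ _ _ _ _ (fun i (x : 'rV[R]_n.+1) => h i (x 0 i))) => i.
  exact/cmeasurable_coord/cintegrable_measurable.
have [I EI] := cint_rV_cons M K.
by split => //; rewrite EI EK EJ big_ord_recl.
Qed.

Lemma integrable_oneDsqrV :
  leb.-integrable setT (fun x => ((1 + x ^+ 2)^-1)%:E).
Proof.
have c := @continuous_oneDsqrV R.
apply/integrableP; split.
  by apply/measurable_EFinP; exact: (continuous_measurable_fun c).
rewrite (_ : (\int[leb]_x _)%E = (\int[leb]_x ((oneDsqr x)^-1)%:E)%E); last first.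
  by apply: eq_integral => x _; rewrite /= ger0_norm// invr_ge0 addr_ge0// sqr_ge0.
rewrite (@ge0_symfun_integralT _ (fun x => (oneDsqr x)^-1))//; last first.
  by move=> x /=; rewrite /oneDsqr sqrrN.
rewrite (_ : [set x | _] = `[0%R, +oo[%classic); last first.
  by apply/seteqP; split=> x /=; rewrite in_itv/= andbT.
by rewrite integral0y_oneDsqr -EFinM ltry.
Qed.

Lemma Rintegral_oneDsqrV : \int[leb]_x (1 + x ^+ 2)^-1 = pi.
Proof.
have c := @continuous_oneDsqrV R.
rewrite /Rintegral (@ge0_symfun_integralT _ (fun x => (oneDsqr x)^-1))//; last first.
  by move=> x /=; rewrite /oneDsqr sqrrN.
rewrite (_ : [set x | _] = `[0%R, +oo[%classic); last first.
  by apply/seteqP; split=> x /=; rewrite in_itv/= andbT.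
by rewrite integral0y_oneDsqr -EFinM /= mulrC divfK.
Qed.

(** A product over the coordinates, so that its integral splits; dominating a
    function by it takes two letters per coordinate. *)
Definition decay n (x : 'rV[R]_n) : R := \prod_i (1 + x 0 i ^+ 2)^-1.

Lemma decay_ge0 n (x : 'rV[R]_n) : 0 <= decay x.
Proof. by apply: prodr_ge0 => i _; rewrite invr_ge0 addr_ge0// sqr_ge0. Qed.

Lemma integrable_decay n : (lebesgue_rV n).-integrable setT (EFin \o @decay n).
Proof.
have i1 : cintegrable leb (fun x : RM => ((1 + x ^+ 2)^-1)%:C).
  split; first exact: integrable_oneDsqrV.
  rewrite (_ : _ \o _ = cst 0%E)//; exact: integrable0.
have [[ir _] _] := @cint_coord_prod n (fun _ x => ((1 + x ^+ 2)^-1)%:C) (fun _ => i1).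
apply: eq_integrable ir => // x _ /=.
by rewrite -rmorph_prod.
Qed.

End product_functions.

(** * The partial Fourier transform *)

Section phases.
Context {R : realType}.
Local Notation Re := (@complex.Re R).
Local Notation Im := (@complex.Im R).

Lemma normc_expi (a : R) : normc (expi a) = 1.
Proof. by rewrite /expi /normc cos2Dsin2 sqrtr1. Qed.

Lemma expiD (a b : R) : expi (a + b) = expi a * expi b.
Proof.
apply: eq_complex_parts; first by rewrite cReM /expi /= cosD.
by rewrite cImM /expi /= sinD addrC.
Qed.

Lemma expi0 : expi (0 : R) = 1.
Proof. by rewrite /expi cos0 sin0. Qed.

Lemma cder_expi d (L : 'rV[R]_d -> R) x v (a : R) :
  (forall s : R, L (s *: v + x) = s * a + L x) ->
  cder v (expi \o L) x ((0 +i* a) * expi (L x)).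
Proof.
move=> HL.
have dL (b : R) : is_derive (0 : R) 1 (fun s : R => s * a + b) a.
  apply: is_derive_eq.
  by rewrite addr0 scaler0 add0r [_ *: _]mulr1.
split; rewrite -[x]add0r -(scale0r v); apply/is_derive_lineE.
  rewrite (_ : (fun r : R => _) = cos \o (fun s : R => s * a + L x)); last first.
    by apply/funext => s /=; rewrite HL.
  apply: is_derive_eq (is_derive1_comp (is_derive_cos _) (dL (L x))) _.
  by rewrite cReM /= scale0r add0r mul0r add0r mul0r sub0r mulNr mulrC.
rewrite (_ : (fun r : R => _) = sin \o (fun s : R => s * a + L x)); last first.
  by apply/funext => s /=; rewrite HL.
apply: is_derive_eq (is_derive1_comp (is_derive_sin _) (dL (L x))) _.
by rewrite cImM /= scale0r add0r mul0r add0r mul0r add0r mulrC.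
Qed.

Lemma cder_comp_affine d d' (B : 'M[R]_(d, d')) v0 (phi : 'rV[R]_d' -> R[i]) v w x l :
  v *m B = w -> cder w phi (affine B v0 x) l -> cder v (phi \o affine B v0) x l.
Proof. by move=> <- [dr di]; split; exact: is_derive_affine. Qed.

Lemma ccont_cmeasurable n (h : 'rV[R]_n -> R[i]) : ccont h -> cmeasurable h.
Proof. by move=> [hr hi]; split; exact: continuous_measurable_rV. Qed.

Lemma measurable_dot n (w : 'rV[R]_n) : measurable_fun setT (dot w).
Proof.
apply: measurable_sum => i; apply: measurable_funM => //.
exact: measurable_rV_coord.
Qed.

Lemma cmeasurable_expi d (T : measurableType d) (L : T -> R) :
  measurable_fun setT L -> cmeasurable (fun t => expi (L t)).
Proof.
move=> mL; split.
  have mc : measurable_fun setT (@cos R).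
    by apply: continuous_measurable_fun; exact: continuous_cos.
  exact: (measurableT_comp mc mL).
have ms : measurable_fun setT (@sin R).
  by apply: continuous_measurable_fun; exact: continuous_sin.
exact: (measurableT_comp ms mL).
Qed.

Lemma cmeasurable_wave n (r : R) (w : 'rV[R]_n) :
  cmeasurable (fun t => expi (r * dot w t)).
Proof.
by apply: cmeasurable_expi; apply: measurable_funM => //; exact: measurable_dot.
Qed.

Lemma cmeasurable_waveN n (r : R) (w : 'rV[R]_n) :
  cmeasurable (fun t => expi (- (r * dot w t))).
Proof. by under eq_fun do rewrite -mulNr; exact: cmeasurable_wave. Qed.

Lemma dotDl n (x y t : 'rV[R]_n) : dot (x + y) t = dot x t + dot y t.
Proof. by rewrite /dot -big_split; apply: eq_bigr => i _; rewrite mxE mulrDl. Qed.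

Lemma dotC n (x y : 'rV[R]_n) : dot x y = dot y x.
Proof. by apply: eq_bigr => i _; rewrite mulrC. Qed.

Lemma dotDr n (t x y : 'rV[R]_n) : dot t (x + y) = dot t x + dot t y.
Proof. by rewrite dotC dotDl !(dotC t). Qed.

Lemma dotZl n (a : R) (x t : 'rV[R]_n) : dot (a *: x) t = a * dot x t.
Proof. by rewrite /dot mulr_sumr; apply: eq_bigr => i _; rewrite mxE mulrA. Qed.

Lemma dotZr n (a : R) (x t : 'rV[R]_n) : dot x (a *: t) = a * dot x t.
Proof. by rewrite dotC dotZl dotC. Qed.

Lemma dot_delta n (i : 'I_n) (t : 'rV[R]_n) : dot (delta_mx 0 i) t = t 0 i.
Proof.
rewrite /dot (bigD1 i)//= mxE !eqxx mul1r big1 ?addr0// => j ji.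
by rewrite mxE (negbTE ji) andbF mul0r.
Qed.

Lemma dot0l n (t : 'rV[R]_n) : dot 0 t = 0.
Proof. by rewrite /dot big1// => i _; rewrite mxE mul0r. Qed.

End phases.

Section derivation_under_integral.
Context {R : realType} {n d : nat}.
Local Notation mu := (@lebesgue_rV R n).
Local Notation Re := (@complex.Re R).
Local Notation Im := (@complex.Im R).

(** On the line through x in direction v the one-variable theorem applies to the
    real and imaginary parts. *)
Lemma cder_cint (G G' : 'rV[R]_d -> 'rV[R]_n -> R[i]) (g : 'rV[R]_n -> R) v x :
  (forall y, cintegrable mu (G y)) ->
  (forall y t, cder v (G ^~ t) y (G' y t)) ->
  (forall (s : R) t, `|s| <= 1 -> normc (G' (s *: v + x) t) <= g t) ->
  mu.-integrable setT (EFin \o g) ->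
  cder v (fun y => cint mu (G y)) x (cint mu (G' x)).
Proof.
move=> iG dG G'g ig.
have key (f f' : 'rV[R]_d -> 'rV[R]_n -> R) :
    (forall y, mu.-integrable setT (EFin \o f y)) ->
    (forall y t, is_derive y v (f ^~ t) (f' y t)) ->
    (forall (s : R) t, `|s| <= 1 -> `|f' (s *: v + x) t| <= g t) ->
    is_derive x v (fun y => \int[mu]_t f y t) (\int[mu]_t f' x t).
  move=> i_f df f'g.
  pose F (s : R) t := f (s *: v + x) t.
  have dF (s : R) t : is_derive s (1 : R) (F ^~ t) (f' (s *: v + x) t).
    exact/is_derive_lineE.
  have d1F (s : R) t : partial1of2 F s t = f' (s *: v + x) t.
    by rewrite partial1of2E; apply: derive_val.
  have in1 (s : R) : `]-1, 1[%classic s -> `|s| <= 1.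
    by rewrite /= in_itv/= ler_norml => /andP[/ltW -> /ltW ->].
  have z0 : `]-1, 1[%classic (0 : R) by rewrite /= in_itv/= ltrN10 ltr01.
  have g0 t : 0 <= g t.
    by rewrite (le_trans (normr_ge0 _) (f'g 0 t _))// normr0.
  have iF (s : R) : `]-1, 1[%classic s -> mu.-integrable setT (EFin \o F s).
    by move=> _; exact: i_f.
  have derF (s : R) t : `]-1, 1[%classic s -> setT t -> derivable (F ^~ t) s 1.
    by move=> _ _; have [] := dF s t.
  have bF (s : R) t : `]-1, 1[%classic s -> setT t -> `|partial1of2 F s t| <= g t.
    by move=> s1 _; rewrite d1F f'g// in1.
  have D1 := derivable_under_integral measurableT z0 iF derF g0 ig bF.
  have D2 := differentiation_under_integral measurableT z0 iF derF g0 ig bF.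
  rewrite -[x]add0r -(scale0r v); apply/is_derive_lineE; apply: DeriveDef => //.
  rewrite derive1E in D2; rewrite D2; apply: eq_Rintegral => t _.
  by rewrite d1F.
split.
  apply: (key (fun y t => Re (G y t)) (fun y t => Re (G' y t))).
  - by move=> y; have [] := iG y.
  - by move=> y t; have [] := dG y t.
  - by move=> s t s1; exact: le_trans (Re_le_normc _) (G'g s t s1).
apply: (key (fun y t => Im (G y t)) (fun y t => Im (G' y t))).
- by move=> y; have [] := iG y.
- by move=> y t; have [] := dG y t.
- by move=> s t s1; exact: le_trans (Im_le_normc _) (G'g s t s1).
Qed.

End derivation_under_integral.

Section rapid_decay.
Context {R : realType} {n : nat}.
Local Notation mu := (@lebesgue_rV R n).

(** The qualitative version of the space: enough for all integrals to converge. *)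
Definition rapid d (H : 'rV[R]_d -> R[i]) : Prop :=
  smooth H /\ forall N, exists A : R, wbound H N A.

Lemma rapid_act d (l : letter d) (H : 'rV[R]_d -> R[i]) : rapid H -> rapid (act l H).
Proof.
move=> [sH bH]; split; first exact: smooth_act.
by move=> N; have [A HA] := bH N.+1; exists A; exact: wbound_act.
Qed.

Lemma decay_gt0 (t : 'rV[R]_n) : 0 < decay t.
Proof. by apply: prodr_gt0 => i _; rewrite invr_gt0 ltr_pwDl// sqr_ge0. Qed.

(** Each factor 1 + x_i^2 costs two letters. *)
Lemma wbound_decay (H : 'rV[R]_(n + n) -> R[i]) A : smooth H ->
  wbound H (2 * n) A ->
  forall x t : 'rV[R]_n, normc (H (row_mx x t)) <= 2 ^+ n * A * decay t.
Proof.
move=> sH HA x t.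
pose X i := inl (rshift n i) : letter (n + n).
pose damp i (F : 'rV[R]_(n + n) -> R[i]) z := F z + act (X i) (act (X i) F) z.
have sdamp i F : smooth F -> smooth (damp i F).
  by move=> sF; apply: smoothD => //; do 2 apply: smooth_act.
have bdamp i F M B : smooth F -> wbound F M.+2 B -> wbound (damp i F) M (2 * B).
  move=> sF FB; rewrite mulr_natl mulr2n; apply: wboundD => //.
  - by do 2 apply: smooth_act.
  - by apply: wbound_le FB => //; rewrite ltnW.
  - by do 2 apply: wbound_act.
have main (s : seq 'I_n) F M B : smooth F -> wbound F (2 * size s + M) B ->
    wbound (foldr damp F s) M (2 ^+ size s * B).
  elim: s M => [|i s IH] M sF; first by rewrite muln0 mul1r.
  move=> FB; rewrite exprS -mulrA; apply: bdamp.
    by elim: (s) => //= j r; exact: sdamp.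
  by apply: IH => //; apply: wbound_le FB => //=; lia.
have E (s : seq 'I_n) F z : foldr damp F s z =
    (\prod_(i <- s) (1 + z 0 (rshift n i) ^+ 2))%:C * F z.
  elim: s => [|i s IH] /=; first by rewrite big_nil mul1r.
  rewrite {1}/damp /= big_cons IH rmorphM rmorphD rmorph1 rmorphXn.
  by rewrite -[X in X = _]/(_ + _ * (_ * _)) expr2; ring.
have := main (index_enum 'I_n) H 0%N A sH.
have -> : size (index_enum 'I_n) = n.
  by rewrite -[RHS]card_ord cardE enumT.
rewrite addn0 => /(_ HA)/wbound_normc/(_ (row_mx x t)).
rewrite E normcM normc_real ger0_norm; last first.
  by apply: prodr_ge0 => i _; rewrite addr_ge0// sqr_ge0.
under eq_bigr do rewrite row_mxEr.
rewrite (_ : \prod_(i <- _) _ = (decay t)^-1); last first.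
  by rewrite /decay -prodfV; apply: eq_bigr => i _; rewrite invrK.
by rewrite mulrC ler_pdivrMr ?decay_gt0.
Qed.

(** Translating by at most 1 along an axis keeps a fixed integrable majorant, as
    differentiation under the integral requires. *)
Lemma decay_shift (t : 'rV[R]_n) (j : 'I_n) (s : R) : `|s| <= 1 ->
  decay (s *: delta_mx 0 j + t) <= 3 * decay t.
Proof.
move=> s1; rewrite /decay (bigD1 j)//= [in leRHS](bigD1 j)//= mulrA.
rewrite (_ : \prod_(i | i != j) _ = \prod_(i < n | i != j) (1 + t 0 i ^+ 2)^-1); last first.
  apply: eq_bigr => i ij; rewrite !mxE eqxx/= (negbTE ij).
  by rewrite mulr0 add0r.
apply: ler_wpM2r.
  by apply: prodr_ge0 => i _; rewrite invr_ge0 addr_ge0// sqr_ge0.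
rewrite !mxE !eqxx/= mulr1.
move: (t 0 j) => a.
have s2 : s ^+ 2 <= 1 by rewrite -real_normK ?num_real// expr_le1.
have p1 : 0 < 1 + (s + a) ^+ 2 by rewrite ltr_pwDl// sqr_ge0.
have p2 : 0 < 1 + a ^+ 2 by rewrite ltr_pwDl// sqr_ge0.
rewrite ler_pdivlMr// mulrC ler_pdivrMr//.
have := sqr_ge0 (a + 2 * s); nra.
Qed.

End rapid_decay.

Section partial_fourier.
Context {R : realType} {n : nat}.
Local Notation mu := (@lebesgue_rV R n).
Local Notation Re := (@complex.Re R).
Local Notation Im := (@complex.Im R).
Variable k : R.
Hypothesis k0 : k != 0.
Implicit Types (H : 'rV[R]_(n + n) -> R[i]) (z : 'rV[R]_(n + n)) (t : 'rV[R]_n).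

Definition pft_kernel H z t : R[i] :=
  expi (k * dot (rsubmx z) t) * H (row_mx (lsubmx z) t).

(** Fourier transform in the second half of the variables, with frequency
    normalization k. *)
Definition pft H z : R[i] := cint mu (pft_kernel H z).

Let fixl_mx : 'M[R]_(n + n) := block_mx 1%:M 0 0 0.

Let fixlE t z : row_mx (lsubmx z) t = affine fixl_mx (row_mx 0 t) z.
Proof.
rewrite /affine -[z in RHS]hsubmxK mul_row_block !mulmx0 mulmx1 !addr0.
by rewrite add_row_mx addr0 add0r.
Qed.

Let fixr_mx : 'M[R]_(n, n + n) := row_mx 0 1%:M.

Let fixrE x t : row_mx x t = affine fixr_mx (row_mx x 0) t.
Proof. by rewrite /affine mul_mx_row mulmx0 mulmx1 add_row_mx add0r addr0. Qed.

Lemma delta_lshift (j : 'I_n) :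
  delta_mx 0 (lshift n j) = row_mx (delta_mx 0 j) 0 :> 'rV[R]_(n + n).
Proof.
apply/rowP => i; case: (split_ordP i) => a ->.
  by rewrite row_mxEl !mxE (inj_eq (@lshift_inj _ _)).
by rewrite row_mxEr !mxE eq_rlshift andbF.
Qed.

Lemma delta_rshift (j : 'I_n) :
  delta_mx 0 (rshift n j) = row_mx 0 (delta_mx 0 j) :> 'rV[R]_(n + n).
Proof.
apply/rowP => i; case: (split_ordP i) => a ->.
  by rewrite row_mxEl !mxE eq_lrshift andbF.
by rewrite row_mxEr !mxE (inj_eq (@rshift_inj _ _)).
Qed.

Lemma kernel_cmeasurable H z : smooth H -> cmeasurable (pft_kernel H z).
Proof.
move=> sH; apply: cmeasurableM.
  exact: cmeasurable_wave.
apply: ccont_cmeasurable.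
rewrite (_ : (fun t => _) = H \o affine fixr_mx (row_mx (lsubmx z) 0)).
  exact/ccont_affine/smooth_ccont.
by apply/funext => t /=; rewrite fixrE.
Qed.

Lemma kernel_normc H z A : smooth H -> wbound H (2 * n) A ->
  forall t, normc (pft_kernel H z t) <= 2 ^+ n * A * decay t.
Proof. by move=> sH HA t; rewrite normcM normc_expi mul1r wbound_decay. Qed.

Let integrable_decayZ A : mu.-integrable setT (EFin \o (fun t => A * decay t)).
Proof. by apply: eq_integrable (integrableZl measurableT A (@integrable_decay R n)). Qed.

Lemma kernel_cintegrable H z : rapid H -> cintegrable mu (pft_kernel H z).
Proof.
move=> [sH /(_ (2 * n)%N)[A HA]].
apply: (cintegrable_dom (kernel_cmeasurable z sH) (kernel_normc z sH HA)).
exact: integrable_decayZ.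
Qed.

Definition decay_mass : R := 2 * \int[mu]_t decay t.

Lemma decay_mass_ge0 : 0 <= decay_mass.
Proof. by rewrite mulr_ge0// Rintegral_ge0// => t _; exact: decay_ge0. Qed.

Lemma pft_normc H z A : smooth H -> wbound H (2 * n) A ->
  normc (pft H z) <= decay_mass * 2 ^+ n * A.
Proof.
move=> sH HA.
rewrite (le_trans (normc_cint (kernel_cmeasurable z sH) (kernel_normc z sH HA) _))//.
rewrite RintegralZl//; last exact: integrable_decay.
by rewrite /decay_mass le_eqVlt; apply/orP; left; apply/eqP; ring.
Qed.

Lemma cder_kernel_l H (j : 'I_n) z t : smooth H ->
  cder (delta_mx 0 (lshift n j)) ((pft_kernel H) ^~ t) z
    (pft_kernel (pderiv (lshift n j) H) z t).
Proof.
move=> sH.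
have c1 : cder (delta_mx 0 (lshift n j))
    (expi \o (fun y : 'rV[R]_(n + n) => k * dot (rsubmx y) t)) z
    ((0 +i* 0) * expi (k * dot (rsubmx z) t)).
  apply: (cder_expi (L := fun y : 'rV[R]_(n + n) => k * dot (rsubmx y) t)) => s.
  rewrite linearD linearZ/= delta_lshift row_mxKr scaler0 add0r.
  by rewrite mulr0 add0r.
have c2 : cder (delta_mx 0 (lshift n j)) (H \o affine fixl_mx (row_mx 0 t)) z
    (pderiv (lshift n j) H (affine fixl_mx (row_mx 0 t) z)).
  have E : (delta_mx 0 (lshift n j) : 'rV[R]_(n + n)) *m fixl_mx = delta_mx 0 (lshift n j).
    by rewrite delta_lshift mul_row_block !mulmx0 mulmx1 !addr0.
  exact: (cder_comp_affine E (smooth_cder (lshift n j) _ sH)).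
have := cderM c1 c2.
rewrite (_ : 0 +i* 0 = 0)// mul0r mul0r add0r.
rewrite /pft_kernel /= -fixlE; congr (cder _ _ _ _).
by apply/funext => y /=; rewrite -fixlE.
Qed.

Lemma cder_kernel_r H (j : 'I_n) z t : smooth H ->
  cder (delta_mx 0 (rshift n j)) ((pft_kernel H) ^~ t) z
    ((0 +i* k) * pft_kernel (act (inl (rshift n j)) H) z t).
Proof.
move=> sH.
have c1 : cder (delta_mx 0 (rshift n j))
    (expi \o (fun y : 'rV[R]_(n + n) => k * dot (rsubmx y) t)) z
    ((0 +i* (k * t 0 j)) * expi (k * dot (rsubmx z) t)).
  apply: (cder_expi (L := fun y : 'rV[R]_(n + n) => k * dot (rsubmx y) t)) => s.
  rewrite linearD linearZ/= delta_rshift row_mxKr dotDl dotZl dot_delta.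
  by ring.
have c2 : cder (delta_mx 0 (rshift n j)) (H \o affine fixl_mx (row_mx 0 t)) z 0.
  have E : (delta_mx 0 (rshift n j) : 'rV[R]_(n + n)) *m fixl_mx = 0.
    by rewrite delta_rshift mul_row_block !mulmx0 !mul0mx !addr0 row_mx0.
  have D := smooth_cder_dir (0 : 'rV[R]_(n + n)) (affine fixl_mx (row_mx 0 t) z) sH.
  have E0 : \sum_i ((0 : 'rV[R]_(n + n)) 0 i)%:C *
      pderiv i H (affine fixl_mx (row_mx 0 t) z) = 0.
    by rewrite big1// => i _; rewrite mxE mul0r.
  by rewrite E0 in D; exact: (cder_comp_affine E D).
have := cderM c1 c2.
rewrite mulr0 addr0 /pft_kernel /= -fixlE row_mxEr.
rewrite (_ : 0 +i* (k * t 0 j) = (0 +i* k) * (t 0 j)%:C); last first.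
  by apply: eq_complex_parts; rewrite ?cReM ?cImM /= ?mul0r ?mulr0 ?subr0 ?add0r.
rewrite (_ : _ * _ * _ * _ = (0 +i* k) * (expi (k * dot (rsubmx z) t) *
  ((t 0 j)%:C * H (row_mx (lsubmx z) t)))); last by ring.
by congr (cder _ _ _ _); apply/funext => y /=; rewrite -fixlE.
Qed.

Lemma cder_pft_l H j z : rapid H ->
  cder (delta_mx 0 (lshift n j)) (pft H) z (pft (act (inr (lshift n j)) H) z).
Proof.
move=> rH; have [sH _] := rH.
have [s' /(_ (2 * n)%N)[A HA]] := rapid_act (inr (lshift n j)) rH.
apply: (cder_cint (G := pft_kernel H) (G' := pft_kernel (act (inr (lshift n j)) H))
  (g := fun t => 2 ^+ n * A * decay t)).
- by move=> y; exact: kernel_cintegrable.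
- by move=> y t; exact: cder_kernel_l.
- by move=> s t _; exact: kernel_normc.
- exact: integrable_decayZ.
Qed.

Lemma cder_pft_r H j z : rapid H ->
  cder (delta_mx 0 (rshift n j)) (pft H) z
    ((0 +i* k) * pft (act (inl (rshift n j)) H) z).
Proof.
move=> rH; have [sH _] := rH.
have rH' := rapid_act (inl (rshift n j)) rH.
have [s' /(_ (2 * n)%N)[A HA]] := rH'.
rewrite /pft -cintZ; last exact: kernel_cintegrable.
apply: (cder_cint (G := pft_kernel H)
  (G' := fun z t => (0 +i* k) * pft_kernel (act (inl (rshift n j)) H) z t)
  (g := fun t => normc (0 +i* k) * (2 ^+ n * A) * decay t)).
- by move=> y; exact: kernel_cintegrable.
- by move=> y t; exact: cder_kernel_r.
- move=> s t _; rewrite normcM -mulrA ler_wpM2l ?normc_ge0//; exact: kernel_normc.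
- exact: integrable_decayZ.
Qed.

(** Integration by parts: the integral of a derivative vanishes because it is
    the derivative of a translation-invariant integral. *)
Lemma pft_by_parts H j z : rapid H ->
  (z 0 (rshift n j))%:C * pft H z = (0 +i* k^-1) * pft (act (inr (rshift n j)) H) z.
Proof.
move=> rH; have [sH bH] := rH.
have rH' := rapid_act (inr (rshift n j)) rH; have [sH' bH'] := rH'.
pose w := rsubmx z; pose x := lsubmx z.
pose P' t := (0 +i* (k * w 0 j)) * pft_kernel H z t +
             pft_kernel (act (inr (rshift n j)) H) z t.
have dP t : cder (delta_mx 0 j) (pft_kernel H z) t (P' t).
  have c1 : cder (delta_mx 0 j) (expi \o (fun y : 'rV[R]_n => k * dot w y)) t
      ((0 +i* (k * w 0 j)) * expi (k * dot w t)).
    apply: (cder_expi (L := fun y : 'rV[R]_n => k * dot w y)) => s.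
    by rewrite dotDr dotZr (dotC w) dot_delta; ring.
  have c2 : cder (delta_mx 0 j) (H \o affine fixr_mx (row_mx x 0)) t
      (pderiv (rshift n j) H (affine fixr_mx (row_mx x 0) t)).
    have E : (delta_mx 0 j : 'rV[R]_n) *m fixr_mx = delta_mx 0 (rshift n j).
      by rewrite delta_rshift mul_mx_row mulmx0 mulmx1.
    exact: (cder_comp_affine E (smooth_cder (rshift n j) _ sH)).
  have := cderM c1 c2; rewrite /P' /pft_kernel /= -fixrE -/w -/x mulrA.
  by congr (cder _ _ _ _); apply/funext => y /=; rewrite -fixrE.
have iK := kernel_cintegrable z rH; have iK' := kernel_cintegrable z rH'.
have [A HA] := bH (2 * n)%N; have [A' HA'] := bH' (2 * n)%N.
pose B := normc (0 +i* (k * w 0 j)) * (2 ^+ n * A) + 2 ^+ n * A'.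
have B0 : 0 <= B.
  by rewrite addr_ge0 ?mulr_ge0 ?normc_ge0 ?exprn_ge0 ?(wbound_ge0 HA) ?(wbound_ge0 HA').
have P'B t : normc (P' t) <= B * decay t.
  rewrite (le_trans (le_normcD _ _))// mulrDl lerD ?kernel_normc//.
  by rewrite normcM -mulrA ler_wpM2l ?normc_ge0 ?kernel_normc.
have shift1 (y t : 'rV[R]_n) : y + t = 1 *: t + y by rewrite scale1r addrC.
have n10 : (1 : R) != 0 by exact: oner_neq0.
have tr y : cintegrable mu (fun t => pft_kernel H z (y + t)) /\
    cint mu (fun t => pft_kernel H z (y + t)) = cint mu (pft_kernel H z).
  have [ir ii] := iK; split.
    split; [have := integrable_affine n10 y ir|have := integrable_affine n10 y ii];
      by apply: eq_integrable => // t _ /=; rewrite shift1.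
  apply: eq_complex_parts; rewrite /cint /=.
    rewrite [RHS]/Rintegral (integral_affine n10 y ir) normr1 expr1n mul1e.
    by congr fine; apply: eq_integral => t _ /=; rewrite shift1.
  rewrite [RHS]/Rintegral (integral_affine n10 y ii) normr1 expr1n mul1e.
  by congr fine; apply: eq_integral => t _ /=; rewrite shift1.
have D : cder (delta_mx 0 j) (fun y => cint mu (fun t => pft_kernel H z (y + t))) 0
    (cint mu (fun t => P' (0 + t))).
  apply: (cder_cint (G := fun y t => pft_kernel H z (y + t)) (G' := fun y t => P' (y + t))
    (g := fun t => B * (3 * decay t))).
  - by move=> y; have [] := tr y.
  - move=> y t; have [dr di] := dP (y + t).
    split.
      apply/(is_derive_ext (f := (Re \o pft_kernel H z) \o affine 1%:M t)).
        by move=> u /=; rewrite /affine mulmx1.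
      by apply: is_derive_affine; rewrite mulmx1 /affine mulmx1.
    apply/(is_derive_ext (f := (Im \o pft_kernel H z) \o affine 1%:M t)).
      by move=> u /=; rewrite /affine mulmx1.
    by apply: is_derive_affine; rewrite mulmx1 /affine mulmx1.
  - move=> s t s1; rewrite addr0 (le_trans (P'B _))// ler_wpM2l//.
    exact: decay_shift.
  - have := integrable_decayZ (B * 3); apply: eq_integrable => // t _ /=.
    by rewrite mulrA.
have E0 : cint mu P' = 0.
  have -> : P' = fun t => P' (0 + t) by apply/funext => t; rewrite add0r.
  rewrite -(pderivE D) (_ : (fun y => _) = fun=> cint mu (pft_kernel H z)).
    by apply: pderivE; exact: cder_cst.
  by apply/funext => y; have [] := tr y.
move: E0; rewrite cintD//; last exact: cintegrableZ.
rewrite cintZ// -/(pft H z) -/(pft _ z) => E0.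
have {E0} <- : - ((0 +i* (k * w 0 j)) * pft H z) = pft (act (inr (rshift n j)) H) z.
  by apply/eqP; rewrite eq_sym -addr_eq0 addrC E0.
rewrite mulrN mulrA -mulNr; congr (_ * _).
by rewrite /w mxE; apply: eq_complex_parts; rewrite ?cReM ?cImM /=; field.
Qed.

Definition pft_factor : R := 1 + `|k| + `|k^-1|.

Lemma pft_factor_ge1 : 1 <= pft_factor.
Proof. by rewrite /pft_factor -addrA lerDl addr_ge0. Qed.

Lemma cder_pft H i z : rapid H -> exists a l,
  normc a <= pft_factor /\ forall z, cder (delta_mx 0 i) (pft H) z (a * pft (act l H) z).
Proof.
move=> rH; case: (split_ordP i) => j ->.
  exists 1, (inr (lshift n j)); split; first by rewrite normc1 pft_factor_ge1.
  by move=> y; rewrite mul1r; exact: cder_pft_l.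
exists (0 +i* k), (inl (rshift n j)); split; last by move=> y; exact: cder_pft_r.
rewrite (le_trans (normc_le_parts _))//= normr0 add0r /pft_factor.
by rewrite addrAC lerDr addr_ge0.
Qed.

(** The transform exchanges multiplications and derivatives in the transformed
    variables and commutes with them in the others. *)
Lemma act_pft H l : rapid H -> exists a l',
  normc a <= pft_factor /\ act l (pft H) = fun z => a * pft (act l' H) z.
Proof.
move=> rH; case: l => i; last first.
  have [a [l [ak da]]] := cder_pft i 0 rH; exists a, l; split => //.
  by apply/funext => z; apply: pderivE; exact: da.
case: (split_ordP i) => j ->.
  exists 1, (inl (lshift n j)); split; first by rewrite normc1 pft_factor_ge1.
  apply/funext => z /=; rewrite mul1r /pft -cintZ; last exact: kernel_cintegrable.
  congr cint; apply/funext => t; rewrite /pft_kernel /= row_mxEl mxE.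
  by rewrite mulrCA.
exists (0 +i* k^-1), (inr (rshift n j)); split.
  by rewrite (le_trans (normc_le_parts _))//= normr0 add0r /pft_factor lerDr addr_ge0.
by apply/funext => z; exact: pft_by_parts.
Qed.

(** Transforms of rapidly decreasing functions form a class stable under partial
    derivatives; continuity follows from the boundedness of the derivatives. *)
Lemma smooth_pft H : rapid H -> smooth (pft H).
Proof.
move=> rH; apply: (@smooth_coind _ _ (fun h => exists2 F, rapid F & h = pft F)); last by exists H.
  move=> _ [F rF ->].
  pose a i := projT1 (cid (cder_pft i 0 rF)).
  pose l i := projT1 (cid (projT2 (cid (cder_pft i 0 rF)))).
  have al i : normc (a i) <= pft_factor /\
      forall z, cder (delta_mx 0 i) (pft F) z (a i * pft (act (l i) F) z).
    exact: (projT2 (cid (projT2 (cid (cder_pft i 0 rF))))).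
  have [A FA] : exists A, wbound F (2 * n).+1 A by have [_] := rF; apply.
  have bd i z : normc (a i * pft (act (l i) F) z) <=
      pft_factor * (decay_mass * 2 ^+ n * A).
    rewrite normcM ler_pM ?normc_ge0//; first by have [] := al i.
    by apply: pft_normc; [have [] := rapid_act (l i) rF|exact: wbound_act].
  split.
    apply: (@bounded_partials_continuous _ _ _ (fun i z => Re (a i * pft (act (l i) F) z))).
      by move=> i z; have [_ /(_ z)[]] := al i.
    by move=> i z; exact: le_trans (Re_le_normc _) (bd i z).
  apply: (@bounded_partials_continuous _ _ _ (fun i z => Im (a i * pft (act (l i) F) z))).
    by move=> i z; have [_ /(_ z)[]] := al i.
  by move=> i z; exact: le_trans (Im_le_normc _) (bd i z).
move=> _ i [F rF ->]; have [a [l [_ da]]] := cder_pft i 0 rF.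
exists (fun z => a * pft (act l F) z) => //.
by apply/lspanZ/lspan1; exists (act l F) => //; exact: rapid_act.
Qed.

(** Each letter moves through the transform; what remains is an integral, bounded
    by words with 2n more letters. *)
Lemma wbound_pft H N A : rapid H -> wbound H (N + 2 * n) A ->
  wbound (pft H) N (pft_factor ^+ N * (decay_mass * 2 ^+ n * A)).
Proof.
have f1 := pft_factor_ge1.
elim: N H => [|N IH] H rH HA.
  by move=> [|//] _ z; rewrite expr0 mul1r; apply: pft_normc => //; case: rH.
have A0 := wbound_ge0 HA.
have B0 : 0 <= decay_mass * 2 ^+ n * A.
  apply: mulr_ge0 => //; apply: mulr_ge0; first exact: decay_mass_ge0.
  exact: exprn_ge0.
apply: wbound_rec => [z|l].
  apply: (@le_trans _ _ (decay_mass * 2 ^+ n * A)).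
    apply: pft_normc; first by case: rH.
    by apply: wbound_le HA => //; exact: leq_addl.
  by apply: ler_peMl => //; exact: exprn_ege1.
have [a [l' [ak ->]]] := act_pft l rH.
have rH' := rapid_act l' rH.
apply: wbound_le (wboundZ a (smooth_pft rH') (IH _ rH' _)) => //; last exact: wbound_act.
rewrite exprS -[leRHS]mulrA ler_wpM2r// mulr_ge0 ?exprn_ge0//.
exact: le_trans ler01 f1.
Qed.

End partial_fourier.

(** * The Poisson kernel *)

Section poisson_kernel.
Context {R : realType}.
Local Notation leb := (@lebesgue_measure R).
Local Notation RM := (measurableTypeR R).
Variable b : R.
Hypothesis b0 : 0 < b.

Let E (w : R) : R := expR (- (b * w)).

Let dE (w : R) : is_derive w 1 E (- b * E w).
Proof.
have d1 : is_derive w 1 (fun w : R => - (b * w)) (- b).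
  have := is_deriveN (is_deriveZ b (is_derive_id w (1 : R))).
  by rewrite [b *: 1]mulr1.
apply: is_derive_eq (@is_derive1_comp R expR (fun w => - (b * w)) w _ _ (is_derive_expR _) d1) _.
by rewrite mulrC.
Qed.

Let cE : continuous E.
Proof.
by move=> w; apply/differentiable_continuous/derivable1_diffP; have [] := dE w.
Qed.

Let E_cvg0 : E w @[w --> +oo] --> 0.
Proof.
have H : b * w @[w --> +oo] --> +oo by apply: gt0_cvgMry => //; exact: cvg_id.
exact: (cvg_comp _ _ H (@cvgr_expR R)).
Qed.

Section frequency.
Variable a : R.

Let c : R := a ^+ 2 + b ^+ 2.
Let c0 : c != 0.
Proof. by rewrite gt_eqF// ltr_wpDl ?sqr_ge0// exprn_gt0. Qed.

Let S (w : R) : R := sin (a * w).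
Let C (w : R) : R := cos (a * w).

Let d1 (w : R) : is_derive w 1 (fun w : R => a * w) a.
Proof.
have := is_deriveZ a (is_derive_id w (1 : R)).
by rewrite [a *: 1]mulr1.
Qed.

Let dS (w : R) : is_derive w 1 S (a * C w).
Proof.
apply: is_derive_eq (@is_derive1_comp R sin (fun w => a * w) w _ _ (is_derive_sin _) (d1 w)) _.
by rewrite mulrC.
Qed.

Let dC (w : R) : is_derive w 1 C (- (a * S w)).
Proof.
apply: is_derive_eq (@is_derive1_comp R cos (fun w => a * w) w _ _ (is_derive_cos _) (d1 w)) _.
by rewrite mulNr mulrC.
Qed.

Let cont (f f' : R -> R) : (forall w : R, is_derive w (1 : R) f (f' w)) -> continuous f.
Proof.
by move=> df w; apply/differentiable_continuous/derivable1_diffP; have [] := df w.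
Qed.

(* An antiderivative of exp(-b w) (1 + cos(a w)). *)
Let F (w : R) : R := E w * (- b^-1 + (a / c * S w - b / c * C w)).

Let dF (w : R) : is_derive w 1 F (E w * (1 + C w)).
Proof.
have D := is_deriveM (dE w) (is_deriveD (is_derive_cst (- b^-1) w (1 : R))
  (is_deriveB (is_deriveZ (a / c) (dS w)) (is_deriveZ (b / c) (dC w)))).
apply: is_derive_eq D _ => /=.
rewrite add0r.
change (E w * (a / c * (a * C w) - b / c * - (a * S w)) +
  (- b^-1 + (a / c * S w - b / c * C w)) * (- b * E w) = E w * (1 + C w)).
have bn0 : b != 0 by rewrite gt_eqF.
have := c0; rewrite /c => cn0.
by field; rewrite bn0 cn0.
Qed.

Let F_cvg0 : F w @[w --> +oo] --> 0.
Proof.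
pose K := `|b^-1| + (`|a / c| + `|b / c|).
have FK w : `|F w| <= E w * K.
  rewrite normrM ger0_norm ?expR_ge0// ler_wpM2l ?expR_ge0//.
  rewrite (le_trans (ler_normD _ _))// normrN lerD2l (le_trans (ler_normB _ _))//.
  by rewrite lerD// normrM ler_piMr// ler_norml; [rewrite sin_geN1 sin_le1|rewrite cos_geN1 cos_le1].
apply: norm_cvg0; apply: (@squeeze_cvgr _ _ _ _ (cst 0) (fun w => E w * K)).
- by apply: nearW => w; rewrite normr_ge0 FK.
- exact: cvg_cst.
- by rewrite -(mul0r K); apply: cvgM; [exact: E_cvg0|exact: cvg_cst].
Qed.

(** Adding 1 to the cosine makes the integrand nonnegative, so that the improper
    fundamental theorem of calculus applies without integrability known
    beforehand; a = 0 gives the integral of exp(-b|w|) alone. *)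
Lemma integral_exp_cos :
  (\int[leb]_w (expR (- (b * `|w|)) * (1 + cos (a * w)))%:E =
   (2 * (b^-1 + b / (a ^+ 2 + b ^+ 2)))%:E)%E.
Proof.
have cC := cont dC.
rewrite (@ge0_symfun_integralT _ (fun w => expR (- (b * `|w|)) * (1 + cos (a * w)))).
- rewrite (_ : [set x | _] = `[0%R, +oo[%classic); last first.
    by apply/seteqP; split=> x /=; rewrite in_itv/= andbT.
  rewrite (_ : (\int[leb]_(x in _) _)%E = (\int[leb]_(x in `[0%R, +oo[) (E x * (1 + C x))%:E)%E); last first.
    by apply: eq_integral => w; rewrite inE/= in_itv/= andbT => w0; rewrite ger0_norm.
  rewrite (@ge0_continuous_FTC2y _ _ F 0 0).
  + rewrite -EFinB -EFinM /F /E /S /C !mulr0 sin0 cos0 oppr0 expR0.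
    by congr EFin; rewrite -/c; ring.
  + by move=> w _; rewrite mulr_ge0 ?expR_ge0// -lerBlDl sub0r cos_geN1.
  + apply: continuous_subspaceT => w; apply: continuousM; first exact: cE.
    by apply: continuousD; [exact: cst_continuous|exact: cC].
  + exact: F_cvg0.
  + by move=> w _; have [] := dF w.
  + by apply: cvg_at_right_filter; exact: (cont dF).
  + by move=> w _; rewrite derive1E; have := dF w => D; exact: derive_val.
- by move=> w; rewrite mulr_ge0 ?expR_ge0// -lerBlDl sub0r cos_geN1.
- have cA : continuous (fun w : R => expR (- (b * `|w|))).
    move=> w; apply: (@continuous_comp _ _ _ (fun w : R => `|w|) E); last exact: cE.
    exact: norm_continuous.
  have cB : continuous (fun w : R => 1 + cos (a * w)).
    by move=> w; apply: continuousD; [exact: cst_continuous|exact: cC].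
  by move=> w; exact: (continuousM (cA w) (cB w)).
- by move=> w /=; rewrite normrN mulrN cosN.
Qed.

End frequency.

Let mE : measurable_fun setT (fun w : RM => expR (- (b * `|w|))).
Proof.
apply: (@continuous_measurable_fun R) => w.
by apply: (@continuous_comp _ _ _ (fun w : R => `|w|) E); [exact: norm_continuous|exact: cE].
Qed.

Lemma integrable_exp_abs : leb.-integrable setT (fun w => (expR (- (b * `|w|)))%:E).
Proof.
have := integral_exp_cos 0.
rewrite (_ : (\int[leb]_w _)%E = (\int[leb]_w (2 * expR (- (b * `|w|)))%:E)%E); last first.
  by apply: eq_integral => w _; rewrite mul0r cos0 mulrC.
move=> H; apply/integrableP; split; first exact/measurable_EFinP.
apply: (@le_lt_trans _ _ (\int[leb]_w (2 * expR (- (b * `|w|)))%:E)%E).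
  apply: ge0_le_integral => //.
  - by apply: measurableT_comp => //; exact/measurable_EFinP.
  - by apply/measurable_EFinP/measurable_funM.
  - move=> w _; rewrite /= lee_fin ger0_norm ?expR_ge0//.
    by rewrite ler_peMl ?expR_ge0// ler1n.
by rewrite H ltry.
Qed.

Let m_osc (a : R) : measurable_fun setT (fun w : RM => a * w : RM).
Proof. by apply: measurable_funM. Qed.

Lemma cintegrable_poisson (a : R) :
  cintegrable leb (fun w : RM => (expR (- (b * `|w|)))%:C * expi (a * w)).
Proof.
apply: (cintegrable_dom _ _ integrable_exp_abs).
  by apply: cmeasurableM; [exact: cmeasurable_real|exact: cmeasurable_expi].
by move=> w; rewrite normcM normc_expi mulr1 normc_real ger0_norm ?expR_ge0.
Qed.

(** The Fourier transform of exp(-b|w|) is the Poisson kernel; the imaginary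
    part vanishes by oddness. *)
Lemma cint_poisson (a : R) :
  cint leb (fun w : RM => (expR (- (b * `|w|)))%:C * expi (a * w)) =
  (2 * b / (a ^+ 2 + b ^+ 2))%:C.
Proof.
have [ir ii] := cintegrable_poisson a.
have RE w : complex.Re ((expR (- (b * `|w|)))%:C * expi (a * w)) =
    expR (- (b * `|w|)) * cos (a * w) by rewrite cReM /= mul0r subr0.
have IE w : complex.Im ((expR (- (b * `|w|)))%:C * expi (a * w)) =
    expR (- (b * `|w|)) * sin (a * w) by rewrite cImM /= mul0r addr0.
have ie := integrable_exp_abs.
have ic : leb.-integrable setT (EFin \o (fun w : RM => expR (- (b * `|w|)) * cos (a * w))).
  by apply: eq_integrable ir => // w _; congr EFin; exact: RE.
have is_ : leb.-integrable setT (EFin \o (fun w : RM => expR (- (b * `|w|)) * sin (a * w))).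
  by apply: eq_integrable ii => // w _; congr EFin; exact: IE.
have I0 : \int[leb]_w expR (- (b * `|w|)) = 2 / b.
  have := congr1 fine (integral_exp_cos 0); rewrite /= -/(Rintegral _ _ _).
  under eq_Rintegral do rewrite mul0r cos0 mulrC.
  rewrite RintegralZl// => H.
  apply: (@mulfI _ 2) => //; rewrite H.
  by field; rewrite gt_eqF.
apply: eq_complex_parts; rewrite /cint /=.
  under eq_Rintegral do rewrite mul0r subr0.
  have := congr1 fine (integral_exp_cos a); rewrite /= -/(Rintegral _ _ _).
  under eq_Rintegral do rewrite mulrDr mulr1.
  rewrite RintegralD// I0 => /(canRL (addKr _)) ->.
  have c0 : a ^+ 2 + b ^+ 2 != 0 by rewrite gt_eqF// ltr_wpDl ?sqr_ge0// exprn_gt0.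
  by field; rewrite c0 gt_eqF.
under eq_Rintegral do rewrite mul0r addr0.
have n10 : (-1 : R) != 0 by rewrite oppr_eq0 oner_neq0.
have mopp : measurable_fun setT (fun t : RM => -1 * t + 0 : RM).
  by apply: measurable_funD => //; exact: measurable_funM.
have mo := measurable_int _ is_.
pose h (w : RM) := expR (- (b * `|w|)) + expR (- (b * `|w|)) * sin (a * w).
have ih : leb.-integrable setT (EFin \o h).
  by have := integrableD measurableT ie is_; apply: eq_integrable.
have h0 w : 0 <= h w.
  by rewrite /h -{1}[expR _]mulr1 -mulrDr mulr_ge0 ?expR_ge0// -lerBlDl sub0r sin_geN1.
have E1 : \int[leb]_w h w = \int[leb]_w h (-1 * w + 0).
  have := @ge0_integral_scaled _ _ _ leb (fun t : RM => -1 * t + 0) (NngNum (normr_ge0 (-1)))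
    mopp (lebesgue_measure_affine n10 0) (EFin \o h) (measurable_int _ ih) h0.
  by rewrite /= normrN1 mul1e => /(congr1 fine).
move: E1; rewrite /h.
under [RHS]eq_Rintegral do rewrite addr0 mulN1r normrN mulrN sinN mulrN -mulN1r.
rewrite RintegralD// RintegralD//; last first.
  by have := integrableZl measurableT (-1) is_; apply: eq_integrable.
rewrite RintegralZl// => /addrI; move: (\int[leb]_w _) => u; lra.
Qed.

End poisson_kernel.

(** * Fourier inversion *)

Section testing.
Context {R : realType} {n : nat}.
Local Notation mu := (@lebesgue_rV R n).
Local Notation V := 'rV[R]_n.

(** Continuity is for the approximate identity, boundedness and integrability
    for dominated convergence and Fubini. *)
Definition test_fun (phi : V -> R) : Prop :=
  [/\ continuous phi, forall x, `|phi x| <= 1 & mu.-integrable setT (EFin \o phi)].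

Lemma cvg_prod_seq (I : Type) (s : seq I) (a : I -> nat -> R) (l : I -> R) :
  (forall i, a i @ \oo --> l i) ->
  (fun j => \prod_(i <- s) a i j) @ \oo --> \prod_(i <- s) l i.
Proof.
move=> al; elim: s => [|i s IH].
  rewrite big_nil (_ : (fun j => _) = fun=> 1); first exact: cvg_cst.
  by apply/funext => j; rewrite big_nil.
rewrite big_cons (_ : (fun j => _) = fun j => a i j * \prod_(k <- s) a k j).
  by apply: cvgM; [exact: al|exact: IH].
by apply/funext => j; rewrite big_cons.
Qed.

Lemma continuous_prod_seq (T : topologicalType) (I : Type) (s : seq I) (a : I -> T -> R) :
  (forall i, continuous (a i)) -> continuous (fun x => \prod_(i <- s) a i x).
Proof.
move=> ca; elim: s => [|i s IH].
  rewrite (_ : (fun x => _) = fun=> 1); first exact: cst_continuous.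
  by apply/funext => j; rewrite big_nil.
rewrite (_ : (fun j => _) = fun j => a i j * \prod_(k <- s) a k j).
  by move=> x; apply: cvgM; [exact: ca|exact: IH].
by apply/funext => j; rewrite big_cons.
Qed.

Let inv_cvg0 : (fun j : nat => j.+1%:R^-1 : R) @ \oo --> (0 : R).
Proof. exact: cvg_harmonic. Qed.

(* A ramp is a continuous approximation of the indicator of a side; the second
   factor in the bump tends to 1 and makes the product over the coordinates
   integrable. *)
Let side (o : option R) : set R :=
  if o is Some b then `]-oo, b[%classic else setT.

Let ramp (o : option R) (j : nat) (x : R) : R :=
  if o is Some b then 1 - (1 + j.+1%:R * Num.max 0 (b - x))^-1 else 1.

Let ramp_den (b x : R) (j : nat) : 1 <= 1 + j.+1%:R * Num.max 0 (b - x).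
Proof. by rewrite lerDl mulr_ge0// le_max lexx. Qed.

Let ramp01 o j x : 0 <= ramp o j x <= 1.
Proof.
case: o => [b|] /=; last by rewrite ler01 lexx.
have d1 := ramp_den b x j.
rewrite subr_ge0 lerBlDr lerDl invf_le1 ?d1 ?invr_ge0 ?(le_trans ler01 d1)//.
exact: lt_le_trans d1.
Qed.

Let continuous_ramp o j : continuous (ramp o j).
Proof.
case: o => [b|] /=; last exact: cst_continuous.
have cm : continuous (fun x : R => Num.max 0 (b - x)).
  rewrite (_ : (fun x => _) = (fun x : R => (`|b - x| + (b - x)) * 2^-1)).
    have cb : continuous (fun x : R => b - x).
      by move=> x; apply: cvgB; [exact: cvg_cst|exact: cvg_id].
    move=> x; apply: cvgM; last exact: cvg_cst.
    by apply: cvgD; [apply: cvg_norm; exact: cb|exact: cb].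
  apply/funext => x; have [h|h] := leP 0 (b - x).
    by rewrite ger0_norm//; field.
  by rewrite ltr0_norm// addNr mul0r.
move=> x; apply: cvgB; first exact: cvg_cst.
apply: cvgV; first by rewrite gt_eqF// (lt_le_trans _ (ramp_den _ _ _)).
by apply: cvgD; [exact: cvg_cst|apply: cvgM; [exact: cvg_cst|exact: cm]].
Qed.

Let cvg_ramp o x : (fun j => ramp o j x) @ \oo --> (\1_(side o) x : R).
Proof.
case: o => [b|] /=; last by rewrite indicT; exact: cvg_cst.
rewrite indicE; have [bx|xb] := leP b x.
  rewrite memNset; last by rewrite /= in_itv/= ltNge bx.
  rewrite (_ : (fun j => _) = fun=> 0); first exact: cvg_cst.
  apply/funext => j; rewrite (_ : Num.max 0 (b - x) = 0); last first.
    by apply/max_idPl; rewrite subr_le0.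
  by rewrite mulr0 addr0 invr1 subrr.
rewrite mem_set; last by rewrite /= in_itv.
rewrite -[X in _ --> X]subr0; apply: cvgB; first exact: cvg_cst.
have bx0 : 0 < b - x by rewrite subr_gt0.
have -> : Num.max 0 (b - x) = b - x by apply/max_idPr; exact: ltW.
apply: (@squeeze_cvgr _ _ _ _ (cst 0) (fun j => (b - x)^-1 * j.+1%:R^-1)).
- apply: nearW => j /=; rewrite invr_ge0 addr_ge0 ?mulr_ge0 ?(ltW bx0)//=.
  rewrite -invfM lef_pV2 ?posrE ?mulr_gt0//; last by rewrite ltr_pwDl// mulr_ge0// ltW.
  by rewrite mulrC lerDr.
- exact: cvg_cst.
- by rewrite -(mulr0 (b - x)^-1); apply: cvgM; [exact: cvg_cst|exact: inv_cvg0].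
Qed.

Let bump (o : 'I_n -> option R) (j : nat) (x : V) : R :=
  \prod_i (ramp (o i) j (x 0 i) * (1 + (x 0 i * j.+1%:R^-1) ^+ 2)^-1).

Let bump_le o j x : 0 <= bump o j x <= decay (j.+1%:R^-1 *: x + 0).
Proof.
apply/andP; split.
  apply: prodr_ge0 => i _; have /andP[r0 _] := ramp01 (o i) j (x 0 i).
  by rewrite mulr_ge0// invr_ge0 addr_ge0// sqr_ge0.
apply: ler_prod => i _; have /andP[r0 r1] := ramp01 (o i) j (x 0 i).
have -> : (j.+1%:R^-1 *: x + 0) 0 i = x 0 i * j.+1%:R^-1 by rewrite addr0 mxE mulrC.
have d0 : 0 <= (1 + (x 0 i * j.+1%:R^-1) ^+ 2)^-1 by rewrite invr_ge0 addr_ge0// sqr_ge0.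
by rewrite mulr_ge0//= ler_piMl.
Qed.

Lemma decay_le1 (x : V) : decay x <= 1.
Proof.
rewrite /decay -[leRHS](@big1_eq _ _ *%R 'I_n (index_enum _) xpredT).
apply: ler_prod => i _; rewrite invr_ge0 addr_ge0 ?sqr_ge0//=.
by rewrite invf_le1 ?lerDl ?sqr_ge0// ltr_pwDl// sqr_ge0.
Qed.

Let test_bump o j : test_fun (bump o j).
Proof.
have cb : continuous (bump o j).
  apply: (@continuous_prod_seq _ _ _ (fun i (x : V) =>
    ramp (o i) j (x 0 i) * (1 + (x 0 i * j.+1%:R^-1) ^+ 2)^-1)) => i.
  have cx : continuous (fun y : V => y 0 i) by exact: coord_continuous.
  have cr : continuous (fun y : R => ramp (o i) j y * (1 + (y * j.+1%:R^-1) ^+ 2)^-1).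
    move=> y; apply: cvgM; first exact: continuous_ramp.
    apply: cvgV; first by rewrite gt_eqF// ltr_pwDl// sqr_ge0.
    apply: cvgD; first exact: cvg_cst.
    by apply: cvgM; apply: cvgM => //; exact: cvg_cst.
  by move=> x; exact: (continuous_comp (cx x) (cr _)).
split => //.
  move=> x; have /andP[b0 b1] := bump_le o j x.
  by rewrite ger0_norm// (le_trans b1)// decay_le1.
have j0 : (j.+1%:R^-1 : R) != 0 by rewrite invr_eq0 pnatr_eq0.
apply: le_integrable (integrable_affine j0 0 (@integrable_decay R n)) => //.
  by apply/measurable_EFinP; exact: continuous_measurable_rV.
move=> x _; have /andP[b0 b1] := bump_le o j x.
by rewrite /= lee_fin ger0_norm// (le_trans b1)// ler_norm.
Qed.

Let indic_box (o : 'I_n -> option R) (x : V) :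
  \prod_i (\1_(side (o i)) (x 0 i) : R) = \1_(box (fun i => side (o i))) x.
Proof.
rewrite indicE; case: (boolP (x \in _)) => [/set_mem xB|/negP xB].
  by rewrite big1// => i _; rewrite indicE mem_set//; exact: xB.
have [i xi] : exists i, ~ side (o i) (x 0 i).
  by apply: contrapT => H; apply: xB; apply/mem_set => i; apply: contrapT => xi; apply: H; exists i.
by rewrite (bigD1 i)//= indicE memNset// mul0r.
Qed.

Let cvg_bump o x : (fun j => bump o j x) @ \oo --> (\1_(box (fun i => side (o i))) x : R).
Proof.
rewrite -indic_box; apply: (@cvg_prod_seq _ _ (fun i j => ramp (o i) j (x 0 i) *
  (1 + (x 0 i * j.+1%:R^-1) ^+ 2)^-1) (fun i => \1_(side (o i)) (x 0 i))) => i.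
rewrite -[X in _ --> X]mulr1; apply: cvgM; first exact: cvg_ramp.
rewrite -[X in _ --> X]invr1; apply: cvgV; first exact: oner_neq0.
rewrite -[X in _ --> X]addr0; apply: cvgD; first exact: cvg_cst.
have H : (fun j : nat => x 0 i * j.+1%:R^-1) @ \oo --> (0 : R).
  by rewrite -[X in _ --> X](mulr0 (x 0 i)); apply: cvgM; [exact: cvg_cst|exact: inv_cvg0].
by rewrite -[X in _ --> X](mulr0 (0 : R)); apply: cvgM.
Qed.

(** Test functions separate integrable functions: they approximate boxes, which
    form a pi-system generating the Borel sets. *)
Lemma test_fun_separate (h : V -> R) : mu.-integrable setT (EFin \o h) ->
  (forall phi, test_fun phi -> \int[mu]_x (phi x * h x) = 0) ->
  {ae mu, forall x, h x = 0}.
Proof.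
move=> ih H0.
have mh : measurable_fun setT h by apply/measurable_EFinP/measurable_int/ih.
have i_h (g : V -> R) : measurable_fun setT g -> (forall x, `|g x| <= 1) ->
    mu.-integrable setT (EFin \o (fun x => g x * h x)).
  move=> mg g1; apply: le_integrable ih => //.
    by apply/measurable_EFinP/measurable_funM.
  by move=> x _; rewrite /= lee_fin normrM ler_piMl.
have lim (g_ : nat -> V -> R) (g : V -> R) : (forall j, measurable_fun setT (g_ j)) ->
    measurable_fun setT g -> (forall j x, `|g_ j x| <= 1) ->
    (forall x, (fun j => g_ j x) @ \oo --> g x) ->
    (forall j, \int[mu]_x (g_ j x * h x) = 0) -> \int[mu]_x (g x * h x) = 0.
  move=> mg_ mg g1 g_g Hg.
  have L : (fun j => \int[mu]_x (g_ j x * h x)) @ \oo --> \int[mu]_x (g x * h x).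
    apply: (@Rintegral_dominated_cvg _ _ _ _ (fun j x => g_ j x * h x)
      (fun x => g x * h x) (fun x => `|h x|)).
    - by move=> j; exact: measurable_funM.
    - exact: measurable_funM.
    - by apply: aeW => x; apply: cvgM; [exact: g_g|exact: cvg_cst].
    - by move=> j x; rewrite normrM ler_piMl.
    - exact: (integrable_norm ih).
  apply/esym; apply: (cvg_unique _ _ L) => //.
  rewrite (_ : (fun j => _) = fun=> 0); first exact: cvg_cst.
  by apply/funext => j; exact: Hg.
have ind1 (A : set V) x : `|\1_A x : R| <= 1.
  by rewrite indicE; case: (_ \in _); rewrite ?normr1 ?normr0.
pose P : set (set V) := [set A | measurable A /\ \int[mu]_x (\1_A x * h x) = 0].
pose G : set (set (measurableTypeR R)) := [set side o | o in setT].
have PG : boxes G `<=` P.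
  move=> _ [B GB ->].
  have /choice[e eB] : forall i, exists a, B i = side a.
    by move=> i; have [a _ <-] := GB i; exists a.
  have -> : box B = box (fun i => side (e i)).
    by congr box; apply/funext => i; exact: eB.
  have mB : measurable (box (fun i => side (e i))).
    apply: measurable_box => i; case: (e i) => [b|]; last exact: measurableT.
    exact: measurable_itv.
  split => //; apply: (lim (bump e)).
  - by move=> j; have [cb _ _] := test_bump e j; exact: continuous_measurable_rV.
  - exact: measurable_indic.
  - by move=> j; have [] := test_bump e j.
  - by move=> x; exact: cvg_bump.
  - by move=> j; apply: H0; exact: test_bump.
have GI : setI_closed G.
  move=> _ _ [b1 _ <-] [b2 _ <-].
  case: b1 => [b|]; case: b2 => [b'|] /=.
  - exists (Some (Num.min b b')) => //=; apply/seteqP; split=> x /=; rewrite !in_itv/= lt_min.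
      by move=> /andP[].
    by move=> [-> ->].
  - by exists (Some b) => //; rewrite setIT.
  - by exists (Some b') => //; rewrite setTI.
  - by exists None => //; rewrite setTI.
have mG : @measurable _ (measurableTypeR R) = <<s G >>.
  rewrite [LHS](RGenInftyO.measurableE R); apply/seteqP; split.
    apply: smallest_sub; first exact: smallest_sigma_algebra.
    by move=> _ [b ->]; apply: sub_sigma_algebra; exists (Some b).
  apply: smallest_sub; first exact: smallest_sigma_algebra.
  move=> _ [[b|] _ <-] /=; first by apply: sub_sigma_algebra; exists b.
  have [_ sC _] : sigma_algebra setT <<s @RGenInftyO.G R >> by exact: smallest_sigma_algebra.
  have [s0 _ _] : sigma_algebra setT <<s @RGenInftyO.G R >> by exact: smallest_sigma_algebra.
  by have := sC _ s0; rewrite setD0.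
have lamP : lambda_system setT P.
  split => //.
  - apply: PG; exists (fun=> setT); first by move=> i; exists None.
    by apply/seteqP; split.
  - move=> A B BA [mA PA] [mB PB]; split; first exact: measurableD.
    have E x : \1_(A `\` B) x * h x = \1_A x * h x - \1_B x * h x.
      rewrite -mulrBl; congr (_ * _); rewrite !indicE.
      have [xB|xB] := pselect (B x).
        by rewrite (mem_set xB) (mem_set (BA _ xB)) memNset ?subrr// => -[].
      rewrite (memNset xB) subr0; congr (_%:R); congr nat_of_bool.
      by apply/idP/idP => /set_mem; [case=> ? _; exact/mem_set|move=> ?; exact/mem_set].
    under eq_Rintegral do rewrite E.
    by rewrite RintegralB// ?PA ?PB ?subrr//; exact/i_h.
  - move=> A ndA PA; split; first by apply: bigcupT_measurable => i; have [] := PA i.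
    apply: (lim (fun j => \1_(A j))) => //.
    + by move=> j; apply: measurable_indic; have [] := PA j.
    + by apply: measurable_indic; apply: bigcupT_measurable => i; have [] := PA i.
    + move=> x; rewrite indicE; case: (boolP (x \in _)) => [/set_mem[i _ Aix]|/negP xA].
        apply: cvg_near_cst; exists i => // j /= ij.
        by rewrite indicE mem_set//; move/subsetPset : (ndA _ _ ij); apply.
      rewrite (_ : (fun j => _) = fun=> 0); first exact: cvg_cst.
      apply/funext => j; rewrite indicE memNset// => Ajx; apply: xA.
      by apply/mem_set; exists j.
    + by move=> j; have [] := PA j.
have all_P : forall A, measurable A -> P A.
  move=> A mA; apply: (lambda_system_subset (boxesI GI) lamP PG) => //.
  rewrite -(measurable_boxes mG)//; by exists None.
have := @integral_ae_eq _ _ _ mu setT measurableT (cst 0%E) (EFin \o h) ih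
  (measurable_cst _) _.
move=> /(_ _)[].
  move=> A _ mA; have [_ ] := all_P A mA.
  have iA : mu.-integrable setT (EFin \o (fun x => \1_A x * h x)).
    by apply: i_h => //; exact: measurable_indic.
  rewrite /Rintegral => z0; have := congr1 EFin z0.
  rewrite fineK; last exact: (integrable_fin_num measurableT iA).
  rewrite integral0 => E0; rewrite -[RHS]E0 integral_mkcond.
  apply: eq_integral => x _.
  by rewrite patchE /= indicE; case: ifP => _; rewrite ?mul1r ?mul0r.
move=> N [mN N0 subN]; exists N; split => // x hx.
by apply: subN => /= Hx; apply: hx; have /(_ I)[] := Hx.
Qed.

End testing.

Section approximate_identity.
Context {R : realType} {n : nat}.
Local Notation mu := (@lebesgue_rV R n).
Local Notation V := 'rV[R]_n.
Local Notation RM := (measurableTypeR R).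

Lemma Rintegral_affine (c : R) (v : V) (g : V -> R) : c != 0 ->
  mu.-integrable setT (EFin \o g) ->
  \int[mu]_t g t = `|c| ^+ n * \int[mu]_t g (c *: t + v).
Proof.
move=> c0 ig; rewrite /Rintegral (integral_affine c0 v ig) fineM//.
exact: (integrable_fin_num measurableT (integrable_affine c0 v ig)).
Qed.

(** The kernel prod_i e / (pi (e^2 + u_i^2)), written through [decay] so that
    its scaling in e is visible. *)
Definition poisson (e : R) (u : V) : R := (pi * e) ^- n * decay (e^-1 *: u).

Definition damp (e : R) (w : V) : R := \prod_i expR (- (2 * pi * e * `|w 0 i|)).

Lemma poisson_ge0 e u : 0 < e -> 0 <= poisson e u.
Proof.
by move=> e0; rewrite mulr_ge0 ?decay_ge0// invr_ge0 exprn_ge0// mulr_ge0 ?pi_ge0// ltW.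
Qed.

Lemma poisson_le e u : 0 < e -> `|poisson e u| <= (pi * e) ^- n.
Proof.
move=> e0; rewrite ger0_norm ?poisson_ge0// ler_piMr ?decay_le1//.
by rewrite invr_ge0 exprn_ge0// mulr_ge0 ?pi_ge0// ltW.
Qed.

Lemma measurable_decay : measurable_fun setT (@decay R n).
Proof. by apply/measurable_EFinP/measurable_int/integrable_decay. Qed.

Lemma integrable_poisson1 : mu.-integrable setT (EFin \o poisson 1).
Proof.
apply: eq_integrable (integrableZl measurableT (pi ^- n) (@integrable_decay R n)) => // u _.
by rewrite /= /poisson mulr1 invr1 scale1r.
Qed.

Lemma Rintegral_poisson1 : \int[mu]_u poisson 1 u = 1.
Proof.
pose h (i : 'I_n) (x : RM) : R[i] := ((1 + x ^+ 2)^-1 : R)%:C.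
have ih i : cintegrable lebesgue_measure (h i).
  split; first exact: integrable_oneDsqrV.
  by apply: eq_integrable (integrable0 _ _) => // x _.
have [_ E] := cint_coord_prod ih.
have decayE : \int[mu]_u decay u = pi ^+ n.
  have := congr1 (@complex.Re R) E; rewrite /cint /=.
  under eq_Rintegral do rewrite -(rmorph_prod (real_complex R)) /=.
  move=> ->; rewrite Rintegral_oneDsqrV prodr_const card_ord.
  rewrite (_ : \int[lebesgue_measure]_x 0 = 0).
    by rewrite -[pi +i* 0]/(pi%:C) -rmorphXn.
  by rewrite /Rintegral integral0.
rewrite /poisson; under eq_Rintegral do rewrite invr1 scale1r.
rewrite RintegralZl//; last exact: integrable_decay.
by rewrite decayE mulr1 mulVf// expf_neq0// gt_eqF// pi_gt0.
Qed.

Lemma damp_ge0 e w : 0 <= damp e w.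
Proof. by apply: prodr_ge0 => i _; exact: expR_ge0. Qed.

Lemma damp_le1 e w : 0 < e -> damp e w <= 1.
Proof.
move=> e0; rewrite /damp -[leRHS](@big1_eq _ _ *%R 'I_n (index_enum _) xpredT).
apply: ler_prod => i _; rewrite expR_ge0/= -[leRHS]expR0 ler_expR oppr_le0.
by rewrite !mulr_ge0// ?pi_ge0// ltW.
Qed.

Lemma cvg_damp w : (fun j : nat => damp j.+1%:R^-1 w) @ \oo --> (1 : R).
Proof.
rewrite -[X in _ --> X](@big1_eq _ _ *%R 'I_n (index_enum _) xpredT).
apply: (@cvg_prod_seq _ _ _ (fun i (j : nat) => expR (- (2 * pi * j.+1%:R^-1 * `|w 0 i|)))
  (fun=> 1)) => i.
have L : (fun j : nat => - (2 * pi * j.+1%:R^-1 * `|w 0 i|)) @ \oo --> (0 : R).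
  rewrite -[X in _ --> X]oppr0; apply: cvgN.
  rewrite -[X in _ --> X](mul0r `|w 0 i|) -(mulr0 (2 * pi)).
  apply: cvgM; last exact: cvg_cst.
  by apply: cvgM; [exact: cvg_cst|exact: cvg_harmonic].
have E0 := @cvg_comp _ _ _ _ (@expR R) _ _ _ L (@continuous_expR R 0).
by rewrite expR0 in E0.
Qed.

Lemma measurable_damp e : measurable_fun setT (damp e).
Proof.
apply: continuous_measurable_rV.
apply: (@continuous_prod_seq _ V _ _ (fun i (w : V) => expR (- (2 * pi * e * `|w 0 i|)))) => i.
have cx : continuous (fun y : V => y 0 i) by exact: coord_continuous.
have cr : continuous (fun y : R => expR (- (2 * pi * e * `|y|))).
  move=> y; apply: (@continuous_comp _ _ _ (fun y : R => - (2 * pi * e * `|y|)) expR);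
    last exact: continuous_expR.
  apply: cvgN; apply: cvgM; first exact: cvg_cst.
  exact: norm_continuous.
by move=> x; exact: (continuous_comp (cx x) (cr _)).
Qed.

(** The Poisson kernel is the Fourier transform of the damping factor, one
    coordinate at a time. *)
Lemma cint_damp_expi e v : 0 < e ->
  cintegrable mu (fun w => (damp e w)%:C * expi (2 * pi * dot v w)) /\
  cint mu (fun w => (damp e w)%:C * expi (2 * pi * dot v w)) = (poisson e v)%:C.
Proof.
move=> e0; have b0 : 0 < 2 * pi * e by rewrite !mulr_gt0// pi_gt0.
pose h (i : 'I_n) (x : RM) : R[i] :=
  (expR (- (2 * pi * e * `|x|)))%:C * expi (2 * pi * v 0 i * x).
have ih i : cintegrable lebesgue_measure (h i) := cintegrable_poisson b0 _.
have [I E] := cint_coord_prod ih.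
have hE : (fun w => (damp e w)%:C * expi (2 * pi * dot v w)) =
    (fun w => \prod_i h i (w 0 i)).
  apply/funext => w; rewrite /h big_split /= -(rmorph_prod (real_complex R)).
  congr (_ * _); rewrite /dot mulr_sumr (big_morph _ expiD expi0).
  by apply: eq_bigr => i _; rewrite mulrA.
rewrite hE E; split => //.
under eq_bigr do rewrite cint_poisson//.
rewrite -(rmorph_prod (real_complex R)); congr (_%:C).
have -> : poisson e v = \prod_(i < n) ((pi * e)^-1 * (1 + (e^-1 * v 0 i) ^+ 2)^-1).
  rewrite big_split prodr_const card_ord exprVn /poisson /decay; congr (_ * _).
  by apply: eq_bigr => i _; rewrite mxE.
apply: eq_bigr => i _.
have p0 : pi != 0 :> R by rewrite gt_eqF// pi_gt0.
have e0' : e != 0 by rewrite gt_eqF.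
have d0 : e ^+ 2 + v 0 i ^+ 2 != 0 by rewrite gt_eqF// ltr_pwDl ?sqr_ge0// exprn_gt0.
have d1 : (2 * pi * v 0 i) ^+ 2 + (2 * pi * e) ^+ 2 != 0.
  by rewrite gt_eqF// ltr_wpDl ?sqr_ge0// exprn_gt0.
have d2 : 1 + (e^-1 * v 0 i) ^+ 2 != 0 by rewrite gt_eqF// ltr_pwDl ?sqr_ge0.
move: p0 d1; generalize (pi : R) => p p0 d1.
by field; apply/and4P; split.
Qed.

Lemma integrable_damp e : 0 < e -> mu.-integrable setT (EFin \o damp e).
Proof.
move=> e0; have [[ir _] _] := cint_damp_expi 0 e0.
apply: eq_integrable ir => // w _.
transitivity (complex.Re ((damp e w)%:C * expi (2 * pi * dot 0 w)))%:E; first by [].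
by rewrite dot0l mulr0 expi0 mulr1.
Qed.

Lemma measurable_combine d (T : measurableType d) (a b : R) (s t : T -> V) :
  measurable_fun setT s -> measurable_fun setT t ->
  measurable_fun setT (fun p => a *: s p + b *: t p).
Proof.
move=> ms mt; apply: measurable_fun_rV => i.
under eq_fun do rewrite !mxE.
by apply: measurable_funD; apply: measurable_funM => //;
  [exact: (measurableT_comp (measurable_rV_coord i) ms)
  |exact: (measurableT_comp (measurable_rV_coord i) mt)].
Qed.

(** Convolution with the Poisson kernel, tested against phi: the substitution
    s = e u + t moves the dependence on e into the argument of phi. *)
Lemma poisson_smoothing e (f phi : V -> R) : 0 < e ->
  mu.-integrable setT (EFin \o f) -> test_fun phi ->
  [/\ mu.-integrable setT (fun s => (phi s * \int[mu]_t (poisson e (s - t) * f t))%:E),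
     mu.-integrable setT (fun t => (f t * \int[mu]_u (phi (e *: u + t) * poisson 1 u))%:E) &
     \int[mu]_s (phi s * \int[mu]_t (poisson e (s - t) * f t)) =
     \int[mu]_t (f t * \int[mu]_u (phi (e *: u + t) * poisson 1 u))].
Proof.
move=> e0 i_f [cphi phi1 iphi]; have en0 : e != 0 by rewrite gt_eqF.
have mphi : measurable_fun setT phi by exact: continuous_measurable_rV.
have mf : measurable_fun setT f by apply/measurable_EFinP/measurable_int/i_f.
have mpoisson r : measurable_fun setT (poisson r).
  apply: measurable_funM => //; apply: (measurableT_comp measurable_decay).
  apply: (eq_measurable_fun (fun u : V => r^-1 *: u + 0 *: u)) => [u _|].
    by rewrite scale0r addr0.
  by apply: measurable_combine; exact: measurable_id.
have i1 := integrable_poisson1.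
pose M : R := (pi * e) ^- n.
pose F (p : V * V) : R := phi p.1 * (poisson e (p.1 - p.2) * f p.2).
have mF : measurable_fun setT F.
  apply: measurable_funM; first exact: (measurableT_comp mphi measurable_fst).
  apply: measurable_funM; last exact: (measurableT_comp mf measurable_snd).
  apply: (measurableT_comp (mpoisson e)).
  apply: (eq_measurable_fun (fun p : V * V => 1 *: p.1 + (-1) *: p.2)) => [p _|].
    by rewrite scale1r scaleN1r.
  exact: (measurable_combine _ _ measurable_fst measurable_snd).
have i_Mphi : mu.-integrable setT (EFin \o (fun s => M * `|phi s|)).
  apply: eq_integrable (integrableZl measurableT M (integrable_norm iphi)) => // s _.
have i_nf := integrable_norm i_f.
have Fle s t : `|F (s, t)| <= M * `|phi s| * `|f t|.
  rewrite /F normrM normrM /= mulrA (mulrC M) ler_wpM2r// ler_wpM2l//.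
  exact: poisson_le.
have iF := @integrable_prod _ _ _ _ _ mu mu F _ _ mF Fle i_Mphi i_nf.
pose G (p : V * V) : R := f p.1 * (phi (e *: p.2 + p.1) * poisson 1 p.2).
have mG : measurable_fun setT G.
  apply: measurable_funM; first exact: (measurableT_comp mf measurable_fst).
  apply: measurable_funM; last exact: (measurableT_comp (mpoisson 1) measurable_snd).
  apply: (measurableT_comp mphi).
  apply: (eq_measurable_fun (fun p : V * V => e *: p.2 + 1 *: p.1)) => [p _|].
    by rewrite scale1r.
  exact: (measurable_combine _ _ measurable_snd measurable_fst).
have Gle t u : `|G (t, u)| <= `|f t| * poisson 1 u.
  rewrite /G normrM normrM /= ler_wpM2l// (ger0_norm (poisson_ge0 _ ltr01)) ler_piMl//.
  exact: poisson_ge0.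
have iG := @integrable_prod _ _ _ _ _ mu mu G _ _ mG Gle i_nf i1.
have iFx s : mu.-integrable setT (fun t => (poisson e (s - t) * f t)%:E).
  apply: (@le_integrable _ _ _ mu setT measurableT _ (EFin \o (fun t => M * f t))) => //.
  - apply/measurable_EFinP; apply: measurable_funM => //.
    apply: (measurableT_comp (mpoisson e)).
    apply: (eq_measurable_fun (fun t : V => 1 *: s + (-1) *: t)) => [t _|].
      by rewrite scale1r scaleN1r.
    by apply: measurable_combine; [exact: measurable_cst|exact: measurable_id].
  - move=> t _ /=; rewrite lee_fin normrM [leRHS]normrM ler_wpM2r//.
    by rewrite (le_trans (poisson_le _ e0))// ler_norm.
  - by apply: eq_integrable (integrableZl measurableT M i_f).
have iFy t : mu.-integrable setT (fun s => (phi s * poisson e (s - t))%:E).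
  apply: (@le_integrable _ _ _ mu setT measurableT _ (EFin \o (fun s => M * phi s))) => //.
  - apply/measurable_EFinP; apply: measurable_funM => //.
    apply: (measurableT_comp (mpoisson e)).
    apply: (eq_measurable_fun (fun s : V => 1 *: s + (-1) *: t)) => [s _|].
      by rewrite scale1r scaleN1r.
    by apply: measurable_combine; [exact: measurable_id|exact: measurable_cst].
  - move=> s _ /=; rewrite lee_fin normrM [leRHS]normrM mulrC ler_wpM2r//.
    by rewrite (le_trans (poisson_le _ e0))// ler_norm.
  - by apply: eq_integrable (integrableZl measurableT M iphi).
have iGx t : mu.-integrable setT (fun u => (phi (e *: u + t) * poisson 1 u)%:E).
  apply: le_integrable i1 => //.
  - apply/measurable_EFinP; apply: measurable_funM => //.
    apply: (measurableT_comp mphi).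
    apply: (eq_measurable_fun (fun u : V => e *: u + 1 *: t)) => [u _|].
      by rewrite scale1r.
    by apply: measurable_combine; [exact: measurable_id|exact: measurable_cst].
  - by move=> u _ /=; rewrite lee_fin normrM ler_piMl.
have [F12 iF1] := Rintegral12_prod iF (fun s =>
  integrableZl measurableT (phi s) (iFx s)).
have [_ iG1] := Rintegral12_prod iG (fun t =>
  integrableZl measurableT (f t) (iGx t)).
have F21 := Rintegral21_prod iF.
have EF s : \int[mu]_t F (s, t) = phi s * \int[mu]_t (poisson e (s - t) * f t).
  by rewrite /F /= RintegralZl//; exact: iFx.
have EG t : \int[mu]_u G (t, u) = f t * \int[mu]_u (phi (e *: u + t) * poisson 1 u).
  by rewrite /G /= RintegralZl//; exact: iGx.
have FG t : \int[mu]_s F (s, t) = \int[mu]_u G (t, u).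
  rewrite EG (_ : (fun s => F (s, t)) = fun s => f t * (phi s * poisson e (s - t))).
    rewrite RintegralZl//; last exact: iFy.
    congr (_ * _); rewrite (Rintegral_affine t en0 (iFy t)) -RintegralZl//; last first.
      exact: (integrable_affine en0 t (iFy t)).
    apply: eq_Rintegral => u _; rewrite addrK mulrCA; congr (_ * _).
    rewrite /poisson scalerA mulVf// scale1r invr1 scale1r mulr1 mulrA gtr0_norm//.
    by rewrite exprMn invfM mulrCA divff ?mulr1// expf_neq0.
  by apply/funext => s; rewrite /F /=; ring.
split.
- by apply: eq_integrable iF1 => // s _; rewrite EF.
- by apply: eq_integrable iG1 => // t _; rewrite EG.
- under eq_Rintegral do rewrite -EF.
  under [RHS]eq_Rintegral do rewrite -EG -FG.
  rewrite F12 F21// => t.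
  apply: eq_integrable (integrableZl measurableT (f t) (iFy t)) => // s _.
  by rewrite /F /= -EFinM; congr (_%:E); ring.
Qed.

(** Dominated convergence twice, in u by continuity of phi and then in t. *)
Lemma cvg_poisson_smoothing (f phi : V -> R) :
  mu.-integrable setT (EFin \o f) -> test_fun phi ->
  (fun j : nat => \int[mu]_s (phi s * \int[mu]_t (poisson j.+1%:R^-1 (s - t) * f t)))
    @ \oo --> \int[mu]_s (phi s * f s).
Proof.
move=> i_f tphi; have [cphi phi1 iphi] := tphi.
have e0 j : 0 < j.+1%:R^-1 :> R by rewrite invr_gt0.
have mphi : measurable_fun setT phi by exact: continuous_measurable_rV.
have mf : measurable_fun setT f by apply/measurable_EFinP/measurable_int/i_f.
have i1 := integrable_poisson1.
have m1 : measurable_fun setT (poisson 1) by apply/measurable_EFinP/measurable_int/i1.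
pose K (j : nat) (t : V) := \int[mu]_u (phi (j.+1%:R^-1 *: u + t) * poisson 1 u).
have mKi j (t : V) : measurable_fun setT (fun u : V => phi (j.+1%:R^-1 *: u + t) * poisson 1 u).
  apply: measurable_funM => //; apply: (measurableT_comp mphi).
  apply: (eq_measurable_fun (fun u : V => j.+1%:R^-1 *: u + 1 *: t)) => [u _|].
    by rewrite scale1r.
  by apply: measurable_combine; [exact: measurable_id|exact: measurable_cst].
have Kle j (t u : V) : `|phi (j.+1%:R^-1 *: u + t) * poisson 1 u| <= poisson 1 u.
  by rewrite normrM (ger0_norm (poisson_ge0 _ ltr01)) ler_piMl// poisson_ge0.
have K_phi t : K ^~ t @ \oo --> phi t.
  rewrite -[X in _ --> X]mulr1 -Rintegral_poisson1 -RintegralZl//.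
  apply: (@Rintegral_dominated_cvg _ _ _ mu
    (fun j u => phi (j.+1%:R^-1 *: u + t) * poisson 1 u) _ (poisson 1)) => //.
    exact: measurable_funM.
  apply: aeW => u; apply: cvgM; last exact: cvg_cst.
  have L : (fun j : nat => j.+1%:R^-1 *: u + t) @ \oo --> t.
    rewrite -[X in _ --> X]add0r -(scale0r u); apply: cvgD; last exact: cvg_cst.
    by apply: cvgZr_tmp; exact: cvg_harmonic.
  exact: (cvg_comp _ _ L (cphi t)).
rewrite (_ : (fun j => _) = fun j => \int[mu]_t (f t * K j t)); last first.
  by apply/funext => j; have [_ _ ->] := poisson_smoothing (e0 j) i_f tphi.
under [X in _ --> X]eq_Rintegral do rewrite mulrC.
apply: (@Rintegral_dominated_cvg _ _ _ mu (fun j t => f t * K j t) _ (fun t => `|f t|)).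
- move=> j; have [_ iK _] := poisson_smoothing (e0 j) i_f tphi.
  exact/measurable_EFinP/measurable_int/iK.
- exact: measurable_funM.
- by apply: aeW => t; apply: cvgM; [exact: cvg_cst|exact: K_phi].
- move=> j t; rewrite normrM ler_piMr//.
  have iK : mu.-integrable setT (fun u => (phi (j.+1%:R^-1 *: u + t) * poisson 1 u)%:E).
    apply: le_integrable i1 => //; first exact/measurable_EFinP.
    move=> u _ /=; rewrite lee_fin (le_trans (Kle j t u))// ler_norm//.
  rewrite (le_trans (le_normr_Rintegral measurableT iK))//.
  rewrite -[leRHS]Rintegral_poisson1; apply: le_Rintegral => //.
  exact: integrable_norm iK.
- by apply: eq_integrable (integrable_norm i_f) => // t _.
Qed.

End approximate_identity.

Section fourier_inversion.
Context {R : realType} {n : nat}.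
Local Notation mu := (@lebesgue_rV R n).
Local Notation V := 'rV[R]_n.
Local Notation Re := (@complex.Re R).
Local Notation Im := (@complex.Im R).
Variables (F T : V -> R[i]).
Hypothesis iF : cintegrable mu F.
Hypothesis iT : cintegrable mu T.
Hypothesis TE : forall w, T w = cint mu (fun t => expi (- (2 * pi * dot w t)) * F t).

Let wave (s w : V) : R[i] := expi (2 * pi * dot s w) * T w.

Let mwave s : cmeasurable (wave s).
Proof.
by apply: cmeasurableM; [exact: cmeasurable_wave|exact: cintegrable_measurable iT].
Qed.

(** Damping the inverse transform of T smoothes F by the Poisson kernel. *)
Lemma damped_inverse e s : 0 < e ->
  cint mu (fun w => (damp e w)%:C * wave s w) =
  cint mu (fun t => (poisson e (s - t))%:C * F t).
Proof.
move=> e0; have [gF igF Fg] := cintegrable_normc iF.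
have mF := cintegrable_measurable iF.
pose h (p : V * V) : R[i] := ((damp e p.1)%:C * expi (2 * pi * dot s p.1)) *
  (expi (- (2 * pi * dot p.1 p.2)) * F p.2).
have mh : cmeasurable h.
  apply: cmeasurableM; apply: cmeasurableM.
  - apply: cmeasurable_real.
    exact: (measurableT_comp (@measurable_damp R n e) measurable_fst).
  - apply: cmeasurable_expi; apply: measurable_funM => //.
    exact: (measurableT_comp (measurable_dot s) measurable_fst).
  - apply: cmeasurable_expi; apply: measurable_funN; apply: measurable_funM => //.
    apply: measurable_sum => i; apply: measurable_funM.
      exact: (measurableT_comp (measurable_rV_coord i) measurable_fst).
    exact: (measurableT_comp (measurable_rV_coord i) measurable_snd).
  - exact: (cmeasurable_comp mF measurable_snd).
have normc_damp w : normc (damp e w)%:C = damp e w.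
  by rewrite normc_real ger0_norm// damp_ge0.
have hle w t : normc (h (w, t)) <= damp e w * gF t.
  rewrite /h !normcM !normc_expi mulr1 mul1r normc_damp /=.
  by rewrite ler_wpM2l ?damp_ge0.
have ih := @cintegrable_prod _ _ _ _ _ mu mu h _ _ mh hle (integrable_damp e0) igF.
have ih1 w : cintegrable mu (fun t => h (w, t)).
  apply: (cintegrableZ ((damp e w)%:C * expi (2 * pi * dot s w))).
  apply: (cintegrableM (A := 1) iF).
    exact: cmeasurable_waveN.
  by move=> t; rewrite normc_expi.
have hE t : (fun w => h (w, t)) =
    fun w => F t * ((damp e w)%:C * expi (2 * pi * dot (s - t) w)).
  apply/funext => w; rewrite /h /= dotDl -(scaleN1r t) dotZl (dotC w) mulN1r (mulrDr (2 * pi)) (mulrN (2 * pi)) expiD.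
  by rewrite mulrA (mulrC (F t)) -!mulrA.
have ih2 t : cintegrable mu (fun w => h (w, t)).
  rewrite hE; apply: cintegrableZ; exact: (cint_damp_expi _ e0).1.
transitivity (cint mu (fun w => cint mu (fun t => h (w, t)))).
  congr (cint mu _); apply/funext => w; rewrite /wave TE mulrA -cintZ//.
  apply: (cintegrableM (A := 1) iF); last by move=> t; rewrite normc_expi.
  exact: cmeasurable_waveN.
rewrite (cint12_prod ih ih1) -(cint21_prod ih ih2).
congr (cint mu _); apply/funext => t; rewrite hE.
have [I E] := cint_damp_expi (s - t) e0.
by rewrite cintZ// E mulrC.
Qed.

Variable H : V -> R[i].
Hypothesis iH : cintegrable mu H.
Hypothesis HE : forall s, H s = cint mu (wave s).

Let part_eq (p : R[i] -> R) :
  (forall h : V -> R[i], p (cint mu h) = \int[mu]_t p (h t)) ->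
  (forall (a : R) z, p (a%:C * z) = a * p z) -> (forall z, `|p z| <= normc z) ->
  (forall h : V -> R[i], cmeasurable h -> measurable_fun setT (p \o h)) ->
  mu.-integrable setT (EFin \o (p \o F)) -> mu.-integrable setT (EFin \o (p \o H)) ->
  {ae mu, forall x, p (F x) = p (H x)}.
Proof.
move=> pint pZ ple pm ipF ipH.
have [gT igT Tg] := cintegrable_normc iT.
have wave_le s w : normc (wave s w) <= gT w by rewrite normcM normc_expi mul1r.
have e0 j : 0 < j.+1%:R^-1 :> R by rewrite invr_gt0.
pose HD (j : nat) s := cint mu (fun w => (damp j.+1%:R^-1 w)%:C * wave s w).
have mD j s : cmeasurable (fun w => (damp j.+1%:R^-1 w)%:C * wave s w).
  by apply: cmeasurableM => //; apply: cmeasurable_real; exact: measurable_damp.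
have D_le j s w : normc ((damp j.+1%:R^-1 w)%:C * wave s w) <= gT w.
  rewrite normcM normc_real ger0_norm ?damp_ge0//.
  by rewrite (le_trans _ (wave_le s w))// ler_piMl ?normc_ge0// damp_le1.
have HD_le j s : `|p (HD j s)| <= 2 * \int[mu]_t gT t.
  by rewrite (le_trans (ple _))// normc_cint.
have HD_H s : (fun j => p (HD j s)) @ \oo --> p (H s).
  rewrite HE pint (_ : (fun j => _) = fun j => \int[mu]_w p ((damp j.+1%:R^-1 w)%:C * wave s w)).
    apply: (@Rintegral_dominated_cvg _ _ _ mu
      (fun j w => p ((damp j.+1%:R^-1 w)%:C * wave s w)) _ gT) => //.
    - by move=> j; exact: pm (mD j s).
    - exact: pm (mwave s).
    - apply: aeW => w; rewrite -[X in _ --> X]mul1r.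
      rewrite (_ : (fun j => _) = fun j : nat => damp j.+1%:R^-1 w * p (wave s w)).
        by apply: cvgM; [exact: cvg_damp|exact: cvg_cst].
      by apply/funext => j; rewrite pZ.
    - by move=> j w; rewrite (le_trans (ple _)).
  by apply/funext => j; rewrite pint.
have pE j s : p (HD j s) = \int[mu]_t (poisson j.+1%:R^-1 (s - t) * p (F t)).
  rewrite /HD damped_inverse// pint; apply: eq_Rintegral => t _.
  by rewrite pZ.
pose h x := p (F x) - p (H x).
have ih : mu.-integrable setT (EFin \o h).
  by apply: eq_integrable (integrableB measurableT ipF ipH) => // x _.
suff : {ae mu, forall x, h x = 0}.
  by apply: filterS => x /eqP; rewrite subr_eq0 => /eqP.
apply: test_fun_separate ih _ => phi tphi; have [cphi phi1 iphi] := tphi.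
have mphi : measurable_fun setT phi by exact: continuous_measurable_rV.
have i_phi (f : V -> R) : mu.-integrable setT (EFin \o f) ->
    mu.-integrable setT (EFin \o (fun x => phi x * f x)).
  move=> i_f; apply: le_integrable (i_f) => //.
    apply/measurable_EFinP; apply: measurable_funM => //.
    exact/measurable_EFinP/measurable_int/i_f.
  by move=> x _ /=; rewrite lee_fin normrM ler_piMl.
rewrite /h; under eq_Rintegral do rewrite mulrBr.
rewrite RintegralB//; [|exact: (i_phi _ ipF)|exact: (i_phi _ ipH)].
apply/eqP; rewrite subr_eq0; apply/eqP.
have L1 := cvg_poisson_smoothing ipF tphi.
apply: (cvg_unique _ L1) => //.
rewrite (_ : (fun j => _) = fun j => \int[mu]_s (phi s * p (HD j s))); last first.
  by apply/funext => j; apply: eq_Rintegral => s _; rewrite pE.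
apply: (@Rintegral_dominated_cvg _ _ _ mu (fun j s => phi s * p (HD j s)) _
  (fun s => 2 * (\int[mu]_t gT t) * `|phi s|)).
- move=> j; have [iK _ _] := poisson_smoothing (e0 j) ipF tphi.
  apply/measurable_EFinP; apply: eq_measurable_fun (measurable_int _ iK) => s _.
  by rewrite /= pE.
- by apply/measurable_EFinP/measurable_int/i_phi.
- by apply: aeW => s; apply: cvgM; [exact: cvg_cst|exact: HD_H].
- by move=> j s; rewrite normrM mulrC ler_wpM2r.
- by apply: eq_integrable (integrableZl measurableT (2 * \int[mu]_t gT t)
    (integrable_norm iphi)) => // s _.
Qed.

(** Fourier inversion for an integrable function with integrable transform: the
    damped inverse transforms tend to H by dominated convergence and to F
    weakly, as convolutions with an approximate identity. *)
Lemma fourier_inversion : {ae mu, forall x, F x = H x}.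
Proof.
have HRe : {ae mu, forall x, Re (F x) = Re (H x)}.
  apply: part_eq => //.
  - by move=> a [u v] /=; rewrite mul0r subr0.
  - exact: Re_le_normc.
  - by move=> h [].
  - by case: iF.
  - by case: iH.
have HIm : {ae mu, forall x, Im (F x) = Im (H x)}.
  apply: part_eq => //.
  - by move=> a [u v] /=; rewrite mul0r addr0.
  - exact: Im_le_normc.
  - by move=> h [].
  - by case: iF.
  - by case: iH.
by apply: filterS2 HRe HIm => x; exact: eq_complex_parts.
Qed.

End fourier_inversion.

(** * Closure properties of the spaces *)

Section tame_scaling.
Context {R : realType}.
Variable sigma : R.
Hypothesis sigma_gt1 : 1 < sigma.

Lemma tameZ c (Q : R) u : 0 <= Q -> tame sigma c u -> tame sigma c (fun N => Q * u N).
Proof.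
move=> Q0; have key tau : (exists2 C : R, 0 < C & forall N, u N <= C * Mseq tau sigma N) ->
    exists2 C : R, 0 < C & forall N, Q * u N <= C * Mseq tau sigma N.
  move=> [C C0 uC]; exists ((Q + 1) * C); first by rewrite mulr_gt0// ltr_wpDl.
  move=> N; rewrite -mulrA (le_trans (ler_wpM2l Q0 (uC N)))//.
  by rewrite ler_wpM2r ?lerDl// mulr_ge0// ltW// Mseq_gt0.
case: c => /=; last by move=> H tau t0; exact: key (H tau t0).
by move=> [tau t0 H]; exists tau => //; exact: key H.
Qed.

Lemma tame_scale c (K Q : R) u k : 1 <= K -> 0 <= Q -> (forall N, 0 <= u N) ->
  tame sigma c u -> tame sigma c (fun N => K ^+ N * (Q * u (N + k)%N)).
Proof.
move=> K1 Q0 u0 tu; have K0 := le_trans ler01 K1.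
apply: tameM => //.
- by move=> N; rewrite exprn_ge0.
- by move=> N; rewrite mulr_ge0.
- apply: tame_le (tame_geometric sigma_gt1 c K1) => N.
  rewrite ler_peMr ?exprn_ge0//; case: N => [|N]; first by rewrite expr0.
  by rewrite exprn_ege1// ler1n.
- exact/tameZ/tame_shift.
Qed.

End tame_scaling.

Section word_class_closure.
Context {R : realType}.
Variables (sigma : R) (c : ultra_case).
Hypothesis sigma_gt1 : 1 < sigma.
Local Notation wclass := (@word_class R sigma c _).

Lemma word_class_smooth d (phi : 'rV[R]_d -> R[i]) : wclass phi -> smooth phi.
Proof. by case. Qed.

Lemma word_class_rapid d (phi : 'rV[R]_d -> R[i]) : wclass phi -> rapid phi.
Proof. by move=> [sp [u _ up]]; split => // N; exists (u N). Qed.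

Lemma word_classZ d (a : R[i]) (phi : 'rV[R]_d -> R[i]) :
  wclass phi -> wclass (fun x => a * phi x).
Proof.
move=> [sp [u tu up]]; split; first exact: smoothZ.
exists (fun N => normc a * u N); first by apply: tameZ; rewrite ?normc_ge0.
by move=> N; exact: wboundZ.
Qed.

Lemma word_class_conj d (phi : 'rV[R]_d -> R[i]) :
  wclass phi -> wclass (fun x => (phi x)^*).
Proof.
move=> [sp [u tu up]]; split; first exact: smooth_conj.
by exists u => // N; exact: wbound_conj.
Qed.

Lemma word_class_tensor n m (phi : 'rV[R]_n -> R[i]) (psi : 'rV[R]_m -> R[i]) :
  wclass phi -> wclass psi -> wclass (tensor phi psi).
Proof.
move=> [sp [u tu up]] [sq [v tv vq]]; split; first exact: smooth_tensor.
exists (fun N => u N * v N); last by move=> N; exact: wbound_tensor.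
apply: tameM => // N; first exact: wbound_ge0 (up N).
exact: wbound_ge0 (vq N).
Qed.

Lemma word_class_affine d d' (B : 'M[R]_(d, d')) v0 (C : 'M[R]_(d', d))
    (phi : 'rV[R]_d' -> R[i]) : (forall x, affine B v0 x *m C = x) ->
  wclass phi -> wclass (phi \o affine B v0).
Proof.
move=> BC [sp [u tu up]]; split; first exact: smooth_affine.
have [K K1 HK] := wbound_affine BC.
exists (fun N => K ^+ N * (1 * u (N + 0)%N)).
  by apply: tame_scale => // N; exact: wbound_ge0 (up N).
by move=> N; rewrite mul1r addn0; exact: HK.
Qed.

Lemma word_class_pft n (k : R) (H : 'rV[R]_(n + n) -> R[i]) : k != 0 ->
  wclass H -> wclass (pft k H).
Proof.
move=> k0 wH; have rH := word_class_rapid wH; have [sH [u tu uH]] := wH.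
split; first exact: smooth_pft.
exists (fun N => pft_factor k ^+ N * (@decay_mass R n * 2 ^+ n * u (N + 2 * n)%N)).
  apply: tame_scale => //.
  - exact: pft_factor_ge1.
  - by rewrite mulr_ge0// decay_mass_ge0.
  - by move=> N; exact: wbound_ge0 (uH N).
by move=> N; exact: wbound_pft.
Qed.

Lemma word_class_slicel n m (v : 'rV[R]_m) (K : 'rV[R]_(n + m) -> R[i]) :
  wclass K -> wclass (fun u => K (row_mx u v)).
Proof.
rewrite (_ : (fun u => _) = K \o affine (row_mx 1%:M 0) (row_mx 0 v)); last first.
  by apply/funext => u; rewrite /= /affine mul_mx_row mulmx1 mulmx0 add_row_mx addr0 add0r.
apply: (@word_class_affine _ _ _ _ (col_mx 1%:M 0)) => u.
rewrite /affine mul_mx_row mulmx1 mulmx0 add_row_mx addr0 add0r.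
by rewrite mul_row_col mulmx1 mulmx0 addr0.
Qed.

Lemma word_class_slicer n m (u : 'rV[R]_n) (K : 'rV[R]_(n + m) -> R[i]) :
  wclass K -> wclass (fun v => K (row_mx u v)).
Proof.
rewrite (_ : (fun v => _) = K \o affine (row_mx 0 1%:M) (row_mx u 0)); last first.
  by apply/funext => v; rewrite /= /affine mul_mx_row mulmx1 mulmx0 add_row_mx addr0 add0r.
apply: (@word_class_affine _ _ _ _ (col_mx 0 1%:M)) => v.
rewrite /affine mul_mx_row mulmx1 mulmx0 add_row_mx addr0 add0r.
by rewrite mul_row_col mulmx1 mulmx0 add0r.
Qed.

End word_class_closure.

(** * The time-frequency representations *)

Section affine_substitution.
Context {R : realType} {n : nat}.
Local Notation mu := (@lebesgue_rV R n).
Local Notation V := 'rV[R]_n.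
Variables (c : R) (c0 : c != 0) (v : V).

Lemma ae_affine (P : V -> Prop) : {ae mu, forall t, P t} ->
  {ae mu, forall t, P (c *: t + v)}.
Proof.
move=> [N [mN N0 subN]].
have mf := measurable_affine c v.
exists ((fun t : V => c *: t + v) @^-1` N); split.
- by rewrite -[X in measurable X]setTI; exact: mf.
- apply/eqP; have := lebesgue_rV_affine c0 v mN; rewrite N0 => /eqP.
  rewrite mule_eq0 => /orP[|//].
  by rewrite eqe expf_eq0 normr_eq0 (negbTE c0) andbF.
- by move=> t nPt; apply: subN.
Qed.

Lemma cmeasurable_affine (h : V -> R[i]) : cmeasurable h ->
  cmeasurable (fun t : V => h (c *: t + v)).
Proof.
by move=> mh; exact: (cmeasurable_comp mh (measurable_affine c v)).
Qed.

Lemma cint_affine (h : V -> R[i]) : cintegrable mu h ->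
  cint mu h = (`|c| ^+ n)%:C * cint mu (fun t => h (c *: t + v)).
Proof.
move=> [ir ii]; apply: eq_complex_parts; rewrite /cint /=.
  by rewrite mul0r subr0 (Rintegral_affine v c0 ir).
by rewrite mul0r addr0 (Rintegral_affine v c0 ii).
Qed.

End affine_substitution.

(** Null sections in one direction give null sections in the other: by Tonelli,
    both mean that the exceptional set is null for the product measure. *)
Lemma ae_swap d1 d2 (T1 : measurableType d1) (T2 : measurableType d2) (R : realType)
    (m1 : {sigma_finite_measure set T1 -> \bar R})
    (m2 : {sigma_finite_measure set T2 -> \bar R}) (h : T1 * T2 -> R[i]) :
  cmeasurable h -> {ae m1, forall x, {ae m2, forall y, h (x, y) = 0}} ->
  {ae m2, forall y, {ae m1, forall x, h (x, y) = 0}}.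
Proof.
move=> [mr mi] H.
pose q (p : T1 * T2) : \bar R := (`|complex.Re (h p)| + `|complex.Im (h p)|)%:E.
have q0 p : (0 <= q p)%E by rewrite lee_fin addr_ge0.
have mq : measurable_fun setT q.
  apply/measurable_EFinP; apply: measurable_funD.
    exact: (measurableT_comp (@normr_measurable R setT) mr).
  exact: (measurableT_comp (@normr_measurable R setT) mi).
have qE p : q p = 0%E <-> h p = 0.
  rewrite /q; split=> [[/eqP]|->]; last by rewrite /= normr0 addr0.
  rewrite paddr_eq0// !normr_eq0 => /andP[/eqP hr /eqP hi].
  exact: eq_complex_parts.
have mqx x : measurable_fun setT (fun y => q (x, y)).
  exact: (measurableT_comp mq (measurable_pair1 x)).
have mqy y : measurable_fun setT (fun x => q (x, y)).
  exact: (measurableT_comp mq (measurable_pair2 y)).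
have mG : measurable_fun setT (fun y => \int[m1]_x q (x, y))%E.
  exact: measurable_fun_fubini_tonelli_G.
have mF : measurable_fun setT (fun x => \int[m2]_y q (x, y))%E.
  exact: measurable_fun_fubini_tonelli_F.
have F0 : {ae m1, forall x, (\int[m2]_y q (x, y) = 0)%E}.
  apply: filterS H => x hx.
  rewrite -(_ : \int[m2]_y `|q (x, y)| = \int[m2]_y q (x, y))%E.
    apply/(ae_eq_integral_abs m2 measurableT (mqx x)).
    by apply: filterS hx => y hxy _; apply/qE.
  by apply: eq_integral => y _; rewrite gee0_abs.
have E0 : (\int[m2]_y \int[m1]_x q (x, y) = 0)%E.
  rewrite -(fubini_tonelli q mq q0).
  rewrite -(_ : \int[m1]_x `|\int[m2]_y q (x, y)| = \int[m1]_x \int[m2]_y q (x, y))%E.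
    apply/(ae_eq_integral_abs m1 measurableT mF).
    by apply: filterS F0.
  by apply: eq_integral => x _; rewrite gee0_abs// integral_ge0.
have : ae_eq m2 setT (fun y => \int[m1]_x q (x, y))%E (cst 0%E).
  apply/(ae_eq_integral_abs m2 measurableT mG); rewrite -[RHS]E0.
  by apply: eq_integral => y _; rewrite gee0_abs// integral_ge0.
apply: filterS => y /(_ I) /= Gy.
have : ae_eq m1 setT (fun x => q (x, y)) (cst 0%E).
  apply/(ae_eq_integral_abs m1 measurableT (mqy y)); rewrite -[RHS]Gy.
  by apply: eq_integral => x _; rewrite gee0_abs.
by apply: filterS => x /(_ I) /qE.
Qed.

Section representations.
Context {R : realType} {n : nat}.
Local Notation mu := (@lebesgue_rV R n).
Local Notation V := 'rV[R]_n.
Local Notation Re := (@complex.Re R).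
Local Notation Im := (@complex.Im R).
Implicit Types (f g : V -> R[i]) (z : 'rV[R]_(n + n)).

Definition sesqui (a b c e : R) f g (x t : V) : R[i] :=
  f (b *: t + a *: x) * (g (e *: t + c *: x))^*.

(** The four representations are instances of one transform: a linear change of
    variables in f (x) conj g followed by a partial Fourier transform. *)
Definition tfr (a b c e : R) f g z : R[i] :=
  cint mu (fun t => expi (- (2 * pi * dot (rsubmx z) t)) *
                    sesqui a b c e f g (lsubmx z) t).

Lemma stftE f g : stft g f = tfr 0 1 (-1) 1 f g.
Proof.
apply/funext => z; congr (cint mu _); apply/funext => t.
by rewrite /sesqui mulrA dotC !scale1r scale0r addr0 scaleN1r.
Qed.

Lemma cross_wignerE f g : cross_wigner f g = tfr 1 2^-1 1 (- 2^-1) f g.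
Proof.
apply/funext => z; congr (cint mu _); apply/funext => t.
by rewrite /sesqui mulrA !scale1r scaleNr (addrC (lsubmx z)) (addrC (lsubmx z)).
Qed.

Lemma cross_ambiguityE f g : cross_ambiguity f g = tfr 2^-1 1 (- 2^-1) 1 f g.
Proof.
apply/funext => z; congr (cint mu _); apply/funext => t.
by rewrite /sesqui mulrA !scale1r scaleNr.
Qed.

Lemma L2_cmeasurable f : L2 f -> cmeasurable f.
Proof. by move=> [/sub_Lfun_mfun fr /sub_Lfun_mfun fi]; split; exact: (set_mem _). Qed.

Lemma L2_integrable f : L2 f -> mu.-integrable setT (fun t => (normc (f t) ^+ 2)%:E).
Proof.
move=> [/Lfun2_integrable_sqr ir /Lfun2_integrable_sqr ii].
apply: eq_integrable (integrableD measurableT ir ii) => // t _ /=.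
case: (f t) => u v /=; rewrite -EFinD; congr (_%:E).
by rewrite sqr_sqrtr// addr_ge0// sqr_ge0.
Qed.

Section sesqui_forms.
Variables (a b c e : R).
Hypotheses (b0 : b != 0) (e0 : e != 0).

Lemma cintegrable_sesqui f g x : L2 f -> L2 g ->
  cintegrable mu (sesqui a b c e f g x).
Proof.
move=> Lf Lg; have i1 := integrable_affine b0 (a *: x) (L2_integrable Lf).
have i2 := integrable_affine e0 (c *: x) (L2_integrable Lg).
apply: (cintegrable_dom (g := fun t : V => normc (f (b *: t + a *: x)) ^+ 2 +
                                       normc (g (e *: t + c *: x)) ^+ 2)).
- apply: cmeasurableM; first exact/cmeasurable_affine/L2_cmeasurable.
  exact/cmeasurable_conj/cmeasurable_affine/L2_cmeasurable.
- move=> t; rewrite normcM normc_conj.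
  set p := normc _; set q := normc _.
  by have := sqr_ge0 (p - q); have := sqr_ge0 p; have := sqr_ge0 q; nra.
- by apply: eq_integrable (integrableD measurableT i1 i2).
Qed.

Lemma cintegrable_tfr f g x w : L2 f -> L2 g ->
  cintegrable mu (fun t => expi (- (2 * pi * dot w t)) * sesqui a b c e f g x t).
Proof.
move=> Lf Lg; apply: (cintegrableM (A := 1) (cintegrable_sesqui x Lf Lg)).
  exact: cmeasurable_waveN.
by move=> t; rewrite normc_expi.
Qed.

(** Substituting representatives is harmless, as the arguments of f and g run
    through an affine bijection of the integration variable. *)
Lemma ae_eq_tfr f g phi psi : L2 f -> L2 g -> smooth phi -> smooth psi ->
  {ae mu, forall t, f t = phi t} -> {ae mu, forall t, g t = psi t} ->
  tfr a b c e f g = tfr a b c e phi psi.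
Proof.
move=> Lf Lg sp sq fphi gpsi; apply/funext => z; rewrite /tfr /sesqui.
set x := lsubmx z; set w := rsubmx z.
have mexp := cmeasurable_waveN (2 * pi) w.
have m2 h k : cmeasurable h -> cmeasurable k -> cmeasurable (fun t : V =>
    expi (- (2 * pi * dot w t)) * (h (b *: t + a *: x) * (k (e *: t + c *: x))^*)).
  move=> mh mk; apply: cmeasurableM => //; apply: cmeasurableM; first exact: cmeasurable_affine.
  exact/cmeasurable_conj/cmeasurable_affine.
apply: ae_eq_cint.
- by apply: m2; exact: L2_cmeasurable.
- by apply: m2; apply: ccont_cmeasurable; exact: smooth_ccont.
have := ae_affine e0 (c *: x) gpsi; have := ae_affine b0 (a *: x) fphi.
by apply: filterS2 => t E1 E2; rewrite E1 E2.
Qed.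

Hypothesis det0 : a * e - b * c != 0.
Let D := (a * e - b * c)^-1.

Let L : 'M[R]_(n + n) := block_mx a%:M c%:M b%:M e%:M.
Let L' : 'M[R]_(n + n) :=
  block_mx (D * e)%:M (- (D * c))%:M (- (D * b))%:M (D * a)%:M.

Let row_L (x t : V) : row_mx x t *m L = row_mx (b *: t + a *: x) (e *: t + c *: x).
Proof. by rewrite /L mul_row_block !mul_mx_scalar addrC (addrC (c *: x)). Qed.

Let row_L' (u v : V) :
  row_mx u v *m L' = row_mx (D *: (e *: u - b *: v)) (D *: (a *: v - c *: u)).
Proof.
rewrite /L' mul_row_block !mul_mx_scalar !scalerBr !scalerA !scaleNr.
by congr row_mx; rewrite addrC.
Qed.

Let LK z : affine L 0 z *m L' = z.
Proof.
rewrite /affine addr0 -[z]hsubmxK row_L row_L'.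
have DD : D * (a * e - b * c) = 1 by rewrite mulVf.
congr row_mx; apply/rowP => i; rewrite !mxE.
  by rewrite -[RHS]mul1r -DD; ring.
by rewrite -[RHS]mul1r -DD; ring.
Qed.

Let L'K z : affine L' 0 z *m L = z.
Proof.
rewrite /affine addr0 -[z]hsubmxK row_L' row_L.
have DD : D * (a * e - b * c) = 1 by rewrite mulVf.
congr row_mx; apply/rowP => i; rewrite !mxE.
  by rewrite -[RHS]mul1r -DD; ring.
by rewrite -[RHS]mul1r -DD; ring.
Qed.

Variables (sigma : R) (k : ultra_case).
Hypothesis sigma_gt1 : 1 < sigma.

Lemma word_class_tfr phi psi : word_class sigma k phi -> word_class sigma k psi ->
  word_class sigma k (tfr a b c e phi psi).
Proof.
move=> wp wq; pose G := tensor phi (fun v => (psi v)^*) \o affine L 0.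
rewrite (_ : tfr a b c e phi psi = pft (- (2 * pi)) G).
  apply: word_class_pft => //.
    by rewrite oppr_eq0 mulf_neq0// gt_eqF// pi_gt0.
  apply: (word_class_affine sigma_gt1 LK); apply: word_class_tensor => //.
  exact: word_class_conj.
apply/funext => z; congr (cint mu _); apply/funext => t.
rewrite /pft_kernel mulNr; congr (_ * _).
by rewrite /G /= /tensor /affine addr0 row_L row_mxKl row_mxKr.
Qed.

(** Inversion on each fibre x = const recovers the sesquilinear form. *)
Lemma ae_sesqui_pft f g x : L2 f -> L2 g -> rapid (tfr a b c e f g) ->
  {ae mu, forall t, sesqui a b c e f g x t = pft (2 * pi) (tfr a b c e f g) (row_mx x t)}.
Proof.
move=> Lf Lg rT; have [sT bT] := rT; have [A TA] := bT (2 * n)%N.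
set T := tfr a b c e f g in rT sT bT TA *.
have k0 : 2 * pi != 0 :> R by rewrite mulf_neq0// gt_eqF// pi_gt0.
have iT : cintegrable mu (fun w => T (row_mx x w)).
  have := kernel_cintegrable 0 (row_mx x 0) rT; congr cintegrable.
  by apply/funext => w; rewrite /pft_kernel mul0r expi0 mul1r row_mxKl.
have iP : cintegrable mu (fun t => pft (2 * pi) T (row_mx x t)).
  have rP : rapid (pft (2 * pi) T).
    split; first exact: smooth_pft.
    move=> N; have [B TB] := bT (N + 2 * n)%N.
    by eexists; exact: wbound_pft TB.
  have := kernel_cintegrable 0 (row_mx x 0) rP; congr cintegrable.
  by apply/funext => w; rewrite /pft_kernel mul0r expi0 mul1r row_mxKl.
have TE w : T (row_mx x w) =
    cint mu (fun t => expi (- (2 * pi * dot w t)) * sesqui a b c e f g x t).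
  by rewrite /T /tfr row_mxKl row_mxKr.
clearbody T.
apply: (fourier_inversion (cintegrable_sesqui x Lf Lg) iT TE iP) => s.
rewrite /pft; congr (cint mu _); apply/funext => w.
by rewrite /pft_kernel row_mxKl row_mxKr.
Qed.

(** The kernel K is the inverse partial transform in the original variables. It is
    known on each fibre x = const for almost every t; passing to (u, v) first
    replaces t by u for fixed x, then exchanges the quantifiers and replaces x by
    v for fixed u. *)
Lemma ae_tensor_pft f g : L2 f -> L2 g -> word_class sigma k (tfr a b c e f g) ->
  exists2 K : 'rV[R]_(n + n) -> R[i], word_class sigma k K &
  {ae mu, forall u, {ae mu, forall v, f u * (g v)^* = K (row_mx u v)}}.
Proof.
move=> Lf Lg wT.
have k0 : 2 * pi != 0 :> R by rewrite mulf_neq0// gt_eqF// pi_gt0.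
have wP : word_class sigma k (pft (2 * pi) (tfr a b c e f g)) by exact: word_class_pft.
exists (pft (2 * pi) (tfr a b c e f g) \o affine L' 0).
  exact: (word_class_affine sigma_gt1 L'K).
set P := pft _ _ in wP *.
have cP : ccont P by apply: smooth_ccont; exact: word_class_smooth wP.
have [mf mg] := (L2_cmeasurable Lf, L2_cmeasurable Lg).
(* With t = (u - a x) / b, the second argument c x + e t is an affine function
   of x for fixed u. *)
pose del := (b * c - a * e) / b.
have del0 : del != 0 by rewrite mulf_neq0 ?invr_eq0// -oppr_eq0 opprB.
have key x : {ae mu, forall u, f u * (g (del *: x + (e / b) *: u))^* =
    P (row_mx x (b^-1 *: u - (a / b) *: x))}.
  have binv0 : b^-1 != 0 by rewrite invr_eq0.
  have := ae_affine binv0 (- ((a / b) *: x)) (ae_sesqui_pft x Lf Lg (word_class_rapid wT)).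
  apply: filterS => u E; apply: etrans E; rewrite /sesqui.
  congr (f _ * (g _)^*).
    by apply/rowP => i; rewrite !mxE; field.
  by apply/rowP => i; rewrite !mxE /del; field.
clearbody P.
pose h (p : V * V) := f p.2 * (g (del *: p.1 + (e / b) *: p.2))^* -
  P (row_mx p.1 (b^-1 *: p.2 - (a / b) *: p.1)).
have mh : cmeasurable h.
  apply: cmeasurableB.
    apply: cmeasurableM; first exact: (cmeasurable_comp mf measurable_snd).
    apply: cmeasurable_conj; apply: (cmeasurable_comp mg).
    exact: (measurable_combine _ _ measurable_fst measurable_snd).
  apply: (cmeasurable_comp (ccont_cmeasurable cP)).
  apply: (measurable_row_mx measurable_fst); under eq_fun do rewrite -scaleNr.
  exact: (measurable_combine _ _ measurable_snd measurable_fst).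
have : {ae mu, forall u, {ae mu, forall x, h (x, u) = 0}}.
  apply: (ae_swap mh); apply: aeW => x; apply: filterS (key x) => u E.
  by rewrite /h /= E subrr.
apply: filterS => u hu.
have delV0 : del^-1 != 0 by rewrite invr_eq0.
have := ae_affine delV0 (- ((e / b / del) *: u)) hu.
apply: filterS => v /eqP; rewrite /h /= subr_eq0 => /eqP E.
have D0 : b * c - a * e != 0 by rewrite -oppr_eq0 opprB.
have {1}-> : v = del *: (del^-1 *: v - (e / b / del) *: u) + (e / b) *: u.
  by apply/rowP => i; rewrite !mxE; field; rewrite ?del0 b0.
rewrite E /affine addr0 row_L'; congr (P (row_mx _ _)).
  by apply/rowP => i; rewrite !mxE /del /D; field; rewrite ?det0 ?D0 b0.
by apply/rowP => i; rewrite !mxE /del /D; field; rewrite ?det0 ?D0 b0.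
Qed.

(** A nonzero value of one factor makes the other a slice of K. *)
Lemma in_S_ae_tfr f g : L2 f -> L2 g ->
  ~ {ae mu, forall x, f x = 0} -> ~ {ae mu, forall x, g x = 0} ->
  word_class sigma k (tfr a b c e f g) -> in_S_ae k sigma f /\ in_S_ae k sigma g.
Proof.
move=> Lf Lg f0 g0 wT; have [K wK fgK] := ae_tensor_pft Lf Lg wT.
have pick (h : V -> R[i]) (Q : V -> Prop) : ~ {ae mu, forall x, h x = 0} ->
    {ae mu, forall x, Q x} -> exists2 x, h x != 0 & Q x.
  move=> h0 aeQ; apply: contrapT => H; apply: h0; apply: filterS aeQ => x Qx.
  apply/eqP; apply: contrapT => /negP hx; apply: H; exists x => //.
have mfgK : cmeasurable (fun p : V * V => f p.1 * (g p.2)^* - K (row_mx p.1 p.2)).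
  have mK := ccont_cmeasurable (smooth_ccont (word_class_smooth wK)).
  apply: cmeasurableB; first apply: cmeasurableM.
  - exact: (cmeasurable_comp (L2_cmeasurable Lf) measurable_fst).
  - apply: cmeasurable_conj.
    exact: (cmeasurable_comp (L2_cmeasurable Lg) measurable_snd).
  exact: (cmeasurable_comp mK (measurable_row_mx measurable_fst measurable_snd)).
have gfK : {ae mu, forall v, {ae mu, forall u, f u * (g v)^* - K (row_mx u v) = 0}}.
  apply: (ae_swap mfgK); apply: filterS fgK => u; apply: filterS => v E.
  by rewrite /= E subrr.
split.
  have [v gv0 Ev] := pick _ _ g0 gfK.
  exists (fun u => ((g v)^*)^-1 * K (row_mx u v)).
    apply: word_class_in_S => //; apply: word_classZ; exact: word_class_slicel.
  apply: filterS Ev => u /eqP; rewrite subr_eq0 => /eqP <-.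
  by rewrite mulrCA mulVf ?mulr1// conjC_eq0.
have [u fu0 Eu] := pick _ _ f0 fgK.
exists (fun v => ((f u)^-1 * K (row_mx u v))^*).
  apply: word_class_in_S => //; apply: word_class_conj; apply: word_classZ.
  exact: word_class_slicer.
by apply: filterS Eu => v <-; rewrite mulKf// conjcK.
Qed.

End sesqui_forms.

End representations.

Section grossmann_royer_wigner.
Context {R : realType} {n : nat}.
Implicit Types (f g : 'rV[R]_n -> R[i]).

(** The substitution t = x - s / 2 turns one transform into the other. *)
Lemma cross_wigner_royer f g : L2 f -> L2 g ->
  cross_wigner f g = fun z => (2 ^+ n)%:C * grossmann_royer g f z.
Proof.
move=> Lf Lg; apply/funext => z; rewrite cross_wignerE /tfr.
have h0 : 2^-1 != 0 :> R by rewrite invr_eq0.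
have hN0 : - 2^-1 != 0 :> R by rewrite oppr_eq0.
have m20 : - 2 != 0 :> R by rewrite oppr_eq0.
have iW := cintegrable_tfr 1 1 h0 hN0 (lsubmx z) (rsubmx z) Lf Lg.
rewrite (cint_affine m20 (2 *: lsubmx z) iW).
rewrite normrN normr_nat; congr (_ * _).
congr (cint _ _); apply/funext => t; rewrite /sesqui mulrA.
congr (_ * _ * _).
- rewrite (_ : - 2 *: t + 2 *: lsubmx z = - 2 *: (t - lsubmx z)); last first.
    by apply/rowP => i; rewrite !mxE; ring.
  rewrite dotZr; congr expi; generalize (dot (rsubmx z) (t - lsubmx z)) (pi : R).
  by move=> r q; ring.
- by congr f; apply/rowP => i; rewrite !mxE; field.
- by congr (g _)^*; apply/rowP => i; rewrite !mxE; field.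
Qed.

End grossmann_royer_wigner.


Section coefficients.
Context {R : realType} {n : nat}.
Implicit Types (f g : 'rV[R]_n -> R[i]).

(** Up to a nonzero constant, each representation is an instance of the
    transform with invertible coefficients. *)
Lemma TFR_tfr f g T : L2 f -> L2 g -> TFR f g T ->
  exists a b c e q : R, [/\ b != 0, e != 0, a * e - b * c != 0, q != 0 &
    T = fun z => q%:C * tfr a b c e f g z].
Proof.
move=> Lf Lg.
have h0 : 2^-1 != 0 :> R by rewrite invr_eq0.
have hN0 : - 2^-1 != 0 :> R by rewrite oppr_eq0.
have det1 : 1 * - 2^-1 - 2^-1 * 1 != 0 :> R.
  by rewrite (_ : _ - _ = - 1) ?oppr_eq0 ?oner_neq0//; field.
have det2 : 2^-1 * 1 - 1 * - 2^-1 != 0 :> R.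
  by rewrite (_ : _ - _ = 1) ?oner_neq0//; field.
have scale1 (S : 'rV[R]_(n + n) -> R[i]) : S = fun z => (1 : R)%:C * S z.
  by apply/funext => z; rewrite mul1r.
have o0 := oner_neq0 R.
move=> [[[->|->]|->]|->].
- exists 1, 2^-1, 1, (- 2^-1), (2 ^- n).
  have q0 : 2 ^- n != 0 :> R by rewrite invr_eq0 expf_neq0.
  split; [exact: h0|exact: hN0|exact: det1|exact: q0|].
  apply/funext => z; rewrite -cross_wignerE cross_wigner_royer// mulrA -rmorphM.
  by rewrite mulVf ?mul1r// expf_neq0.
- exists 0, 1, (-1), 1, 1.
  have det0 : 0 * 1 - 1 * -1 != 0 :> R by rewrite mul0r mul1r sub0r opprK.
  split; [exact: o0|exact: o0|exact: det0|exact: o0|].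
  by rewrite -stftE.
- exists 1, 2^-1, 1, (- 2^-1), 1.
  split; [exact: h0|exact: hN0|exact: det1|exact: o0|].
  by rewrite -cross_wignerE.
- exists 2^-1, 1, (- 2^-1), 1, 1.
  split; [exact: o0|exact: o0|exact: det2|exact: o0|].
  by rewrite -cross_ambiguityE.
Qed.

End coefficients.

Theorem theorem5p3 (R : realType) (n : nat) (hn : (0 < n)%N)
    (sigma : R) (hsigma : 1 < sigma) (c : ultra_case) :
  (forall (f g : 'rV[R]_n -> R[i]) (T : 'rV[R]_(n + n) -> R[i]),
     L2 f -> L2 g -> in_S_ae c sigma f -> in_S_ae c sigma g ->
     TFR f g T -> in_S c sigma T)
  /\
  (forall (f g : 'rV[R]_n -> R[i]) (T : 'rV[R]_(n + n) -> R[i]),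
     L2 f -> L2 g ->
     ~ {ae lebesgue_rV n, forall x, f x = 0} ->
     ~ {ae lebesgue_rV n, forall x, g x = 0} ->
     TFR f g T -> in_S c sigma T ->
     in_S_ae c sigma f /\ in_S_ae c sigma g).
Proof.
split=> f g T Lf Lg.
  move=> [phi sphi fphi] [psi spsi gpsi] /TFR_tfr -/(_ Lf Lg).
  move=> [a [b [d [e [q [b0 e0 det0 _ ->]]]]]].
  have wphi := in_S_word_class hsigma sphi; have wpsi := in_S_word_class hsigma spsi.
  apply: word_class_in_S => //; apply: word_classZ.
  rewrite (ae_eq_tfr _ _ b0 e0 Lf Lg _ _ fphi gpsi); first exact: word_class_tfr.
    exact: word_class_smooth wphi.
  exact: word_class_smooth wpsi.
move=> f0 g0 /TFR_tfr -/(_ Lf Lg) [a [b [d [e [q [b0 e0 det0 q0 TE]]]]]] sT.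
apply: (in_S_ae_tfr b0 e0 det0 hsigma Lf Lg f0 g0).
have -> : tfr a b d e f g = fun z => (q^-1)%:C * T z.
  by apply/funext => z; rewrite TE mulrA -rmorphM mulVf// mul1r.
by apply: word_classZ; exact: in_S_word_class.
Qed.
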